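(* Let $1\le p<q<\infty$, $\alpha>0$, $r_0>0$ and $\lambda\ge1$. Assume that $E$ is totally bounded and that there are constants $C,\delta>0$ such that for all $x\in E$ and $0<r'<r\le r_0$, $$0<\mu(B(x,2r))\le C\mu(B(x,r))<\infty,\quad 0<\nu(B(x,2r))\le C\nu(B(x,r))<\infty,\quad\frac{\nu(B(x,r'))}{\nu(B(x,r))}\le C\Bigl(\frac{r'}r\Bigr)^\delta .$$ Let $\mathcal{Y}\subset P^{\alpha,p}_{\lambda,E}(X,\mu)$ be equipped with one of the norms $$\|u\|_{L^1(E,\nu)}+\|G(u)\|_{L^p(X,\mu)}\quad\text{or}\quad\|u\|_{L^1(X,\mu)}+\|G(u)\|_{L^p(X,\mu)},$$ where $G(u)$ is such that for all balls $B=B(x,r)$ with $x\in E$ and $0<r\le r_0$, $$\frac1{\mu(B)}\int_B|u-u_{B,\mu}|\,d\mu\le r^\alpha\biggl(\frac1{\mu(\lambda B)}\int_{\lambda B}G(u)^p\,d\mu\biggr)^{1/p}.$$ Let $$\Theta_{q,\lambda}(r):=\sup_{0<\rho\le r}\ \sup_{x\in E}\frac{\rho^\alpha\,\nu(B(x,\rho))^{1/q}}{\mu(B(x,\lambda\rho))^{1/p}},\quad0<r\le r_0 .$$ Then the following hold: (i) If $\Theta_{q,\lambda}(r_0)<\infty$, then the embedding $\mathcal{Y}\hookrightarrow L^{q'}(E,\nu)$ is compact for all $1\le q'<q$. (ii) If functions in $\mathcal{Y}$ satisfy the truncation property, then the embedding $\mathcal{Y}\hookrightarrow L^q(E,\nu)$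 is bounded when $\Theta_{q,\lambda}(r_0)<\infty$, and compact when $\Theta_{q,\lambda}(r)\to0$ as $r\to0$.
   Context: $(X,d)$ is a metric space with positive complete Borel measures $\mu,\nu$, and $E\subset X$ is $\nu$-measurable with $\nu(E)>0$. $B(x,r)$ is the open ball; balls come with a predetermined centre and radius; $\lambda B(x,r)=B(x,\lambda r)$; $u_{B,\mu}=\mu(B)^{-1}\int_Bu\,d\mu$. $L^1_{\rm loc}(X,\mu)$: integrable on all balls. $P^{\alpha,p}_{\tau,E}(X,\mu)$ ($\tau\ge1$) consists of all $u\in L^1_{\rm loc}(X,\mu)$ for which there is $0\le g\in L^p(X,\mu)$ with $$\frac1{\mu(B)}\int_B|u-u_{B,\mu}|\,d\mu\le r^\alpha\Bigl(\frac1{\mu(\tau B)}\int_{\tau B}g^p\,d\mu\Bigr)^{1/p}$$ for all balls $B=B(x,r)$ with $x\in E$ and $0<r\le r_0$. Truncation property: for each $u\in\mathcal{Y}$ and all $l<k$, the inequality $$\frac1{\mu(B)}\int_B|u_{l,k}-(u_{l,k})_{B,\mu}|\,d\mu\le C[\operatorname{diam}(B)]^\alpha\Bigl(\frac1{\mu(\lambda B)}\int_{\lambda B}g_{l,k}^p\,d\mu\Bigr)^{1/p}$$ holds for all balls $B$ centred in $E$ of radius at most $r_0$, where $u_{l,k}=\max\{l,\min\{u,k\}\}$, $g_{l,k}=G(u)\chi_{\{l<u<k\}}$ and $C$ is independent of $u,l,k,B$. Embeddings into $L^q(E,\nu)$ (and the norm $\|u\|_{L^1(E,\nu)}$) are understood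 through the representative $\bar u(x)=\limsup_{r\to0}\mu(B(x,r))^{-1}\int_{B(x,r)}u\,d\mu$, $x\in E$. The embedding is compact if every sequence in $\mathcal{Y}$ bounded in the chosen norm has a subsequence whose images converge in the target, and bounded if $\|\bar u\|_{L^q(E,\nu)}\le C\|u\|_{\mathcal{Y}}$ for all $u\in\mathcal{Y}$. $\mathcal{Y}$ need not be a linear space. *)

(* Defs.v *)
From HB Require Import structures.
From mathcomp Require Import all_boot all_order all_algebra.
From mathcomp Require Import all_classical all_reals all_analysis measurable_realfun.
Set Implicit Arguments.
Unset Strict Implicit.
Unset Printing Implicit Defensive.
Import Order.TTheory GRing.Theory Num.Theory.
Import numFieldNormedType.Exports.
Local Open Scope classical_set_scope.
Local Open Scope ring_scope.

(* Measurable types are pointed, whereas metric types need not be. *)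
#[short(type="pmetricType")]
HB.structure Definition PointedMetric (K : numDomainType) :=
  {M of Pointed M & Metric K M}.

Section metric_notions.
Context {R : realType} {X : metricType R}.

(* Only meaningful for nonempty bounded sets, e.g. for balls. *)
Definition diam (A : set X) : R := sup [set mdist z.1 z.2 | z in A `*` A].

Definition totally_bounded (E : set X) : Prop :=
  forall e : R, 0 < e ->
    exists2 F : set X, finite_set F & E `<=` \bigcup_(x in F) ball x e.

End metric_notions.

Section averages.
Context {d : measure_display} {T : measurableType d} {R : realType}.
Variable mu : {measure set T -> \bar R}.
Local Open Scope ereal_scope.

(* With the convention 1 / +oo = 0. *)
Definition mean (B : set T) (f : T -> \bar R) : \bar R :=
  (mu B)^-1 * \int[mu]_(y in B) f y.

Definition mean_osc (B : set T) (u : T -> R) : \bar R :=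
  mean B (fun y => `|u y - fine (mean B (EFin \o u))|%:E).

Definition Lp_mean (p : R) (B : set T) (g : T -> R) : \bar R :=
  mean B (fun y => (g y `^ p)%:E) `^ p^-1.

Definition Lp_norm (D : set T) (p : R) (f : T -> \bar R) : \bar R :=
  Lnorm mu p%:E (f \_ D).

Definition in_Lp (D : set T) (p : R) (f : T -> \bar R) : Prop :=
  measurable_fun D f /\ Lp_norm D p f < +oo.

End averages.

(* The two measures may live on different sigma-algebras, so these are not part
   of the structure of X: the sigma-algebra of a measure is <<s S>>, with S an
   arbitrary generating family (every sigma-algebra is of this form). *)
Section complete_borel.
Context {R : realType} {X : pmetricType R} {S : set (set X)}.
Variable mu : {measure set (g_sigma_algebraType S) -> \bar R}.

Definition complete_borel_measure : Prop :=
  (forall U : set X, open U -> <<s S >> U) /\ measure_is_complete mu.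

End complete_borel.

Section poincare_spaces.
Context {R : realType} {X : pmetricType R} {S : set (set X)}.
Variable mu : {measure set (g_sigma_algebraType S) -> \bar R}.
(* Functions are finite everywhere: integrability makes them finite mu-a.e., and
   changing u and g on mu-null sets affects none of the averages below. *)
Implicit Types (u g : X -> R) (E : set X) (Y : set (X -> R)).
Local Open Scope ereal_scope.

Definition L1loc : set (X -> R) :=
  [set u | forall (x : X) (r : R), (0 < r)%R ->
             mu.-integrable (ball x r) (EFin \o u)].

Definition poincare_gradient (alpha p tau r0 : R) E u g : Prop :=
  [/\ forall x, (0 <= g x)%R,
      in_Lp mu setT p (EFin \o g)
    & forall (x : X) (r : R), E x -> (0 < r <= r0)%R ->
        mean_osc mu (ball x r) u
          <= (r `^ alpha)%:E * Lp_mean mu p (ball x (tau * r)%R) g].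

Definition poincare_space (alpha p tau r0 : R) E : set (X -> R) :=
  [set u | L1loc u /\ exists g, poincare_gradient alpha p tau r0 E u g].

Definition trunc (l k : R) u : X -> R :=
  fun y => Num.max l (Num.min (u y) k).

Definition trunc_gradient (l k : R) u g : X -> R :=
  fun y => (g y * \1_[set z | (l < u z < k)%R] y)%R.

Definition truncation_property (alpha p lambda r0 : R) E Y
    (G : (X -> R) -> X -> R) : Prop :=
  exists C : R, forall u, Y u -> forall l k : R, (l < k)%R ->
    forall (x : X) (r : R), E x -> (0 < r <= r0)%R ->
      mean_osc mu (ball x r) (trunc l k u)
        <= (C * diam (ball x r) `^ alpha)%:E
           * Lp_mean mu p (ball x (lambda * r)%R) (trunc_gradient l k u (G u)).

Definition ubar u : X -> \bar R :=
  fun x => limf_esup (fun r : R => mean mu (ball x r) (EFin \o u)) (0%R)^'+.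

End poincare_spaces.

Section embeddings.
Context {R : realType} {X : pmetricType R} {Smu Snu : set (set X)}.
Variable mu : {measure set (g_sigma_algebraType Smu) -> \bar R}.
Variable nu : {measure set (g_sigma_algebraType Snu) -> \bar R}.
Implicit Types (u g v : X -> R) (E : set X) (Y : set (X -> R)).
Local Open Scope ereal_scope.

Definition norm_E_nu (p : R) E (G : (X -> R) -> X -> R) u : \bar R :=
  Lp_norm nu E 1 (ubar mu u) + Lp_norm mu setT p (EFin \o G u).

Definition norm_X_mu (p : R) (G : (X -> R) -> X -> R) u : \bar R :=
  Lp_norm mu setT 1 (EFin \o u) + Lp_norm mu setT p (EFin \o G u).

(* Well-definedness of u |-> ubar as a map from Y to L^q(E, nu). *)
Definition embeds Y E (q : R) : Prop :=
  forall u, Y u -> in_Lp nu E q (ubar mu u).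

Definition bounded_embedding Y (NY : (X -> R) -> \bar R) E (q : R) : Prop :=
  embeds Y E q /\
  exists C : R, forall u, Y u -> Lp_norm nu E q (ubar mu u) <= C%:E * NY u.

Definition compact_embedding Y (NY : (X -> R) -> \bar R) E (q : R) : Prop :=
  embeds Y E q /\
  forall w : nat -> X -> R, (forall n, Y (w n)) ->
    (exists M : R, forall n, NY (w n) <= M%:E) ->
    exists phi : nat -> nat, {homo phi : m n / (m < n)%N} /\
    exists2 v : X -> R, in_Lp nu E q (EFin \o v) &
      Lp_norm nu E q (fun x => ubar mu (w (phi n)) x - (v x)%:E)
        @[n --> \oo] --> 0.

Definition Theta (alpha p q lambda : R) E (r : R) : \bar R :=
  ereal_sup
    [set ereal_sup
       [set (rho `^ alpha)%:E * nu (ball x rho) `^ q^-1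
            / mu (ball x (lambda * rho)%R) `^ p^-1 | x in E]
    | rho in [set rho : R | (0 < rho <= r)%R]].

End embeddings.

(* Main.v *)
Require Import Defs.
From HB Require Import structures.
From mathcomp Require Import all_boot all_order all_algebra finmap.
From mathcomp Require Import all_classical all_reals all_analysis measurable_realfun.
From mathcomp Require Import lra zify.
Set Implicit Arguments.
Unset Strict Implicit.
Unset Printing Implicit Defensive.
Import Order.TTheory GRing.Theory Num.Theory.
Import numFieldNormedType.Exports.
Local Open Scope classical_set_scope.
Local Open Scope ring_scope.

(* Summing the Poincare inequality over the dyadic balls centred at [x] bounds
   [|ubar u x - u_B|] by a series of averages of [g ^ p].  Hedberg's splitting bounds
   this series by the maximal function of [g ^ p] and the finiteness of [Theta], and
   a Vitali covering then gives, for balls [B] of radius [r],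
     [nu {x | |ubar u x - u_B| > t} <= C (Theta r * norm(g) / t) ^ q],
   as well as the existence of Lebesgue points outside a [nu]-null set.

   Given a bounded sequence, the averages over the balls of a countable family of nets
   converge along a subsequence, and the weak type estimate at small scales, where the
   [Theta] of a smaller exponent is small, makes [ubar] of a further subsequence
   converge [nu]-almost everywhere (Borel-Cantelli).  Vitali's convergence theorem
   upgrades this to convergence of the norms as soon as the tails of [|ubar u| ^ q'] are
   uniformly small.  For [q' < q] this follows from the weak type estimate; for
   [q' = q] it follows from Maz'ya's truncation, where the factor [Theta r ^ q] in front
   of the tail bound tends to [0]. *)

(** * Averages *)

(** [Y] need not be linear and truncation is assumed for its members only, so compactness cannot
    come from estimating differences [w m - w n]. Every estimate therefore concerns a single
    function, and functions are compared only through their averages over finitely many balls at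
    each scale.

    The finiteness of [Theta] trades negative powers of [mu (lam B)] for [nu B ^ (- 1/q)]. These
    blow up along shrinking balls, and boundedness of the integrals of [g ^ p] alone does not
    compensate; this is why the maximal function divides [mu]-integrals by [nu]-measures.

    [ubar] is a limsup over a continuum of radii, and [mu] and [nu] may have different
    sigma-algebras. Measurability for [nu] is obtained from lower semicontinuity of integrals over
    open balls and from completeness of [nu].

    The norm on [E] does not control integrals of [u] against [mu]. Averages are bounded in that
    case by comparing them with [ubar] on a large part of [E] inside the ball. *)

Section averages.
Context {d : measure_display} {T : measurableType d} {R : realType}.
Variable mu : {measure set T -> \bar R}.
Implicit Types (A B : set T) (v w : T -> R) (c : R).

Definition avg B v : R := fine (mean mu B (EFin \o v)).
Definition dev B v c : R := avg B (fun y => `|v y - c|).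
(** Inverses of [0] and [+oo], and [fine] of an infinite value, are defaults; on these sets [avg] of
    an integrable function is a genuine mean. *)
Definition fin_pos B := measurable B /\ (0 < mu B < +oo)%E.

Lemma fin_pos_fine {B} : fin_pos B -> 0 < fine (mu B).
Proof. by case=> _ /fine_gt0. Qed.

Lemma fin_posK {B} : fin_pos B -> (fine (mu B))%:E = mu B.
Proof. by case=> _ /andP[/ltW B0 Boo]; rewrite fineK// ge0_fin_numE. Qed.

Lemma fin_pos_inv {B} : fin_pos B -> ((mu B)^-1 = (fine (mu B))^-1%:E)%E.
Proof.
move=> hB; rewrite -(fin_posK hB) inver ifF//.
by apply/negbTE; rewrite gt_eqF// fin_pos_fine.
Qed.

Lemma avgE B v : fin_pos B -> mu.-integrable B (EFin \o v) ->
  avg B v = (fine (mu B))^-1 * \int[mu]_(y in B) v y.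
Proof.
move=> hB iv; rewrite /avg /mean fin_pos_inv// fineM//.
by apply: integrable_fin_num => //; case: hB.
Qed.

Lemma mean_avg B v : fin_pos B -> mu.-integrable B (EFin \o v) ->
  mean mu B (EFin \o v) = (avg B v)%:E.
Proof.
move=> hB iv; rewrite /avg fineK// /mean fin_pos_inv// fin_numM//.
by apply: integrable_fin_num => //; case: hB.
Qed.

Lemma integrable_cst B c : fin_pos B -> mu.-integrable B (EFin \o cst c).
Proof.
move=> [mB /andP[_ Boo]]; apply/integrableP; split.
  exact/measurable_EFinP/measurable_cst.
rewrite (@eq_integral _ _ _ _ _ (cst `|c|%:E))//.
by rewrite integral_cst// lte_mul_pinfty// lee_fin.
Qed.

Lemma integrable_dist B v c : fin_pos B -> mu.-integrable B (EFin \o v) ->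
  mu.-integrable B (EFin \o (fun y => `|v y - c|)).
Proof.
move=> hB iv; have mB := hB.1.
have := integrable_abse (integrableB mB iv (integrable_cst c hB)).
exact: eq_integrable.
Qed.

Lemma mean_osc_dev B v : fin_pos B -> mu.-integrable B (EFin \o v) ->
  mean_osc mu B v = (dev B v (avg B v))%:E.
Proof.
by move=> hB iv; rewrite -mean_avg//; exact: integrable_dist.
Qed.

Lemma dev_ge0 B v c : 0 <= dev B v c.
Proof.
by apply: fine_ge0; rewrite mule_ge0 ?inve_ge0 ?integral_ge0// => y _; rewrite lee_fin.
Qed.

(** The function and the constant may change together with the set: [w = v] compares averages over
    nested balls, while [w] a truncation of [v] and [c'] the truncated constant compares averages
    before and after truncation. *)
Lemma avg_dist_le (K : R) B' B v w c c' : fin_pos B' -> fin_pos B -> B' `<=` B ->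
  fine (mu B) <= K * fine (mu B') ->
  mu.-integrable B (EFin \o v) -> mu.-integrable B' (EFin \o w) ->
  (forall y, B' y -> `|w y - c'| <= `|v y - c|) ->
  `|avg B' w - c'| <= K * dev B v c.
Proof.
move=> hB' hB B'B BK iv iw wv.
have [mB' mB] := (hB'.1, hB.1).
have b'0 := fin_pos_fine hB'; have b0 := fin_pos_fine hB.
have ic : mu.-integrable B' (EFin \o cst c').
  exact: integrable_cst.
have -> : avg B' w - c' = (fine (mu B'))^-1 * \int[mu]_(y in B') (w y - c').
  by rewrite avgE// RintegralB// Rintegral_cst// mulrBr mulrCA mulVf ?mulr1// gt_eqF.
rewrite normrM ger0_norm ?invr_ge0 ?(ltW b'0)//.
have iwc : mu.-integrable B' (EFin \o (fun y => w y - c')).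
  by have := integrableB mB' iw ic; apply: eq_integrable.
have ivc := integrable_dist c hB iv.
have ivc' : mu.-integrable B' (EFin \o (fun y => `|v y - c|)).
  exact: integrableS ivc.
rewrite /dev avgE// ler_pdivrMl//.
apply: (le_trans (le_normr_Rintegral mB' iwc)).
have h1 : \int[mu]_(t in B') `|w t - c'| <= \int[mu]_(t in B') `|v t - c|.
  by apply: le_Rintegral => //; exact: integrable_dist.
apply: (le_trans h1).
have h2 : \int[mu]_(t in B') `|v t - c| <= \int[mu]_(t in B) `|v t - c|.
  rewrite /Rintegral fine_le//; [exact: integrable_fin_num..|].
  apply: ge0_subset_integral => //; exact: measurable_int ivc.
apply: (le_trans h2).
set J := (X in X <= _).
have J0 : 0 <= J by apply: Rintegral_ge0.
rewrite mulrA mulrA -[leLHS]mul1r ler_wpM2r//.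
by rewrite ler_pdivlMr// mul1r mulrC.
Qed.

Lemma dev_le_avg B v c c' : fin_pos B -> mu.-integrable B (EFin \o v) ->
  dev B v c <= dev B v c' + `|c' - c|.
Proof.
move=> hB iv; have [mB _] := hB; have b0 := fin_pos_fine hB.
have i1 := integrable_dist c hB iv; have i2 := integrable_dist c' hB iv.
have i3 : mu.-integrable B (EFin \o cst `|c' - c|).
  exact: integrable_cst.
rewrite /dev !avgE// ler_pdivrMl// mulrDr mulrA mulfV ?gt_eqF// mul1r.
rewrite [X in _ + X]mulrC -Rintegral_cst// -RintegralD//.
apply: le_Rintegral => //.
  by have := integrableD mB i2 i3; apply: eq_integrable.
by move=> y _; rewrite (le_trans _ (ler_normD _ _))// [v y - c' + _]addrA subrK.
Qed.

End averages.

(** * Tails and Vitali convergence *)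

Lemma dyadic_bracket {R : realType} (t0 a : R) : 0 < t0 -> t0 <= a ->
  exists k : nat, 2 ^+ k * t0 <= a < 2 ^+ k.+1 * t0.
Proof.
move=> t00 ta.
have ex : exists k : nat, a < 2 ^+ k * t0.
  exists (Num.truncn (a / t0)).+1; rewrite -ltr_pdivrMr//.
  have /truncn_itv/andP[_ h] : 0 <= a / t0 by rewrite divr_ge0// ltW// (lt_le_trans t00).
  by rewrite (lt_le_trans h)// -natrX ler_nat ltnW// ltn_expl.
case: (ex_minnP ex) => -[|k] hk mk.
  by move: hk; rewrite expr0 mul1r ltNge ta.
exists k; rewrite hk andbT leNgt; apply/negP => /mk.
by rewrite ltnn.
Qed.

Section tails.
Context {d : measure_display} {T : measurableType d} {R : realType}.
Variable nu : {measure set T -> \bar R}.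
Implicit Types (D : set T) (f : T -> R).

(** On a set of finite measure, uniform smallness of this quantity for large [t] is uniform
    integrability of [|f| ^ q]. *)
Definition tail D f (q t : R) : \bar R :=
  \int[nu]_(x in D `&` [set x | t <= `|f x|]) (`|f x| `^ q)%:E.

Lemma measurable_level D f (t : R) : measurable D -> measurable_fun D f ->
  measurable (D `&` [set x | t <= `|f x|]).
Proof.
move=> mD mf.
have mnf : measurable_fun D (fun x => `|f x|) by exact: measurableT_comp.
have := mnf mD _ (measurable_itv `[t, +oo[); congr measurable.
by congr (_ `&` _); apply/seteqP; split => x /=; rewrite in_itv/= andbT.
Qed.

Lemma measurable_normpow D f (q : R) : measurable_fun D f ->
  measurable_fun D (fun x => (`|f x| `^ q)%:E).
Proof.
move=> mf; apply/measurable_EFinP.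
apply: (measurableT_comp (f := fun z : R => z `^ q)); first exact: measurable_powR.
exact: measurableT_comp.
Qed.

(** Dyadic layer cake. Whole level sets replace the annuli because weak type estimates bound exactly
    their measures. *)
Lemma tail_le_series D f (q t0 : R) : measurable D -> measurable_fun D f ->
  0 < q -> 0 < t0 ->
  (tail D f q t0 <= \sum_(k <oo) ((2 ^+ k.+1 * t0) `^ q)%:E *
      nu (D `&` [set x | 2 ^+ k * t0 <= `|f x|])%R)%E.
Proof.
move=> mD mf q0 t00.
pose L k : set T := D `&` [set x | 2 ^+ k * t0 <= `|f x|]%R.
have mL k : measurable (L k) by exact: measurable_level.
have -> : (\sum_(k <oo) ((2 ^+ k.+1 * t0) `^ q)%:E * nu (L k) =
    \int[nu]_(x in D) \sum_(k <oo) ((2 ^+ k.+1 * t0) `^ q)%:E * (\1_(L k) x)%:E)%E.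
  rewrite integral_nneseries//.
  - apply: eq_eseriesr => k _; rewrite ge0_integralZl_EFin ?powR_ge0//.
    + by rewrite integral_indic// setIC setIA setIid.
    + exact/measurable_EFinP.
  - move=> k; apply: measurable_funeM; exact/measurable_EFinP.
  - by move=> k x _; rewrite mule_ge0// lee_fin ?powR_ge0.
rewrite /tail.
pose S x : \bar R := (\sum_(k <oo) ((2 ^+ k.+1 * t0) `^ q)%:E * (\1_(L k) x)%:E)%E.
have mS : measurable_fun D S.
  apply: ge0_emeasurable_sum => [k x Dx _|k _].
    by rewrite mule_ge0// lee_fin ?powR_ge0.
  apply: measurable_funeM; exact/measurable_EFinP.
have S0 x : (0 <= S x)%E.
  by apply: nneseries_ge0 => k _ _; rewrite mule_ge0// lee_fin ?powR_ge0.
have m1 := measurable_level t0 mD mf.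
have DD : D `&` [set x | t0 <= `|f x|] `<=` D by [].
apply: (@le_trans _ _ (\int[nu]_(x in D `&` [set x | t0 <= `|f x|]%R) S x)%E); last first.
  exact: ge0_subset_integral.
apply: ge0_le_integral => //.
- by apply: measurable_normpow; exact: measurable_funS mf.
- exact: measurable_funS mS.
- move=> x [Dx /= tx].
  have [k /andP[k1 k2]] := dyadic_bracket t00 tx.
  apply: (@le_trans _ _ ((2 ^+ k.+1 * t0) `^ q)%:E).
    rewrite lee_fin; apply: ge0_ler_powR; rewrite ?nnegrE ?(ltW q0) ?normr_ge0 ?(ltW k2)//.
    by rewrite mulr_ge0 ?exprn_ge0// ltW.
  apply: le_trans (nneseries_lim_ge k.+1 _); last first.
    by move=> n _ _; rewrite mule_ge0// lee_fin ?powR_ge0.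
  rewrite big_nat_recr//= indicE mem_set ?mule1; last by [].
  by rewrite leeDr// sume_ge0// => n _; rewrite mule_ge0// lee_fin ?powR_ge0.
Qed.

Lemma tailE D f (q t : R) :
  tail D f q t = (\int[nu]_(x in D)
    ((fun x => (`|f x| `^ q)%R%:E) \_ [set x | t <= `|f x|]%R) x)%E.
Proof. by rewrite /tail integral_mkcondr. Qed.

Lemma measurable_fun_restrict D (B : set T) (F : T -> R) : measurable (D `&` B) ->
  measurable_fun D (fun x => (F x)%:E) ->
  measurable_fun D ((fun x => (F x)%:E) \_ B).
Proof.
move=> mDB mF.
apply: (@eq_measurable_fun _ _ _ _ D (fun x => (F x * \1_(D `&` B) x)%:E)).
  move=> x /set_mem Dx; rewrite patchE indicE.
  case: ifPn => [/set_mem Bx|/negP Bx]; first by rewrite mem_set// mulr1.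
  rewrite memNset ?mulr0// => -[_ ?]; exact/Bx/mem_set.
by apply/measurable_EFinP/measurable_funM => //; exact/measurable_EFinP.
Qed.

Lemma measurable_tail D f (q t : R) : measurable D -> measurable_fun D f ->
  measurable_fun D ((fun x => (`|f x| `^ q)%:E) \_ [set x | t <= `|f x|]).
Proof.
move=> mD mf; apply: measurable_fun_restrict; first exact: measurable_level.
exact: measurable_normpow.
Qed.

Lemma integral_normpow_le_tail D f (q t : R) : measurable D -> measurable_fun D f ->
  0 < q -> 0 <= t ->
  (\int[nu]_(x in D) (`|f x| `^ q)%:E <= (t `^ q)%:E * nu D + tail D f q t)%E.
Proof.
move=> mD mf q0 t0; rewrite tailE -integral_cst//.
rewrite -ge0_integralD//; last 2 first.
- by move=> x _; rewrite erestrict_ge0// => y; rewrite lee_fin powR_ge0.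
- exact: measurable_tail.
apply: ge0_le_integral => //.
- exact: measurable_normpow.
- by apply: emeasurable_funD => //; exact: measurable_tail.
move=> x Dx; rewrite patchE; case: ifPn => [_|/negP tx].
  by rewrite leeDr// lee_fin powR_ge0.
rewrite adde0 lee_fin ge0_ler_powR ?nnegrE ?(ltW q0)//.
by rewrite leNgt; apply/negP => /ltW xt; apply: tx; rewrite inE.
by move=> x _; rewrite lee_fin powR_ge0.
Qed.

End tails.

Lemma cvge0_le {R : realType} (u : (\bar R)^nat) : (forall n, 0 <= u n)%E ->
  (forall e : R, 0 < e -> exists N, forall n, (N <= n)%N -> (u n <= e%:E)%E) ->
  u @ \oo --> 0%E.
Proof.
move=> u0 ue; apply/fine_cvgP; split.
  have [N hN] := ue 1 ltr01; exists N => // n /= Nn.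
  by rewrite ge0_fin_numE// (le_lt_trans (hN _ Nn))// ltry.
apply/cvgrPdist_le => e e0; have [N hN] := ue e e0; exists N => // n /= Nn.
have un : u n \is a fin_num.
  by rewrite ge0_fin_numE// (le_lt_trans (hN _ Nn))// ltry.
by rewrite sub0r normrN ger0_norm ?fine_ge0// -lee_fin fineK// hN.
Qed.

(** Stands in for convexity or subadditivity of the power: the disjunction says
    [x <= c * Num.max a b], which suffices for every [q > 0]. *)
Lemma powR_le_add {R : realType} (q c x a b : R) : 0 < q -> 0 <= c -> 0 <= x ->
  0 <= a -> 0 <= b -> x <= c * a \/ x <= c * b ->
  x `^ q <= c `^ q * (a `^ q + b `^ q).
Proof.
move=> q0 c0 x0 a0 b0 h.
suff [h'|h'] : x `^ q <= c `^ q * a `^ q \/ x `^ q <= c `^ q * b `^ q.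
- by rewrite (le_trans h')// mulrDr lerDl mulr_ge0// powR_ge0.
- by rewrite (le_trans h')// mulrDr lerDr mulr_ge0// powR_ge0.
by case: h => h; [left|right]; rewrite -powRM//;
  apply: ge0_ler_powR => //; rewrite ?nnegrE ?mulr_ge0// ltW.
Qed.

Lemma powR_continuous {R : realType} (q a : R) : 0 < a ->
  {for a, continuous (fun z : R => z `^ q)}.
Proof.
move=> a0; apply: differentiable_continuous; apply/derivable1_diffP.
by apply: derivable_powR; rewrite in_itv/= a0.
Qed.

Lemma cvg_norm_powR0 {R : realType} (q : R) (u : nat -> R) (l : R) : 0 < q ->
  u @ \oo --> l -> (`|u n - l| `^ q) @[n --> \oo] --> 0.
Proof.
move=> q0 /cvgrPdist_le ul; apply/cvgrPdist_le => e e0.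
have := ul (e `^ q^-1) (powR_gt0 _ e0); apply: filterS => n h.
rewrite sub0r normrN ger0_norm ?powR_ge0// distrC.
have -> : e = (e `^ q^-1) `^ q by rewrite -powRrM mulVf ?gt_eqF// powRr1// ltW.
by rewrite ge0_ler_powR ?nnegrE ?powR_ge0// ltW.
Qed.

Section vitali_convergence.
Context {d : measure_display} {T : measurableType d} {R : realType}.
Variable nu : {measure set T -> \bar R}.
Variables (D : set T) (f : nat -> T -> R) (v : T -> R) (q : R).
Hypotheses (mD : measurable D) (Doo : (nu D < +oo)%E) (q0 : 0 < q).
Hypothesis mf : forall n, measurable_fun D (f n).
Hypothesis fv : forall x, D x -> f n x @[n --> \oo] --> v x.

Let mv : measurable_fun D v.
Proof. by apply: (measurable_fun_cvg mf) => x Dx; exact: fv. Qed.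

(** Fatou's lemma. The threshold doubles because [2 * t <= |v x|] forces [t <= |f n x|] eventually,
    so that the restricted powers converge there; at the threshold [t] itself they need not. *)
Lemma tail_lim_le (t e : R) : 0 < t ->
  (forall n, tail nu D (f n) q t <= e%:E)%E -> (tail nu D v q (2 * t) <= e%:E)%E.
Proof.
move=> t0 fe.
pose g n : T -> \bar R := (fun x => (`|f n x| `^ q)%:E) \_ [set x | t <= `|f n x|].
pose D' := D `&` [set x | 2 * t <= `|v x|].
have mD' : measurable D' by exact: measurable_level.
have D'D : D' `<=` D := @subIsetl _ _ _.
have mg n : measurable_fun D (g n) by exact: measurable_tail.
have g0 n x : (0 <= g n x)%E.
  by rewrite /g; apply: erestrict_ge0 => y; rewrite lee_fin powR_ge0.
have -> : tail nu D v q (2 * t) = (\int[nu]_(x in D') limn_einf (g^~ x))%E.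
  apply: eq_integral => x /set_mem[Dx /= vx].
  suff /cvg_limn_einf_sup[-> _] : g n x @[n --> \oo] --> (`|v x| `^ q)%:E by [].
  have v0 : 0 < `|v x| by rewrite (lt_le_trans _ vx)// mulr_gt0.
  have nfv : `|f n x| @[n --> \oo] --> `|v x| by apply: cvg_norm; exact: fv.
  have h : (`|f n x| `^ q)%:E @[n --> \oo] --> (`|v x| `^ q)%:E.
    apply: cvg_EFin; first by near=> n.
    exact: (cvg_comp _ _ nfv (powR_continuous v0)).
  apply: cvg_trans h; apply: near_eq_cvg.
  have /cvgrPdist_lt/(_ t t0) := nfv; apply: filterS => n hn.
  rewrite /g patchE mem_set//=.
  move: hn vx; rewrite ltr_distlC => /andP[]; lra.
apply: (le_trans (fatou nu mD' _ _)) => //.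
  by move=> n; exact: measurable_funS (mg n).
rewrite limn_einf_lim; apply: lime_le; first exact: is_cvg_einfs.
apply: nearW => n; apply: (@le_trans _ _ (tail nu D (f n) q t)) => //.
rewrite tailE; apply: (@le_trans _ _ (\int[nu]_(x in D') g n x)%E).
  by apply: ereal_inf_lbound; exists n => //=.
exact: ge0_subset_integral.
Unshelve. all: by end_near. Qed.

Hypothesis tight : forall e, 0 < e ->
  exists2 t, 0 < t & forall n, (tail nu D (f n) q t <= e%:E)%E.

Lemma vitali_limit_lty : (\int[nu]_(x in D) (`|v x| `^ q)%:E < +oo)%E.
Proof.
have [t t0 ft] := tight ltr01.
apply: (le_lt_trans (@integral_normpow_le_tail _ _ _ nu D v q (2 * t) mD mv q0 _)).
  by rewrite mulr_ge0// ltW.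
rewrite lte_add_pinfty// ?lte_mul_pinfty ?lee_fin ?powR_ge0//.
by rewrite (le_lt_trans (tail_lim_le t0 ft))// ltry.
Qed.

Lemma vitali_convergence :
  (\int[nu]_(x in D) (`|f n x - v x| `^ q)%:E)%E @[n --> \oo] --> 0%E.
Proof.
apply: cvge0_le => [n|e e0].
  by apply: integral_ge0 => x _; rewrite lee_fin powR_ge0.
(* The bounds below add up to [e1 + 4 ^ q * (e1 + e1)], at most [e] because [1 <= 4 ^ q]. *)
pose e1 := e / (3 * 4 `^ q).
have c0 : 0 < (4 : R) `^ q by rewrite powR_gt0.
have e10 : 0 < e1 by rewrite divr_gt0// mulr_gt0.
have [t t0 ft] := tight e10.
pose L n := [set x | t <= `|f n x|].
pose h n : T -> \bar R := (fun x => (`|f n x - v x| `^ q)%:E) \_ (~` (L n)).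
pose g n : T -> \bar R := (fun x => (`|f n x| `^ q)%:E) \_ (L n).
pose w : T -> \bar R := (fun x => (`|v x| `^ q)%:E) \_ [set x | 2 * t <= `|v x|].
have mB n : measurable_fun D (fun x => f n x - v x) by exact: measurable_funB.
have mh n : measurable_fun D (h n).
  apply: measurable_fun_restrict; last exact: measurable_normpow.
  have -> : D `&` ~` L n = D `\` (D `&` L n) by rewrite setDIr setDv set0U.
  exact/measurableD/measurable_level.
have mg n : measurable_fun D (g n) by exact: measurable_tail.
have mw : measurable_fun D w by exact: measurable_tail.
have h0 n x : (0 <= h n x)%E.
  by apply: erestrict_ge0 => y; rewrite lee_fin powR_ge0.
have g0 n x : (0 <= g n x)%E.
  by apply: erestrict_ge0 => y; rewrite lee_fin powR_ge0.
have w0 x : (0 <= w x)%E.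
  by apply: erestrict_ge0 => y; rewrite lee_fin powR_ge0.
(* [h] carries the part where [|f n| < t]. Elsewhere either [|v| < 2 * t <= 2 * |f n|], and [|f n|]
   alone dominates, or the tail [w] of [v] takes part. *)
have ptw n x : ((`|f n x - v x| `^ q)%:E <= h n x + (4 `^ q)%:E * (g n x + w x))%E.
  rewrite /h /g /w !patchE in_setC; case: ifPn => /= [|/negPn fx].
    move=> fx; rewrite leeDl// mule_ge0 ?adde_ge0 ?lee_fin//.
      by case: ifPn => // _; rewrite lee_fin powR_ge0.
    by case: ifPn => // _; rewrite lee_fin powR_ge0.
  rewrite add0e fx; move: fx => /set_mem; rewrite /L /= => fx.
  case: ifPn => [/set_mem/= vx|/negP vx].
    rewrite -EFinD -EFinM lee_fin powR_le_add//.
    have [fv'|/ltW vf] := leP `|f n x| `|v x|.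
      by right; have := (ler_normB (f n x) (v x), normr_ge0 (f n x), normr_ge0 (v x)) => -[[]]; lra.
    by left; have := (ler_normB (f n x) (v x), normr_ge0 (f n x), normr_ge0 (v x)) => -[[]]; lra.
  have {}vx : `|v x| < 2 * t by rewrite ltNge; apply/negP => ?; apply: vx; rewrite inE.
  rewrite adde0 -EFinM lee_fin -powRM// ge0_ler_powR ?nnegrE ?mulr_ge0 ?(ltW q0)//.
  by have := (ler_normB (f n x) (v x), normr_ge0 (f n x), normr_ge0 (v x)) => -[[]]; lra.
have ih : (\int[nu]_(x in D) h n x)%E @[n --> \oo] --> 0%E.
  have -> : 0%E = (\int[nu]_(x in D) (cst 0%E x))%E by rewrite integral0.
  (* Dominates [h n], which lives where [|f n - v| <= t + |v|]; it is integrable since [D] has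
     finite measure and by [vitali_limit_lty]. *)
  pose G x : \bar R := ((2 `^ q)%:E * ((t `^ q)%:E + (`|v x| `^ q)%:E))%E.
  apply: (@dominated_cvg _ _ _ nu D mD h (cst 0%E) G) => //.
  - move=> x Dx; apply: (@squeeze_cvge _ _ _ _ (cst 0%E) _
        (fun n => (`|f n x - v x| `^ q)%:E)).
    + apply: nearW => n; rewrite h0/= /h patchE.
      by case: ifPn => // _; rewrite lee_fin powR_ge0.
    + exact: cvg_cst.
    + by apply: cvg_EFin; [exact: nearW|apply: cvg_norm_powR0 => //; exact: fv].
  - apply/integrableP; split.
      by apply: measurable_funeM; apply: emeasurable_funD => //; exact: measurable_normpow.
    under eq_integral do rewrite gee0_abs ?mule_ge0 ?adde_ge0 ?lee_fin ?powR_ge0//.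
    have mvq := measurable_normpow q mv.
    rewrite ge0_integralZl_EFin ?powR_ge0//; last 2 first.
    + by move=> x _; rewrite adde_ge0 ?lee_fin ?powR_ge0.
    + exact: emeasurable_funD.
    rewrite ge0_integralD//; last first.
    + by move=> x _; rewrite lee_fin powR_ge0.
    rewrite integral_cst// lte_mul_pinfty ?lee_fin ?powR_ge0//.
    by rewrite lte_add_pinfty ?lte_mul_pinfty ?lee_fin ?powR_ge0// vitali_limit_lty.
  - move=> n x Dx; rewrite gee0_abs// /h /G patchE; case: ifPn => [|_].
      rewrite in_setC => /negP fx; rewrite -EFinD -EFinM lee_fin powR_le_add// ?(ltW t0)//.
      have {}fx : `|f n x| < t by rewrite ltNge; apply/negP => ?; apply: fx; rewrite inE.
      have := ler_normB (f n x) (v x) => ?.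
      by have [?|/ltW ?] := leP `|v x| t; [left|right]; lra.
    by rewrite mule_ge0 ?adde_ge0 ?lee_fin ?powR_ge0.
have e10' : 0 <= e1 by exact: ltW.
have := ih => /fine_cvgP[hfin] /cvgrPdist_le/(_ _ e10) hsm.
have [N _ hN] := hfin; have [N' _ hN'] := hsm.
exists (maxn N N') => n; rewrite geq_max => /andP[Nn N'n].
have hn : (\int[nu]_(x in D) h n x <= e1%:E)%E.
  have := hN' _ N'n; rewrite /= sub0r normrN => /(le_trans (ler_norm _)).
  by rewrite -lee_fin fineK//; exact: hN.
apply: (@le_trans _ _ (\int[nu]_(x in D) (h n x + (4 `^ q)%:E * (g n x + w x)))%E).
  apply: ge0_le_integral => //.
  - exact: measurable_normpow.
  - by apply: emeasurable_funD => //; apply: measurable_funeM; exact: emeasurable_funD.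
rewrite ge0_integralD//; last 2 first.
- by move=> x _; rewrite mule_ge0 ?lee_fin ?powR_ge0// adde_ge0.
- by apply: measurable_funeM; exact: emeasurable_funD.
rewrite ge0_integralZl_EFin ?powR_ge0//; last 2 first.
- by move=> x _; rewrite adde_ge0.
- exact: emeasurable_funD.
rewrite ge0_integralD//.
have gn : (\int[nu]_(x in D) g n x <= e1%:E)%E by rewrite -tailE.
have wn : (\int[nu]_(x in D) w x <= e1%:E)%E by rewrite -tailE tail_lim_le.
apply: (@le_trans _ _ (e1%:E + (4 `^ q)%:E * (e1%:E + e1%:E))%E).
  apply: (leeD hn); apply: lee_wpmul2l; first by rewrite lee_fin powR_ge0.
  exact: (leeD gn wn).
rewrite -(EFinD e1 e1) -EFinM -EFinD lee_fin.
have c1 : 1 <= (4 : R) `^ q.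
  by rewrite -[leLHS](powRr0 4) ler_powR ?ler1n// ltW.
have -> : e = 3 * (4 `^ q * e1).
  by rewrite mulrA /e1 mulrC divfK// gt_eqF// mulr_gt0.
have : e1 <= 4 `^ q * e1 by rewrite ler_peMl.
lra.
Qed.

End vitali_convergence.

(** * Vitali coverings and the maximal function *)

Section covering.
Context {R : realType} {X : pmetricType R}.
Implicit Types (E : set X) (rho : nat -> R).

Lemma sub_ball (x y : X) (r s e : R) : ball x e y -> e + r <= s -> ball y r `<=` ball x s.
Proof. by move=> xy ers z yz; apply: le_ball ers _ _; exact: ball_triangle xy yz. Qed.

Lemma ball_open_pos (x : X) (r : R) : open (ball x r).
Proof.
rewrite openE => y; rewrite ballEmdist/= => xy.
apply/nbhs_ballP; exists (r - mdist x y) => [|z]; first by rewrite /= subr_gt0.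
rewrite !ballEmdist/= => yz; rewrite (le_lt_trans (metric_triangle x y z))//.
by rewrite -ltrBrDl.
Qed.

(* Zorn's lemma applied to the disjoint subfamilies of [V] such that a member of [V]
   meeting the subfamily meets an element of no larger index (i.e. no smaller radius). *)
Lemma vitali_selection (V : set (X * nat)) rho : (forall i, 0 < rho i) ->
  exists D : set (X * nat), [/\ D `<=` V,
    trivIset D (fun z => ball z.1 (rho z.2)) &
    forall z, V z -> exists2 w, D w & (w.2 <= z.2)%N /\
      ball z.1 (rho z.2) `&` ball w.1 (rho w.2) !=set0].
Proof.
move=> rho0; pose B (z : X * nat) := ball z.1 (rho z.2).
pose P (D : set (X * nat)) := [/\ D `<=` V, trivIset D B &
  forall z, V z -> (exists2 w, D w & B z `&` B w !=set0) ->
    exists2 w, D w & (w.2 <= z.2)%N /\ B z `&` B w !=set0].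
have PF (F : set (set (X * nat))) : F `<=` P -> total_on F subset -> P (\bigcup_(D in F) D).
  move=> FP totF; split.
  - by move=> z [D FD Dz]; have [+ _ _] := FP _ FD; exact.
  - move=> z w [D FD Dz] [D' FD' D'w].
    have [DD'|D'D] := totF _ _ FD FD'.
      by have [_ + _] := FP _ FD'; apply => //; exact: DD'.
    by have [_ + _] := FP _ FD; apply => //; exact: D'D.
  - move=> z Vz [w [D FD Dw] zw]; have [_ _ /(_ z Vz)] := FP _ FD.
    by case; [exists w|move=> w' Dw' ?; exists w' => //; exists D].
have [D [[DV tD PD] maxD]] := Zorn_bigcup PF.
exists D; split => // z Vz; apply: (PD) => //; apply: contrapT => nz.
(* Take a member of [V] missing [D] of least index. A member of [V] that meets its ball but misses
   [D] has no smaller index, so it can be adjoined to [D], against maximality. *)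
pose bad i := `[< exists2 y, V (y, i) & ~ exists2 w, D w & B (y, i) `&` B w !=set0 >].
have exbad : exists i, bad i.
  by exists z.2; apply/asboolP; exists z.1; rewrite -surjective_pairing.
case: (ex_minnP exbad) => i /asboolP[y Vy ny] mini.
apply: (maxD (D `|` [set (y, i)])).
  split; first exact: subsetUl.
  move=> /(_ (y, i)) h; apply: ny; exists (y, i); first by apply: h; right.
  by exists y; split; exact: ballxx.
split.
- by move=> w [/DV//|->].
- move=> a b [Da|->] [Db|->] // ab; first exact: tD.
    by exfalso; apply: ny; exists a => //; rewrite setIC.
  by exfalso; apply: ny; exists b.
- move=> w Vw [w' [Dw' ww'|-> wy]].
    have [a Da ?] : exists2 a, D a & (a.2 <= w.2)%N /\ B w `&` B a !=set0.
      by apply: (PD) => //; exists w'.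
    by exists a => //; left.
  have [[a Da wa]|nw] := pselect (exists2 a, D a & B w `&` B a !=set0).
    have [b Db ?] : exists2 b, D b & (b.2 <= w.2)%N /\ B w `&` B b !=set0.
      by apply: (PD) => //; exists a.
    by exists b => //; left.
  exists (y, i); [by right|split => //=].
  by apply: mini; apply/asboolP; exists w.1; rewrite -surjective_pairing.
Qed.

(** For one radius [rho i] the family is finite: a covering ball of that radius contains at most one
    of the centres, since its own centre lies in the ball around each of them. *)
Lemma totally_bounded_separated_countable E rho (D : set (X * nat)) :
  totally_bounded E -> (forall i, 0 < rho i) -> (forall z, D z -> E z.1) ->
  trivIset D (fun z => ball z.1 (rho z.2)) -> countable D.
Proof.
move=> tbE rho0 DE tD.
have -> : D = \bigcup_i (D `&` [set z | z.2 = i]).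
  by rewrite eqEsubset; split => [z Dz|z [i _ []]//]; exists z.2.
apply: bigcup_countable => // i _; apply: finite_set_countable.
have [F finF EF] := tbE _ (rho0 i).
apply: (@sub_finite_set _ _ (\bigcup_(y in F) (D `&` [set z | z.2 = i /\ ball y (rho i) z.1]))).
  by move=> z [Dz zi]; have [y Fy yz] := EF _ (DE _ Dz); exists y.
apply: bigcup_finite => // y Fy; set A := (X in finite_set X).
have [->|/set0P[a Aa]] := eqVneq A set0; first exact: finite_set0.
apply: (@sub_finite_set _ _ [set a]); last exact: finite_set1.
move=> z [Dz [zi yz]]; have [Da [ai ya]] := Aa.
apply: tD => //; exists y; split; rewrite /= ?zi ?ai; exact: ball_sym.
Qed.

End covering.

(** * Weak type estimate for a maximal function with two measures *)

Section maximal_function.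
Context {R : realType} {X : pmetricType R} {Smu Snu : set (set X)}.
Variable mu : {measure set (g_sigma_algebraType Smu) -> \bar R}.
Variable nu : {measure set (g_sigma_algebraType Snu) -> \bar R}.
Hypothesis omu : forall U : set X, open U -> <<s Smu >> U.
Hypothesis onu : forall U : set X, open U -> <<s Snu >> U.

Lemma measurable_ball_mu (x : X) (r : R) :
  measurable (ball x r : set (g_sigma_algebraType Smu)).
Proof. by apply: omu; exact: ball_open_pos. Qed.

Lemma measurable_ball_nu (x : X) (r : R) :
  measurable (ball x r : set (g_sigma_algebraType Snu)).
Proof. by apply: onu; exact: ball_open_pos. Qed.

(** The selected balls are disjoint, so the integrals over them add up to at most [I], while [K]
    pays for the tripled balls on the [nu] side. [N] is a union of open balls, hence measurable,
    whereas the set of bad centres need not be. *)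
Lemma maximal_weak_type (E : set X) (lam K s I : R) (rho : nat -> R)
    (H : g_sigma_algebraType Smu -> \bar R) :
  totally_bounded E -> 0 < lam -> 0 <= K -> 0 < s -> (forall i, 0 < rho i) ->
  {homo rho : i j / (i <= j)%N >-> j <= i} ->
  (forall x i, E x -> (nu (ball x (3 * (lam * rho i))%R) <= K%:E * nu (ball x (rho i)))%E) ->
  measurable_fun setT H -> (forall x, 0 <= H x)%E ->
  (\int[mu]_x H x <= I%:E)%E ->
  exists N : set (g_sigma_algebraType Snu), [/\ measurable N, (nu N <= (K * I / s)%:E)%E &
    forall x, E x -> ~ N x -> forall i,
      (\int[mu]_(y in ball x (lam * rho i)%R) H y <= s%:E * nu (ball x (rho i)))%E].
Proof.
move=> tbE lam0 K0 s0 rho0 rhoi Kd mH H0 HI.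
pose r i := lam * rho i.
have r0 i : 0 < r i by rewrite mulr_gt0.
have rle i j : (i <= j)%N -> r j <= r i by move=> ij; rewrite ler_pM2l// rhoi.
pose V := [set z : X * nat | E z.1 /\
  (s%:E * nu (ball z.1 (rho z.2)) < \int[mu]_(y in ball z.1 (r z.2)) H y)%E].
have [D [DV tD coverD]] := vitali_selection V r0.
have DE z : D z -> E z.1 by move=> /DV[].
have /countable_injP[f injf] := totally_bounded_separated_countable tbE r0 DE tD.
(* Enumeration of [D] through the injection [f]: each [A n] is one selected ball or empty, which
   turns sums over [D] into series over [nat]. *)
pose A n : set X := \bigcup_(z in D `&` [set z | f z = n]) ball z.1 (r z.2).
pose C n : set X := \bigcup_(z in D `&` [set z | f z = n]) ball z.1 (3 * r z.2).
have oA n : open (A n) by apply: bigcup_open => z _; exact: ball_open_pos.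
have oC n : open (C n) by apply: bigcup_open => z _; exact: ball_open_pos.
have mA n : measurable (A n : set (g_sigma_algebraType Smu)) by exact: omu.
have mC n : measurable (C n : set (g_sigma_algebraType Snu)) by exact: onu.
have tA : trivIset setT A.
  move=> n m _ _ [y [[z [Dz /= <-] zy] [w [Dw /= <-] wy]]].
  by congr f; apply: tD => //; exists y.
have AE n z : D z -> f z = n -> A n = ball z.1 (r z.2) /\ C n = ball z.1 (3 * r z.2).
  move=> Dz fz; split; rewrite eqEsubset; split => y.
  - move=> [w [Dw /= fw]]; suff -> : w = z by [].
    by apply: injf; rewrite ?inE// fw fz.
  - by move=> zy; exists z.
  - move=> [w [Dw /= fw]]; suff -> : w = z by [].
    by apply: injf; rewrite ?inE// fw fz.
  - by move=> zy; exists z.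
have CA n : (nu (C n) <= (K / s)%:E * \int[mu]_(y in A n) H y)%E.
  have [[z [Dz fz]]|nz] := pselect (exists z, D z /\ f z = n); last first.
    have -> : C n = set0.
      by rewrite -subset0 => y [z [Dz fz] _]; apply: nz; exists z.
    by rewrite measure0 mule_ge0 ?lee_fin ?divr_ge0 ?(ltW s0)// integral_ge0.
  have [-> ->] := AE _ _ Dz fz; have [Ez /ltW hz] := DV _ Dz.
  apply: (le_trans (Kd z.1 z.2 Ez)).
  rewrite [in leRHS]EFinM -muleA; apply: lee_wpmul2l; first by rewrite lee_fin.
  by rewrite lee_pdivlMl.
exists (\bigcup_n C n); split.
- exact: bigcupT_measurable.
- apply: (@le_trans _ _ (\sum_(n <oo) nu (C n))%E).
    by apply: measure_sigma_subadditive => //; exact: bigcupT_measurable.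
  apply: (@le_trans _ _ (\sum_(n <oo) (K / s)%:E * \int[mu]_(y in A n) H y)%E).
    by apply: lee_nneseries => n *; [exact: measure_ge0|exact: CA].
  rewrite nneseriesZl; last by move=> n _; exact: integral_ge0.
  rewrite -ge0_integral_bigcup//; last exact: measurable_funS mH.
  have -> : K * I / s = K / s * I by rewrite mulrAC.
  rewrite [leRHS]EFinM; apply: lee_wpmul2l; first by rewrite lee_fin divr_ge0 ?(ltW s0).
  apply: le_trans HI; apply: ge0_subset_integral => //.
  exact: bigcupT_measurable.
- move=> x Ex Nx i; rewrite leNgt; apply/negP => hx; apply: Nx.
  have Vx : V (x, i) by [].
  have [z Dz [/= zi [y [xy zy]]]] := coverD _ Vx.
  exists (f z) => //; exists z => //=.
  apply: (@le_ball _ _ _ (r z.2 + r i)); last exact: ball_triangle zy (ball_sym xy).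
  have := rle _ _ zi; have := r0 z.2; lra.
Qed.

End maximal_function.

(** * Chaining *)

Section hedberg.
Context {R : realType}.

Lemma geometric_partial_le (z : R) n : 0 <= z -> z < 1 ->
  \sum_(i < n) z ^+ i <= (1 - z)^-1.
Proof.
move=> z0 z1; have z10 : 0 < 1 - z by rewrite subr_gt0.
rewrite -[leRHS]mul1r ler_pdivlMr// mulrC.
have -> : (1 - z) * \sum_(i < n) z ^+ i = 1 - z ^+ n.
  by rewrite -[LHS]opprK -mulNr opprB -subrX1 opprB.
by rewrite gerBl exprn_ge0.
Qed.

(** The exponents [M.-1 - i] to the left of the cut and [i - M] to the right both decrease to [0] at
    the cut, so each side is at most [c / (1 - z)]. *)
Lemma unimodal_geometric_sum (z c : R) (t : nat -> R) (M n : nat) : 0 <= z -> z < 1 ->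
  0 <= c -> (M <= n)%N ->
  (forall i, (i < M)%N -> t i <= c * z ^+ (M.-1 - i)) ->
  (forall i, (M <= i < n)%N -> t i <= c * z ^+ (i - M)) ->
  \sum_(i < n) t i <= 2 * c / (1 - z).
Proof.
move=> z0 z1 c0 Mn tl tr.
rewrite -(big_mkord xpredT t) (@big_cat_nat _ _ _ M)//= -mulrA mulr_natl mulr2n.
apply: lerD.
  rewrite big_mkord; apply: (@le_trans _ _ (\sum_(i < M) c * z ^+ (M.-1 - i))).
    by apply: ler_sum => i _; exact: tl.
  rewrite -mulr_sumr ler_wpM2l//.
  rewrite (reindex_inj rev_ord_inj)/=.
  rewrite (eq_bigr (fun i : 'I_M => z ^+ i)); first exact: geometric_partial_le.
  move=> i _; congr (_ ^+ _); have := ltn_ord i; lia.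
rewrite -{1}(add0n M) big_addn big_mkord.
apply: (@le_trans _ _ (\sum_(i < n - M) c * z ^+ i)).
  apply: ler_sum => i _; rewrite -[in leRHS](addnK M i); apply: tr.
  have := ltn_ord i; lia.
by rewrite -mulr_sumr ler_wpM2l// geometric_partial_le.
Qed.

Lemma powR_exprn (x r : R) n : 0 <= x -> (x ^+ n) `^ r = (x `^ r) ^+ n.
Proof. by move=> x0; rewrite -(powR_mulrn _ x0) -(powR_mulrn _ (powR_ge0 _ _)) powRAC. Qed.

Lemma powR_invl (x r : R) : 0 <= x -> x^-1 `^ r = x `^ (- r).
Proof. by move=> x0; rewrite -powR_inv1// -powRrM mulN1r. Qed.

Lemma powR_half_lt1 (r : R) : 0 < r -> (2^-1 : R) `^ r < 1.
Proof.
move=> r0; have e1 : 1 `^ r = 1 :> R by rewrite powR1.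
rewrite -[ltRHS]e1; apply: gt0_ltr_powR; rewrite ?nnegrE ?invr_ge0//; lra.
Qed.

(** Brings different exponents [r <= P] to the common constant [K ^ P] and the common ratio [z], so
    that both halves of Hedberg's splitting obey one geometric bound. *)
Lemma decay_powR_le (K delta r x z P : R) m : 1 <= K -> 0 < r -> r <= P -> 0 <= x ->
  (2^-1 : R) `^ (delta * r) <= z ->
  x <= K * (2^-1 ^+ m) `^ delta -> x `^ r <= K `^ P * z ^+ m.
Proof.
move=> K1 r0 rP x0 hz xK.
have K0 : 0 <= K by rewrite (le_trans _ K1).
apply: (@le_trans _ _ ((K * (2^-1 ^+ m) `^ delta) `^ r)).
  by rewrite ge0_ler_powR ?nnegrE ?(ltW r0)// mulr_ge0// powR_ge0.
rewrite powRM ?powR_ge0// -powRrM powR_exprn ?invr_ge0//.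
apply: ler_pM; rewrite ?powR_ge0 ?exprn_ge0 ?powR_ge0//.
  by rewrite ler_powR.
by rewrite lerXn2r ?nnegrE ?powR_ge0// (le_trans _ hz)// powR_ge0.
Qed.

(* Hedberg's splitting: the sum is cut at the first index where [s * a i <= B];
   before it [I i <= B] is used, after it [I i <= s * a i], and both pieces are geometric. *)
Lemma hedberg_sum (P Q delta K : R) : 0 < Q -> Q < P -> 0 < delta -> 1 <= K ->
  exists2 c : R, 0 < c & forall (B s : R) (a I : nat -> R), 0 < B -> 0 < s ->
    (forall i, 0 < a i) ->
    (forall i j, (i <= j)%N -> a j <= K * (2^-1 ^+ (j - i)) `^ delta * a i) ->
    (forall i, 0 <= I i <= B) -> (forall i, I i <= s * a i) ->
    forall n, \sum_(i < n) a i `^ (- Q) * I i `^ P <= c * (B `^ (P - Q) * s `^ Q).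
Proof.
move=> Q0 QP delta0 K1.
have P0 : 0 < P by exact: lt_trans QP.
pose k := P - Q; have k0 : 0 < k by rewrite subr_gt0.
pose z : R := Num.max (2^-1 `^ (delta * k)) (2^-1 `^ (delta * Q)).
have z0 : 0 <= z by rewrite le_max powR_ge0.
have z1 : z < 1 by rewrite gt_max !powR_half_lt1// mulr_gt0.
have K0 : 0 < K by rewrite (lt_le_trans _ K1).
have c0 : 0 < K `^ P by rewrite powR_gt0.
exists (2 * K `^ P / (1 - z)).
  by rewrite divr_gt0 ?mulr_gt0// subr_gt0.
move=> B s a I B0 s0 a0 decay IB Isa n.
pose W := B `^ (P - Q) * s `^ Q.
have W0 : 0 <= W by rewrite mulr_ge0 ?powR_ge0.
(* [b i <= 1] is the condition [s * a i <= B] of the cut; after factoring out [W], each term is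
   bounded by a pure power of [b i]. *)
pose b i := s * a i / B.
have b0 i : 0 < b i by rewrite divr_gt0// mulr_gt0.
pose phi i := if b i <= 1 then b i `^ k else b i `^ (- Q).
have tphi i : a i `^ (- Q) * I i `^ P <= W * phi i.
  (* In logarithms both remaining estimates are linear identities, left to [lra]. *)
  have lnE (x r : R) : 0 < x -> x `^ r = expR (ln x * r).
    by move=> x0; rewrite expRM lnK.
  have lnb : ln (b i) = ln s + ln (a i) - ln B.
    by rewrite /b lnM ?lnV ?lnM ?posrE// ?invr_gt0 ?mulr_gt0.
  have /andP[Ii0 IiB] := IB i.
  rewrite /phi; case: ifPn => _.
    apply: (@le_trans _ _ (a i `^ (- Q) * (s * a i) `^ P)).
      rewrite ler_wpM2l ?powR_ge0// ge0_ler_powR ?nnegrE ?(ltW P0)//.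
      by rewrite mulr_ge0// ltW.
    rewrite /W (lnE _ _ (a0 i)) (lnE _ _ s0) (lnE _ _ B0) (lnE _ _ (b0 i)).
    rewrite (lnE _ _ (mulr_gt0 s0 (a0 i))) lnM ?posrE// -!expRD lnb ler_expR /k; lra.
  apply: (@le_trans _ _ (a i `^ (- Q) * B `^ P)).
    by rewrite ler_wpM2l ?powR_ge0// ge0_ler_powR ?nnegrE ?(ltW P0)// ltW.
  rewrite /W (lnE _ _ (a0 i)) !(lnE _ _ s0) !(lnE _ _ B0) (lnE _ _ (b0 i)).
  rewrite -!expRD lnb ler_expR; lra.
apply: (@le_trans _ _ (\sum_(i < n) W * phi i)); first by apply: ler_sum.
rewrite -/W -mulr_sumr mulrC ler_wpM2r//.
(* The alternative [n <= M] provides a cut when no [b M] drops to [1] before [n]. *)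
have exM : exists M, (n <= M)%N || (b M <= 1) by exists n; rewrite leqnn.
case: (ex_minnP exM) => M hM minM.
have Mn : (M <= n)%N by apply: minM; rewrite leqnn.
have decayb i j : (i <= j)%N -> b j <= K * (2^-1 ^+ (j - i)) `^ delta * b i.
  move=> ij; rewrite /b mulrA ler_wpM2r ?invr_ge0 ?(ltW B0)//.
  by rewrite mulrCA ler_wpM2l ?(ltW s0)// decay.
apply: (@unimodal_geometric_sum z (K `^ P) phi M n) => //; first exact: ltW.
- move=> i iM.
  have big j : (j < M)%N -> 1 < b j.
    move=> jM; rewrite ltNge; apply/negP => bj.
    by have := minM j; rewrite bj orbT leqNgt jM => /(_ isT).
  rewrite /phi (lt_geF (big _ iM)) -powR_invl ?(ltW (b0 i))//.
  apply: (@decay_powR_le K delta Q) => //; rewrite ?invr_ge0 ?(ltW (b0 i)) ?(ltW QP)//.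
    by rewrite le_max lexx orbT.
  have := decayb i M.-1; have := big M.-1.
  rewrite prednK ?(leq_ltn_trans _ iM)// => /(_ (leqnn _)) h1 h2.
  rewrite -[leLHS]mul1r ler_pdivrMr//; apply: (le_trans (ltW h1)); apply: h2.
  by rewrite -ltnS prednK// (leq_ltn_trans _ iM).
- move=> i /andP[Mi iltn].
  have bM : b M <= 1 by case/orP: hM => //; rewrite leqNgt (leq_ltn_trans Mi iltn).
  have KbM : b i <= K * (2^-1 ^+ (i - M)) `^ delta.
    apply: (le_trans (decayb _ _ Mi)).
    by rewrite ler_piMr// mulr_ge0 ?powR_ge0// ltW.
  rewrite /phi; case: ifPn => [_|].
    apply: (@decay_powR_le K delta k) => //; rewrite ?(ltW (b0 i))//.
      by rewrite /k gerBl ltW.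
    by rewrite le_max lexx.
  (* [a] decays only up to the factor [K], so [b i] may exceed [1] again beyond the cut; then
     [b i ^ (- Q) <= b i ^ k] and the bound of the other case applies. *)
  rewrite -ltNge => bi1.
  apply: (@le_trans _ _ (b i `^ k)).
    by rewrite ler_powR ?(ltW bi1)// /k; lra.
  apply: (@decay_powR_le K delta k) => //; rewrite ?(ltW (b0 i))//.
    by rewrite /k gerBl ltW.
  by rewrite le_max lexx.
Qed.

End hedberg.

(** * Doubling pairs of measures and oscillation sums *)

Section geometry.
Context {R : realType} {X : pmetricType R} {Smu Snu : set (set X)}.
Variable mu : {measure set (g_sigma_algebraType Smu) -> \bar R}.
Variable nu : {measure set (g_sigma_algebraType Snu) -> \bar R}.
Implicit Types (E : set X) (v h : X -> R).

(* The hypotheses on the pair of measures at scales at most [r1], where [r1] is so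
   small that all the balls occurring in the argument are controlled. *)
Record doubling_pair E (lam K delta r1 : R) : Prop := DoublingPair {
  dp_lam : 1 <= lam;
  dp_K : 1 <= K;
  dp_delta : 0 < delta;
  dp_r1 : 0 < r1;
  dp_omu : forall U : set X, open U -> <<s Smu >> U;
  dp_onu : forall U : set X, open U -> <<s Snu >> U;
  dp_tb : totally_bounded E;
  dp_mu : forall x r, E x -> 0 < r <= r1 -> fin_pos mu (ball x r);
  dp_mulam : forall x r, E x -> 0 < r <= r1 -> fin_pos mu (ball x (lam * r));
  dp_nu : forall x r, E x -> 0 < r <= r1 -> fin_pos nu (ball x r);
  dp_mu4 : forall x r, E x -> 0 < r <= r1 ->
    fin_pos mu (ball x (4 * r)) /\ fine (mu (ball x (4 * r))) <= K * fine (mu (ball x r));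
  dp_nulam : forall x r, E x -> 0 < r <= r1 ->
    (nu (ball x (3 * (lam * r))%R) <= K%:E * nu (ball x r))%E;
  dp_decay : forall x s r, E x -> 0 < s -> s <= r -> r <= r1 ->
    fine (nu (ball x s)) <= K * (s / r) `^ delta * fine (nu (ball x r)) }.

Definition osc v (x : X) (r : R) : R := dev mu (ball x r) v (avg mu (ball x r) v).

(** Weaker than [L1loc], to include truncations: these are bounded, hence integrable on balls of
    finite measure, and finiteness is known for the balls listed here. *)
Definition loc_integrable E (r1 : R) v : Prop :=
  forall x r, E x -> 0 < r <= r1 -> mu.-integrable (ball x r) (EFin \o v).

(** [kappa] is [1] for the members of the class; for their truncations it absorbs the constant of
    the truncation property and the passage from diameters to radii. *)
Definition osc_gradient E (lam r1 alpha p kappa : R) v h : Prop :=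
  [/\ forall x, 0 <= h x,
      measurable_fun (setT : set (g_sigma_algebraType Smu)) h &
      forall x r, E x -> 0 < r <= r1 ->
        (mean_osc mu (ball x r) v <=
         (kappa * r `^ alpha)%:E * Lp_mean mu p (ball x (lam * r)%R) h)%E].

(** The bound [Theta r <= theta] in real numbers, with the denominator cleared. *)
Definition theta_le E (lam alpha p q r theta : R) : Prop :=
  forall x s, E x -> 0 < s <= r ->
    s `^ alpha * fine (nu (ball x s)) `^ q^-1 <=
    theta * fine (mu (ball x (lam * s))) `^ p^-1.

Definition dyad (r : R) (i : nat) : R := r * 2^-1 ^+ i.

Lemma dyad_gt0 r i : 0 < r -> 0 < dyad r i.
Proof. by move=> r0; rewrite mulr_gt0// exprn_gt0. Qed.

Lemma dyad_homo r : 0 < r -> {homo dyad r : i j / (i <= j)%N >-> j <= i}.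
Proof.
move=> r0 i j ij; rewrite ler_pM2l// ler_wiXn2l//; lra.
Qed.

Lemma dyad_le r i : 0 < r -> dyad r i <= r.
Proof.
by move=> r0; have := dyad_homo r0 (leq0n i); rewrite {2}/dyad expr0 mulr1.
Qed.

Lemma dyadD r i j : dyad (dyad r i) j = dyad r (i + j).
Proof. by rewrite /dyad exprD mulrA. Qed.

Lemma dyadS r i : 2 * dyad r i.+1 = dyad r i.
Proof. by rewrite /dyad exprS; lra. Qed.

Variables (E : set X) (lam K delta r1 : R).
Hypothesis dp : doubling_pair E lam K delta r1.

(** [theta_le] trades [s ^ alpha * mu (ball x (lam * s)) ^ (- 1/p)] for
    [theta * nu (ball x s) ^ (- 1/q)], so that [mu] is left only in the integral of [h ^ p]. *)
Lemma osc_le (alpha p q kappa r theta : R) v h : 1 <= p -> 0 <= kappa -> r <= r1 ->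
  theta_le E lam alpha p q r theta -> 0 <= theta ->
  loc_integrable E r1 v -> osc_gradient E lam r1 alpha p kappa v h ->
  (\int[mu]_y (h y `^ p)%:E < +oo)%E ->
  forall x s, E x -> 0 < s <= r ->
  osc v x s <= kappa * theta * (fine (nu (ball x s)) `^ (- q^-1) *
    fine (\int[mu]_(y in ball x (lam * s)%R) (h y `^ p)%:E)%E `^ p^-1).
Proof.
move=> p1 k0 rr1 hth th0 iv [h0 mh hgrad] Ioo x s Ex /andP[s0 sr].
have sr1 : 0 < s <= r1 by rewrite s0 (le_trans sr).
have hm := dp_mulam dp Ex sr1; have hn := dp_nu dp Ex sr1.
have n0 := fin_pos_fine hn; have m0 := fin_pos_fine hm.
have mhp : measurable_fun (setT : set (g_sigma_algebraType Smu)) (fun y => (h y `^ p)%:E).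
  apply/measurable_EFinP.
  exact: (measurableT_comp (f := fun z : R => z `^ p) (measurable_powR p)).
set Iy := (\int[mu]_(y in _) _)%E.
have I0 : (0 <= Iy)%E by apply: integral_ge0 => y _; rewrite lee_fin powR_ge0.
have Ifin : Iy \is a fin_num.
  rewrite ge0_fin_numE//; apply: le_lt_trans Ioo; apply: ge0_subset_integral => //.
  by case: hm.
  by move=> y _; rewrite lee_fin powR_ge0.
have := hgrad _ _ Ex sr1.
have hb := dp_mu dp Ex sr1; have hi := iv _ _ Ex sr1.
rewrite mean_osc_dev//.
have -> : Lp_mean mu p (ball x (lam * s)) h =
    (((fine (mu (ball x (lam * s))))^-1 * fine Iy) `^ p^-1)%:E.
  by rewrite /Lp_mean /mean (fin_pos_inv hm) -/Iy -poweR_EFin EFinM fineK.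
rewrite -EFinM lee_fin.
move=> /le_trans; apply; rewrite -!mulrA ler_wpM2l//.
have P0 : 0 <= p^-1 by rewrite invr_ge0 (le_trans _ p1).
rewrite powRM ?invr_ge0 ?(ltW m0) ?fine_ge0// powR_invl ?(ltW m0)//.
rewrite !mulrA ler_wpM2r ?powR_ge0// !powRN.
rewrite ler_pdivrMr ?powR_gt0// mulrAC ler_pdivlMr ?powR_gt0//.
by apply: hth => //; rewrite s0.
Qed.

(** This is [hedberg_sum] with exponents [1/p] and [1/q], where [a i] is the [nu]-measure of the
    dyadic ball and [I i] the integral of [h ^ p] over its enlargement; outside [N] the maximal
    function gives [I i <= s * a i]. The constant [c] precedes [r] and [theta], so a small [theta]
    makes [N] small. *)
Lemma osc_sum_weak_type (alpha p q : R) : 1 <= p -> p < q ->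
  exists2 c : R, 0 < c & forall r theta kappa A t v h, 0 < r <= r1 -> 0 < theta ->
    theta_le E lam alpha p q r theta -> 0 < kappa -> 0 < A -> 0 < t ->
    loc_integrable E r1 v -> osc_gradient E lam r1 alpha p kappa v h ->
    (\int[mu]_y (h y `^ p)%:E <= (A `^ p)%:E)%E ->
    exists N : set (g_sigma_algebraType Snu), [/\ measurable N,
      (nu N <= ((c * kappa * theta * A / t) `^ q)%:E)%E &
      forall x, E x -> ~ N x -> forall n, \sum_(i < n) osc v x (dyad r i) <= t].
Proof.
move=> p1 pq.
have p0 : 0 < p by rewrite (lt_le_trans _ p1).
have q0 : 0 < q by exact: lt_trans pq.
have [lam1 K1 delta0 _ _] := And5 (dp_lam dp) (dp_K dp) (dp_delta dp) I I.
have lam0 : 0 < lam by rewrite (lt_le_trans _ lam1).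
have K0 : 0 < K by rewrite (lt_le_trans _ K1).
have [||||c1 c10 hed] := @hedberg_sum R p^-1 q^-1 delta K => //.
- by rewrite invr_gt0.
- by rewrite ltf_pV2 ?posrE.
exists (c1 * K `^ q^-1); first by rewrite mulr_gt0// powR_gt0.
move=> r theta kappa A t v h /andP[r0 rr1] th0 hth k0 A0 t0 iv grad HA.
have [h0 mh _] := grad.
pose B := A `^ p; have B0 : 0 < B by rewrite powR_gt0.
(* Hedberg's splitting will bound the sum by [w * s ^ (1/q)]; [s] is chosen to make this equal to
   [t]. *)
pose w := kappa * theta * (c1 * B `^ (p^-1 - q^-1)).
have w0 : 0 < w by rewrite !mulr_gt0// powR_gt0.
pose s := (t / w) `^ q; have s0 : 0 < s by rewrite powR_gt0// divr_gt0.
have mhp : measurable_fun (setT : set (g_sigma_algebraType Smu)) (fun y => (h y `^ p)%:E).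
  apply/measurable_EFinP.
  exact: (measurableT_comp (f := fun z : R => z `^ p) (measurable_powR p)).
have rho0 i := @dyad_gt0 r i r0.
have rhor1 i : 0 < dyad r i <= r1.
  by rewrite rho0 (le_trans (dyad_le i r0)).
have [N [mN nuN hN]] := @maximal_weak_type R X Smu Snu mu nu (dp_omu dp) (dp_onu dp) E lam K s B
  (dyad r) (fun y => (h y `^ p)%:E) (dp_tb dp) lam0 (ltW K0) s0 rho0 (dyad_homo r0)
  (fun x i Ex => dp_nulam dp Ex (rhor1 i)) mhp (fun x => powR_ge0 _ _) HA.
exists N; split => //.
  apply: (le_trans nuN); rewrite lee_fin.
  have rootK z : 0 < z -> (z `^ q^-1) `^ q = z.
    by move=> z0; rewrite -powRrM mulVf ?gt_eqF// powRr1// ltW.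
  have BA : B `^ q^-1 * B `^ (p^-1 - q^-1) = A.
    rewrite -powRD; last by rewrite (gt_eqF B0) implybT.
    by rewrite addrC subrK /B -powRrM mulfV ?gt_eqF// powRr1// ltW.
  have -> : K * B / s = (K `^ q^-1 * B `^ q^-1 * (w / t)) `^ q.
    have -> : s^-1 = (w / t) `^ q.
      by rewrite /s -powRN -powR_invl ?invf_div// divr_ge0 ?(ltW t0) ?(ltW w0).
    have : 0 <= w / t by rewrite divr_ge0 ?(ltW t0) ?(ltW w0).
    by move: (w / t) => wt wt0; rewrite !powRM ?rootK ?mulr_ge0 ?powR_ge0.
  rewrite le_eqVlt; apply/orP; left; apply/eqP; congr (_ `^ q).
  by rewrite -[in RHS]BA /w; lra.
move=> x Ex Nx n.
have HA' : (\int[mu]_y (h y `^ p)%:E < +oo)%E by rewrite (le_lt_trans HA)// ltry.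
pose a i := fine (nu (ball x (dyad r i))).
pose J i := fine (\int[mu]_(y in ball x (lam * dyad r i)%R) (h y `^ p)%:E)%E.
have JE i : (\int[mu]_(y in ball x (lam * dyad r i)%R) (h y `^ p)%:E <= B%:E)%E.
  apply: le_trans HA; apply: ge0_subset_integral => //.
    by have [] := dp_mulam dp Ex (rhor1 i).
  by move=> y _; rewrite lee_fin powR_ge0.
have J0 i : (0 <= \int[mu]_(y in ball x (lam * dyad r i)%R) (h y `^ p)%:E)%E.
  by apply: integral_ge0 => y _; rewrite lee_fin powR_ge0.
have Jfin i : (\int[mu]_(y in ball x (lam * dyad r i)%R) (h y `^ p)%:E)%E \is a fin_num.
  by rewrite ge0_fin_numE// (le_lt_trans (JE i))// ltry.
apply: (@le_trans _ _ (\sum_(i < n) kappa * theta * (a i `^ (- q^-1) * J i `^ p^-1))).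
  apply: ler_sum => i _; apply: (@osc_le alpha p q kappa r theta v h) => //;
    rewrite ?(ltW k0) ?(ltW th0)//.
  by rewrite rho0 dyad_le.
rewrite -mulr_sumr.
have : \sum_(i < n) a i `^ (- q^-1) * J i `^ p^-1 <= c1 * (B `^ (p^-1 - q^-1) * s `^ q^-1).
  apply: hed => //.
  - by move=> i; exact: fin_pos_fine (dp_nu dp Ex (rhor1 i)).
  - move=> i j ij; have := dp_decay dp Ex (rho0 j) (dyad_homo r0 ij) (andP (rhor1 i)).2.
    have -> // : dyad r j / dyad r i = 2^-1 ^+ (j - i).
    rewrite -(subnKC ij) -dyadD {1}/dyad mulrAC divff ?mul1r ?gt_eqF//.
    by rewrite addKn.
  - by move=> i; rewrite fine_ge0//= -lee_fin fineK.
  - move=> i; have := hN x Ex Nx i; rewrite -lee_fin fineK//.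
    by rewrite EFinM (fin_posK (dp_nu dp Ex (rhor1 i))).
move=> /(ler_wpM2l (ltW (mulr_gt0 k0 th0))) /le_trans; apply.
rewrite /s -powRrM mulfV ?gt_eqF// powRr1 ?divr_ge0 ?(ltW t0) ?(ltW w0)//.
by rewrite !mulrA -[X in X * _ / w]mulrA -/w mulrAC divff ?mul1r// gt_eqF.
Qed.

End geometry.

Lemma limf_esup_eq {R : realType} (F : set_system R) (f : R -> \bar R) (L : R) :
  ProperFilter F ->
  (forall e : R, 0 < e -> F [set x | (L - e)%:E <= f x <= (L + e)%:E]%E) ->
  limf_esup f F = L%:E.
Proof.
move=> PF h; apply/eqP; rewrite eq_le; apply/andP; split.
- apply/lee_addgt0Pr => e e0; pose V := [set x | (L - e)%:E <= f x <= (L + e)%:E]%E.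
  apply: (@le_trans _ _ (ereal_sup (f @` V))).
    by apply: ereal_inf_lbound; exists V => //; exact: h.
  by apply: ge_ereal_sup => _ [y /andP[_ hy] <-].
- apply: le_ereal_inf_tmp => _ [V FV <-].
  apply/lee_subgt0Pr => e e0.
  have [y [Vy /= /andP[hy _]]] := filter_ex (filterI FV (h _ e0)).
  by apply: le_trans hy _; apply: ereal_sup_ubound; exists y.
Qed.

(** * Lebesgue points *)

Section pointwise.
Context {R : realType} {X : pmetricType R} {Smu Snu : set (set X)}.
Variable mu : {measure set (g_sigma_algebraType Smu) -> \bar R}.
Variable nu : {measure set (g_sigma_algebraType Snu) -> \bar R}.
Variables (E : set X) (lam K delta r1 : R).
Hypothesis dp : doubling_pair mu nu E lam K delta r1.
Implicit Types (v w : X -> R).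

Local Notation A v x r := (avg mu (ball x r) v).
Local Notation D v x r := (dev mu (ball x r) v).
Local Notation loc v := (loc_integrable mu E r1 v).

Lemma avg_concentric_le x s rho v c : E x -> 0 < rho -> rho <= s -> s <= r1 ->
  s <= 4 * rho -> loc v -> `|A v x rho - c| <= K * D v x s c.
Proof.
move=> Ex rho0 rs sr1 s4 iv.
have hs : 0 < s <= r1 by rewrite sr1 (lt_le_trans rho0).
have hrho : 0 < rho <= r1 by rewrite rho0 (le_trans rs).
have [h4 le4] := dp_mu4 dp Ex hrho.
have [hms hmr] := (dp_mu dp Ex hs, dp_mu dp Ex hrho).
apply: (avg_dist_le hmr hms) => //; [exact: le_ball| |exact: iv|exact: iv].
apply: le_trans le4; rewrite -lee_fin !fin_posK//; apply: le_measure.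
- by rewrite inE; case: hms.
- by rewrite inE; case: h4.
- exact: le_ball.
Qed.

(** Replaces the centre [x] by a net point [y]: [ball y rho] lies in [ball x (2 * rho)], which lies
    in [ball y (4 * rho)], and [dp_mu4] compares the measures. *)
Lemma avg_net_le (x y : X) rho v c : E x -> E y -> ball y rho x -> 0 < rho ->
  2 * rho <= r1 -> loc v -> `|A v y rho - c| <= K * D v x (2 * rho) c.
Proof.
move=> Ex Ey yx rho0 r2 iv.
have hs : 0 < 2 * rho <= r1 by rewrite r2 andbT mulr_gt0.
have hrho : 0 < rho <= r1 by rewrite rho0; lra.
have [h4 le4] := dp_mu4 dp Ey hrho.
have [hms hmr] := (dp_mu dp Ex hs, dp_mu dp Ey hrho).
apply: (avg_dist_le hmr hms) => //; [| |exact: iv|exact: iv].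
  by apply: sub_ball (ball_sym yx) _; lra.
apply: le_trans le4; rewrite -lee_fin !fin_posK//; apply: le_measure.
- by rewrite inE; case: hms.
- by rewrite inE; case: h4.
- by apply: sub_ball yx _; lra.
Qed.

Lemma lipschitz_avg_le x s v w (c c' : R) : E x -> 0 < s <= r1 -> loc v -> loc w ->
  (forall y, `|w y - c'| <= `|v y - c|) -> `|A w x s - c'| <= D v x s c.
Proof.
move=> Ex hs iv iw wv; rewrite -[leRHS]mul1r.
have hm := dp_mu dp Ex hs.
by apply: (avg_dist_le hm hm) => //; rewrite ?mul1r//; [exact: iv|exact: iw].
Qed.

(** Consecutive dyadic averages differ by at most [K] times an oscillation, so they converge; the
    limit is [ubar] because any small radius is within a factor [2] of a dyadic one. The last
    clause, a Lebesgue point property, later lets truncation pass to the limit. *)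
Lemma osc_summable_limit x r v t : E x -> 0 < r <= r1 -> loc v ->
  (forall n, \sum_(i < n) osc mu v x (dyad r i) <= t) ->
  exists L, [/\ ubar mu v x = L%:E, `|L - A v x r| <= K * t &
    D v x (dyad r n) L @[n --> \oo] --> 0].
Proof.
move=> Ex /andP[r0 rr1] iv osct.
have K0 : 0 <= K by rewrite (le_trans _ (dp_K dp)).
pose u n := A v x (dyad r n).
pose o n := osc mu v x (dyad r n).
have o0 n : 0 <= o n by exact: dev_ge0.
have hrad n : 0 < dyad r n <= r1.
  by rewrite dyad_gt0//= (le_trans (dyad_le n r0)).
have ustep n : `|u n.+1 - u n| <= K * o n.
  apply: avg_concentric_le => //; rewrite ?dyad_gt0//.
  - exact: dyad_homo.
  - by have /andP[] := hrad n.
  - by rewrite -(dyadS r n); have := dyad_gt0 n.+1 r0; lra.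
have co : cvgn (series o).
  apply: nondecreasing_is_cvgn.
    by apply/nondecreasing_seqP => n; rewrite !seriesEord/= big_ord_recr/= lerDl.
  by exists t; move=> _ [n _ <-]; rewrite seriesEord; exact: osct.
have cKo : cvgn (series (fun n => K * o n)).
  have -> : series (fun n => K * o n) = (fun n => K * series o n).
    by apply/funext => n; rewrite /series/= mulr_sumr.
  exact: is_cvgMr.
have cu : cvgn (series (fun n => u n.+1 - u n)).
  apply: normed_cvg; have Ko0 n : 0 <= K * o n by rewrite mulr_ge0.
  exact: (series_le_cvg (fun n => normr_ge0 _) Ko0 ustep cKo).
have seriesu n : series (fun n => u n.+1 - u n) n = u n - u 0%N.
  by rewrite /series/= telescope_sumr.
have /cvg_ex[L' uL'] := cu.
pose L := L' + u 0%N.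
have uL : u n @[n --> \oo] --> L.
  have -> : u = (fun n => series (fun n => u n.+1 - u n) n + u 0%N).
    by apply/funext => n; rewrite seriesu subrK.
  by apply: cvgD => //; exact: cvg_cst.
have u0 : u 0%N = A v x r by rewrite /u /dyad expr0 mulr1.
have ut n : `|u n - u 0%N| <= K * t.
  rewrite -seriesu seriesEord/= (le_trans (ler_norm_sum _ _ _))//.
  apply: (@le_trans _ _ (\sum_(i < n) K * o i)); first by apply: ler_sum.
  by rewrite -mulr_sumr ler_wpM2l.
have Dlim : D v x (dyad r n) L @[n --> \oo] --> 0.
  apply: (@squeeze_cvgr _ _ _ _ (cst 0) (fun n => o n + `|u n - L|)).
  - apply: nearW => n; rewrite dev_ge0/=.
    exact: (dev_le_avg _ _ (dp_mu dp Ex (hrad n)) (iv _ _ Ex (hrad n))).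
  - exact: cvg_cst.
  - rewrite -[X in _ --> X]addr0; apply: cvgD; first exact: cvg_series_cvg_0.
    by rewrite -(normr0 R) -(subrr L); apply: cvg_norm; apply: cvgB => //; exact: cvg_cst.
exists L; split => //.
- apply: limf_esup_eq => e e0.
  have K10 : 0 < e / (K + 1) by rewrite divr_gt0//; lra.
  have /cvgrPdist_le/(_ _ K10)[N _ hN] := Dlim.
  have hDN n : (N <= n)%N -> K * D v x (dyad r n) L <= e.
    move=> /hN; rewrite /= sub0r normrN => /(le_trans (ler_norm _)) hD.
    apply: (@le_trans _ _ ((K + 1) * D v x (dyad r n) L)).
      by rewrite ler_wpM2r ?dev_ge0// lerDl.
    by rewrite mulrC -ler_pdivlMr//; lra.
  near=> rho.
  have rho0 : 0 < rho by near: rho; exact: nbhs_right_gt.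
  have rhoN : rho < dyad r N by near: rho; apply: nbhs_right_lt; exact: dyad_gt0.
  have [i [Ni irho rhoi]] : exists i, [/\ (N <= i)%N, rho <= dyad r i & dyad r i <= 2 * rho].
    have [k /andP[k1 k2]] := dyadic_bracket rho0 (ltW rhoN).
    have dE : dyad r (N + k) = dyad r N / 2 ^+ k by rewrite -dyadD {1}/dyad exprVn.
    exists (N + k)%N; split; first exact: leq_addr.
      rewrite dE ler_pdivlMr ?exprn_gt0//; lra.
    by rewrite dE ler_pdivrMr ?exprn_gt0// mulrAC -exprS ltW.
  have rhor1 : 0 < rho <= r1.
    by rewrite rho0 (le_trans irho)//; have /andP[] := hrad i.
  have : `|A v x rho - L| <= e.
    apply: le_trans (hDN _ Ni); apply: avg_concentric_le => //.
      by have /andP[] := hrad i.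
    by have := rho0; lra.
  rewrite ler_distl => /andP[h1 h2].
  have hm := dp_mu dp Ex rhor1; have hi := iv _ _ Ex rhor1.
  by rewrite /= mean_avg// !lee_fin h1.
- rewrite -u0; have : `|u n - u 0%N| @[n --> \oo] --> `|L - u 0%N|.
    by apply: cvg_norm; apply: cvgB => //; exact: cvg_cst.
  move=> h; move/cvg_lim: (h) => <- //.
  by apply: limr_le; [apply/cvg_ex; eexists; exact: h|exact: nearW].
Unshelve. all: by end_near. Qed.

End pointwise.

(** * Measurability of ball averages across the two sigma-algebras *)

Section semicontinuity.
Context {R : realType} {X : pmetricType R} {Smu Snu : set (set X)}.
Variable mu : {measure set (g_sigma_algebraType Smu) -> \bar R}.
Variable nu : {measure set (g_sigma_algebraType Snu) -> \bar R}.
Hypothesis omu : forall U : set X, open U -> <<s Smu >> U.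
Hypothesis onu : forall U : set X, open U -> <<s Snu >> U.

(** Lower semicontinuity: by monotone convergence the integral over a slightly smaller concentric
    ball already exceeds [c], and that ball stays inside [ball z r] for [z] near [x]. *)
Lemma open_integral_ball_gt (H : g_sigma_algebraType Smu -> \bar R) (r : R) (c : \bar R) :
  measurable_fun setT H -> (forall x, 0 <= H x)%E ->
  open [set x : X | (c < \int[mu]_(y in ball x r) H y)%E].
Proof.
move=> mH H0; rewrite openE => x /= cx.
pose F n : set (g_sigma_algebraType Smu) := ball x (r - n.+1%:R^-1).
have mF n : measurable (F n) by exact: measurable_ball_mu.
have ndF : nondecreasing_seq F.
  apply/nondecreasing_seqP => n; apply/subsetPset; apply: le_ball.
  by rewrite lerB// lef_pV2 ?posrE// ler_nat.
have UF : \bigcup_n F n = ball x r.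
  rewrite eqEsubset; split => [y [n _]|y].
    by apply: le_ball; rewrite gerBl invr_ge0.
  rewrite ballEmdist/= -subr_gt0 => xy.
  have [n _ hn] := near_infty_natSinv_lt (PosNum xy).
  have h : n.+1%:R^-1 < r - mdist x y := hn n (leqnn n).
  exists n => //; by rewrite /F ballEmdist/= ltrBrDl -ltrBrDr.
have := @ge0_nondecreasing_set_cvg_integral _ _ _ F H mu ndF mF
  (fun i => measurable_funS measurableT (@subsetT _ _) mH) (fun i x _ => H0 x).
rewrite UF => cvF.
have [n _ hn] : \forall n \near \oo, (c < \int[mu]_(y in F n) H y)%E.
  apply: (cvF [set z | c < z]%E); apply: open_nbhs_nbhs; split => //.
  exact: open_ereal_gt_ereal.
apply/nbhs_ballP; exists n.+1%:R^-1 => [|z xz]; first by rewrite /= invr_gt0.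
apply: (lt_le_trans (hn n (leqnn n))); apply: ge0_subset_integral => //.
- exact: measurable_ball_mu.
- exact: measurable_funS mH.
- by apply: sub_ball (ball_sym xz) _; rewrite addrC subrK.
Qed.

(** The function is built from [mu] but must be measurable for [nu]; the open sets are what the two
    sigma-algebras are known to share. *)
Lemma measurable_integral_ball (H : g_sigma_algebraType Smu -> \bar R) (r : R) :
  measurable_fun setT H -> (forall x, 0 <= H x)%E ->
  measurable_fun (setT : set (g_sigma_algebraType Snu))
    (fun x => \int[mu]_(y in ball x r) H y)%E.
Proof.
move=> mH H0; apply: (measurability _ (ErealGenOInfty.measurableE R)).
move=> _ [_ [c ->] <-]; rewrite setTI.
have := open_integral_ball_gt r c%:E mH H0 => /onu; congr (<<s Snu >> _).
by apply/seteqP; split => x /=; rewrite in_itv/= andbT.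
Qed.

(** Integrability gives measurability on each ball, and countably many balls about [point] exhaust
    [X]. *)
Lemma L1loc_measurable (u : X -> R) : L1loc mu u ->
  measurable_fun (setT : set (g_sigma_algebraType Smu)) u.
Proof.
move=> iu.
have -> : [set: g_sigma_algebraType Smu] = \bigcup_n ball (point : X) n.+1%:R.
  rewrite eqEsubset; split => // x _.
  exists (Num.truncn (mdist (point : X) x)) => //.
  rewrite ballEmdist/=.
  by have /truncn_itv/andP[] : 0 <= mdist (point : X) x := mdist_ge0 _ _.
apply/measurable_fun_bigcup => n; first exact: measurable_ball_mu.
apply/measurable_EFinP; apply: measurable_int; exact: iu.
Qed.

Lemma measurable_avg (E : set X) (u : X -> R) (r : R) :
  measurable (E : set (g_sigma_algebraType Snu)) -> L1loc mu u -> 0 < r ->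
  (forall x, E x -> fin_pos mu (ball x r)) ->
  measurable_fun (E : set (g_sigma_algebraType Snu)) (fun x => avg mu (ball x r) u).
Proof.
move=> mE iu r0 hE.
have mu_ : measurable_fun (setT : set (g_sigma_algebraType Smu)) (EFin \o u).
  by apply/measurable_EFinP; exact: L1loc_measurable iu.
pose U : X -> R := fun x => fine (\int[mu]_(y in ball x r) (EFin \o u)^\+ y)%E
   - fine (\int[mu]_(y in ball x r) (EFin \o u)^\- y)%E.
pose m x := fine (\int[mu]_(y in ball x r) (cst 1%E y))%E.
apply: (@eq_measurable_fun _ _ (g_sigma_algebraType Snu) R E (fun x => m x `^ (-1) * U x)).
  move=> x /set_mem Ex; have hx := hE _ Ex.
  rewrite /m integral_cst; last exact: measurable_ball_mu.
  rewrite mul1e powR_inv1; last exact: ltW (fin_pos_fine hx).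
  rewrite avgE//; last exact: iu.
  have mb := measurable_ball_mu omu x r; have ib := iu x r r0.
  have -> // : U x = \int[mu]_(y in ball x r) u y.
  rewrite /U -fineB.
  - by rewrite /Rintegral [in RHS]integralE.
  - by have := integrable_pos_fin_num mb ib.
  - by have := integrable_neg_fin_num mb ib.
have mI H : measurable_fun setT H -> (forall x, 0 <= H x)%E ->
  measurable_fun (E : set (g_sigma_algebraType Snu))
    (fun x => fine (\int[mu]_(y in ball x r) H y)%E).
  move=> mH H0.
  have mHE : measurable_fun (E : set (g_sigma_algebraType Snu))
      (fun x => \int[mu]_(y in ball x r) H y)%E.
    apply: measurable_funTS; exact: measurable_integral_ball.
  exact: (measurableT_comp (f := fine) (fine_measurable measurableT) mHE).
apply: measurable_funM.
  apply: (measurableT_comp (f := fun z : R => z `^ (-1)) (measurable_powR (-1))).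
  exact: mI.
apply: measurable_funB; apply: mI => //.
- exact: measurable_funepos.
- exact: measurable_funeneg.
Qed.

End semicontinuity.

(** * Uniform bounds and almost everywhere convergent subsequences *)

Section uniform_bounds.
Context {R : realType} {X : pmetricType R} {Smu Snu : set (set X)}.
Variable mu : {measure set (g_sigma_algebraType Smu) -> \bar R}.
Variable nu : {measure set (g_sigma_algebraType Snu) -> \bar R}.
Variables (E : set X) (lam K delta r1 alpha p q : R).
Hypothesis dp : doubling_pair mu nu E lam K delta r1.
Hypothesis mE : measurable (E : set (g_sigma_algebraType Snu)).
Hypothesis cnu : measure_is_complete nu.
Hypotheses (p1 : 1 <= p) (pq : p < q).
Implicit Types (u g : X -> R).

Local Notation A u x r := (avg mu (ball x r) u).
Local Notation D u x r := (dev mu (ball x r) u).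

Definition controlled (M : R) u g : Prop :=
  [/\ L1loc mu u, osc_gradient mu E lam r1 alpha p 1 u g &
    (\int[mu]_y (g y `^ p)%:E <= (M `^ p)%:E)%E].

(** Either norm bounds one of these integrals, and through this disjunction both norms are treated
    at once. *)
Definition l1_bounded (M : R) u : Prop :=
  (\int[nu]_(x in E) `|ubar mu u x| <= M%:E)%E \/ (\int[mu]_x `|u x|%:E <= M%:E)%E.

Lemma L1loc_loc u : L1loc mu u -> loc_integrable mu E r1 u.
Proof. by move=> iu x r _ /andP[r0 _]; exact: iu. Qed.

Let K0 : 0 < K. Proof. by rewrite (lt_le_trans _ (dp_K dp)). Qed.
Let q0 : 0 < q. Proof. by rewrite (lt_trans _ pq)// (lt_le_trans _ p1). Qed.

Lemma null_of_small (N : nat -> set (g_sigma_algebraType Snu)) (c : R) :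
  (forall n, measurable (N n)) -> 0 <= c ->
  (forall n, (nu (N n) <= ((c / n.+1%:R) `^ q)%:E)%E) ->
  nu (\bigcap_n N n) = 0%E.
Proof.
move=> mN c0 hN; apply/eqP; rewrite eq_le measure_ge0 andbT.
apply/lee_addgt0Pr => e e0; rewrite add0e.
have ce : 0 <= c / (e `^ q^-1) by rewrite divr_ge0// powR_ge0.
have /truncn_itv/andP[_ h] := ce.
set n := Num.truncn _ in h.
apply: (@le_trans _ _ (nu (N n))).
  apply: le_measure; rewrite ?inE//.
  - exact: bigcapT_measurable.
  - exact: bigcap_inf.
apply: (le_trans (hN n)); rewrite lee_fin.
have -> : e = (e `^ q^-1) `^ q by rewrite -powRrM mulVf ?gt_eqF// powRr1// ltW.
rewrite ge0_ler_powR ?nnegrE ?powR_ge0 ?divr_ge0 ?(ltW q0)//.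
by rewrite ler_pdivrMr// mulrC -ler_pdivrMr ?powR_gt0// ltW.
Qed.

Lemma osc_ae_summable r theta M u g : 0 < r <= r1 -> 0 < theta ->
  theta_le mu nu E lam alpha p q r theta -> 0 < M -> controlled M u g ->
  exists N : set (g_sigma_algebraType Snu), [/\ measurable N, nu N = 0%E &
    forall x, E x -> ~ N x ->
      exists t, forall n, \sum_(i < n) osc mu u x (dyad r i) <= t].
Proof.
move=> hr th0 hth M0 [iu grad hM].
have [c c0 weak] := osc_sum_weak_type dp alpha p1 pq.
have wk n := weak r theta 1 M n.+1%:R u g hr th0 hth ltr01 M0 (ltr0Sn _ n) (L1loc_loc iu) grad hM.
have [N hN] := choice wk.
exists (\bigcap_n N n); split.
- by apply: bigcapT_measurable => n; have [] := hN n.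
- apply: (@null_of_small N (c * 1 * theta * M)).
  + by move=> n; have [] := hN n.
  + by rewrite !mulr_ge0// ltW.
  + by move=> n; have [] := hN n.
- move=> x Ex Nx; have [n Nnx] : exists n, ~ N n x.
    by apply: contrapT => /forallNP h; apply: Nx => n _; apply: contrapT; exact: h.
  by exists n.+1%:R; have [_ _ /(_ x Ex Nnx)] := hN n.
Qed.

(** Off a null set the limsup over all radii is the limit of the averages over dyadic radii, whose
    countable limsup is measurable; completeness of [nu] transfers this to [ubar]. *)
Lemma ubar_ae_measurable r theta M u g : 0 < r <= r1 -> 0 < theta ->
  theta_le mu nu E lam alpha p q r theta -> 0 < M -> controlled M u g ->
  measurable_fun (E : set (g_sigma_algebraType Snu)) (ubar mu u).
Proof.
move=> hr th0 hth M0 cu; have [iu grad hM] := cu.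
have /andP[r0 rr1] := hr.
have [N [mN N0 hN]] := osc_ae_summable hr th0 hth M0 cu.
pose f n (x : g_sigma_algebraType Snu) : \bar R := (A u x (dyad r n))%:E.
have mf n : measurable_fun (E : set (g_sigma_algebraType Snu)) (f n).
  apply/measurable_EFinP; apply: measurable_avg => //.
  - exact: dp_omu dp.
  - exact: dp_onu dp.
  - exact: dyad_gt0.
  - move=> x Ex; apply: (dp_mu dp Ex).
    by rewrite dyad_gt0//= (le_trans (dyad_le n r0)).
apply: (@ae_measurable_fun _ _ _ nu cnu E (fun x => limn_esup (f ^~ x))); last first.
  exact: (measurable_fun_limn_esup mf).
exists N; split => // x /= /not_implyP[Ex fx]; apply: contrapT => Nx; apply: fx.
have [t ht] := hN _ Ex Nx.
have [L [-> _ DL]] := osc_summable_limit dp Ex hr (L1loc_loc iu) ht.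
suff /cvg_limn_einf_sup[_ ->] : f n x @[n --> \oo] --> L%:E by [].
apply: cvg_EFin; first exact: nearW.
apply/cvgrPdist_le => e e0; have /cvgrPdist_le/(_ _ e0) := DL; apply: filterS => n.
rewrite sub0r normrN /f/= => h; rewrite distrC.
apply: (le_trans _ (le_trans (ler_norm _) h)).
apply: (lipschitz_avg_le dp Ex) => //; [|exact: L1loc_loc..].
by rewrite dyad_gt0//= (le_trans (dyad_le n r0)).
Qed.

(** Origin of [K * (1 + K)]: doubling moves the average to [ball x (2 * rho)], where the deviation
    from [L] is at most an oscillation [<= t] plus a distance [<= K * t]. *)
Lemma ubar_net x y rho u t : E x -> E y -> ball y rho x -> 0 < rho ->
  2 * rho <= r1 -> L1loc mu u ->
  (forall n, \sum_(i < n) osc mu u x (dyad (2 * rho) i) <= t) ->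
  exists L, [/\ ubar mu u x = L%:E, `|L - A u x (2 * rho)| <= K * t &
    `|A u y rho - L| <= K * (1 + K) * t].
Proof.
move=> Ex Ey yx rho0 r2 iu ht.
have h2 : 0 < 2 * rho <= r1 by rewrite r2 mulr_gt0.
have [L [uL AL _]] := osc_summable_limit dp Ex h2 (L1loc_loc iu) ht.
exists L; split => //; apply: (le_trans (avg_net_le dp L Ex Ey yx rho0 r2 (L1loc_loc iu))).
rewrite -mulrA ler_wpM2l ?(ltW K0)//.
have := ht 1%N; rewrite big_ord_recl big_ord0 addr0 /dyad expr0 mulr1 => osct.
apply: (le_trans (dev_le_avg _ (A u x (2 * rho)) (dp_mu dp Ex h2) (L1loc_loc iu Ex h2))).
by rewrite [leRHS]mulrDl mul1r lerD// distrC.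
Qed.

(** Doubling makes [nu] positive on the ball, but the norm on [E] sees only the part of the ball
    inside [E], hence the positivity assumption on that part. *)
Lemma avg_bound y rho theta : E y -> 0 < rho -> 2 * rho <= r1 -> 0 < theta ->
  theta_le mu nu E lam alpha p q (2 * rho) theta ->
  (0 < nu (E `&` ball y rho))%E ->
  exists2 Lam, 0 < Lam & forall M u g, 0 < M -> controlled M u g -> l1_bounded M u ->
    `|A u y rho| <= Lam * M.
Proof.
move=> Ey rho0 r2 th0 hth nuEy.
have h2 : 0 < 2 * rho <= r1 by rewrite r2 mulr_gt0.
have hrho : 0 < rho <= r1 by rewrite rho0; lra.
have [c c0 weak] := osc_sum_weak_type dp alpha p1 pq.
have mB := measurable_ball_nu (dp_onu dp) y rho.
have hB := dp_nu dp Ey hrho.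
have hmB := dp_mu dp Ey hrho.
have m0 := fin_pos_fine hmB.
pose S : set (g_sigma_algebraType Snu) := E `&` ball y rho.
have mS : measurable S by exact: measurableI.
have Soo : (nu S < +oo)%E.
  have [_ /andP[_]] := hB; apply: le_lt_trans; apply: le_measure; rewrite ?inE//.
  exact: subIsetr.
pose n0 := fine (nu S).
have n0E : nu S = n0%:E by rewrite /n0 fineK// ge0_fin_numE.
have n00 : 0 < n0 by rewrite -lte_fin -n0E.
(* At the threshold [tau * M] the exceptional set has measure at most [n0 / 2], so it spares half of
   [S]. *)
pose tau := c * 1 * theta * (2 / n0) `^ q^-1.
have tau0 : 0 < tau by rewrite !mulr_gt0// powR_gt0// divr_gt0.
have KK0 : 0 < K * (1 + K) by rewrite mulr_gt0 ?addr_gt0.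
exists (3 / n0 + K * (1 + K) * tau + (fine (mu (ball y rho)))^-1).
  by rewrite addr_gt0 ?invr_gt0// addr_gt0 ?divr_gt0// mulr_gt0.
move=> M u g M0 cu [hl1|hl1]; last first.
  have [iu _ _] := cu.
  apply: (@le_trans _ _ ((fine (mu (ball y rho)))^-1 * M)); last first.
    rewrite ler_wpM2r ?(ltW M0)// lerDr addr_ge0 ?divr_ge0 ?(ltW n00)//.
    exact: ltW (mulr_gt0 KK0 tau0).
  have ib := iu y rho rho0.
  rewrite avgE// normrM ger0_norm ?invr_ge0 ?(ltW m0)// ler_wpM2l ?invr_ge0 ?(ltW m0)//.
  have mb := hmB.1.
  apply: (le_trans (le_normr_Rintegral mb ib)).
  rewrite -lee_fin fineK; last first.
    exact: integrable_fin_num (integrable_abse ib).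
  apply: le_trans hl1; apply: ge0_subset_integral => //.
  apply/measurable_EFinP; apply: measurableT_comp => //.
  exact: L1loc_measurable (dp_omu dp) _ iu.
have [iu grad hM] := cu.
have [N [mN nuN hN]] := weak (2 * rho) theta 1 M (tau * M) u g h2 th0 hth ltr01 M0
  (mulr_gt0 tau0 M0) (L1loc_loc iu) grad hM.
have {}nuN : (nu N <= (n0 / 2)%:E)%E.
  apply: (le_trans nuN); rewrite lee_fin.
  have -> : c * 1 * theta * M / (tau * M) = (2 / n0) `^ (- q^-1).
    rewrite powRN /tau; have B0 : 0 < c * 1 * theta by rewrite !mulr_gt0.
    move: (c * 1 * theta) B0 => B B0; rewrite -[B * _ * M]mulrA invfM mulrACA divff ?gt_eqF//.
    by rewrite mul1r invfM mulrCA divff ?mulr1// gt_eqF.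
  rewrite -powRrM mulNr mulVf ?gt_eqF// powR_inv1 ?divr_ge0 ?(ltW n00)//.
  by rewrite invf_div.
(* If the average were larger, [|ubar|] would be at least [3 * M / n0] on a set of measure at least
   [n0 / 2], and its integral would exceed [M]. *)
rewrite leNgt; apply/negP => big.
have low x : S x -> ~ N x -> ((3 * M / n0)%:E <= `|ubar mu u x|)%E.
  move=> [Ex yx] Nx.
  have [L [-> _ AL]] := ubar_net Ex Ey yx rho0 r2 iu (hN x Ex Nx).
  rewrite lee_fin.
  have := ler_normB L (L - A u y rho); rewrite opprB addrC subrK => h.
  have inv0 : 0 < (fine (mu (ball y rho)))^-1 * M by rewrite mulr_gt0 ?invr_gt0.
  move: AL big h; rewrite [X in X <= _ -> _]distrC !mulrDl; lra.
have mSN : measurable (S `\` N) by exact: measurableD.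
have hSN : ((n0 / 2)%:E <= nu (S `\` N))%E.
  have sub : (nu S <= nu N + nu (S `\` N))%E.
    apply: (@le_trans _ _ (nu (N `|` (S `\` N)))); last exact: measureU2.
    apply: le_measure; rewrite ?inE//; first exact: measurableU.
    by move=> x Sx; have [Nx|Nx] := pselect (N x); [left|right].
  have SNoo : nu (S `\` N) \is a fin_num.
    rewrite ge0_fin_numE//; apply: le_lt_trans Soo.
    by apply: le_measure; rewrite ?inE//; exact: subDsetl.
  move: sub; rewrite n0E -(fineK SNoo) => /le_trans/(_ (leeD2r _ nuN)).
  rewrite -EFinD !lee_fin; lra.
have : ((3 * M / n0 * (n0 / 2))%:E <= M%:E)%E.
  apply: le_trans hl1.
  apply: (@le_trans _ _ (\int[nu]_(x in S `\` N) `|ubar mu u x|)%E); last first.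
    apply: ge0_subset_integral => //.
    - by apply: measurableT_comp => //; apply: ubar_ae_measurable h2 th0 hth M0 cu.
    - by move=> x [[]].
  apply: (@le_trans _ _ (\int[nu]_(x in S `\` N) (3 * M / n0)%:E)%E).
    by rewrite integral_cst// EFinM lee_wpmul2l// lee_fin divr_ge0 ?mulr_ge0 ?(ltW n00) ?(ltW M0).
  apply: ge0_le_integral => //.
  - by move=> x _; rewrite lee_fin divr_ge0 ?mulr_ge0 ?(ltW n00) ?(ltW M0).
  - apply: measurableT_comp => //.
    apply: (measurable_funS mE); last exact: ubar_ae_measurable h2 th0 hth M0 cu.
    by move=> x [[]].
  - by move=> x [Sx Nx]; exact: low.
rewrite lee_fin; have -> : 3 * M / n0 * (n0 / 2) = 3 / 2 * M.
  by rewrite mulrA divfK ?gt_eqF//; lra.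
lra.
Qed.

Lemma finite_set_ub (F : set X) (f : X -> R) : finite_set F ->
  exists2 b, 0 < b & forall y, F y -> f y <= b.
Proof.
move=> finF; pose b := \sum_(y \in F) `|f y|.
have b0 : 0 <= b by apply: fsumr_ge0.
exists (1 + b) => [|y Fy]; first by rewrite ltr_wpDr.
rewrite (le_trans (ler_norm _))// /b (fsbigD1 y)//=.
rewrite addrCA lerDl addr_ge0// fsumr_ge0//.
Qed.

(** Centres of a cover may lie outside [E]; those whose ball meets [E] are moved into [E], which
    doubles the radius. *)
Lemma totally_bounded_net rho : 0 < rho ->
  exists2 F : set X, finite_set F &
    F `<=` E /\ forall x, E x -> exists2 y, F y & ball y rho x.
Proof.
move=> rho0; have rho2 : 0 < rho / 2 by rewrite divr_gt0.
have [F finF EF] := dp_tb dp rho2.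
have /choice[c hc] : forall y, exists z, (exists2 w, E w & ball y (rho / 2) w) ->
    E z /\ ball y (rho / 2) z.
  move=> y; have [[w Ew yw]|nw] := pselect (exists2 w, E w & ball y (rho / 2) w).
    by exists w.
  by exists y => /nw.
pose F' := F `&` [set y | exists2 w, E w & ball y (rho / 2) w].
exists (c @` F'); first by apply/finite_image/finite_setIl.
split; first by move=> _ [y [Fy /hc[Ez _]] <-].
move=> x Ex; have [y Fy yx] := EF _ Ex.
have /hc[_ yz] : exists2 w, E w & ball y (rho / 2) w by exists x.
exists (c y); first by exists y => //; split => //; exists x.
by rewrite [rho]splitr; apply: ball_triangle (ball_sym yz) yx.
Qed.

(** [avg_bound] applies at the net points whose ball meets [E] in positive measure; the finitely
    many other balls only contribute the null set [N]. *)
Lemma uniform_avg_bound rho theta : 0 < rho -> 2 * rho <= r1 -> 0 < theta ->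
  theta_le mu nu E lam alpha p q (2 * rho) theta ->
  exists (F : set X) (N : set (g_sigma_algebraType Snu)) (Lam : R),
  [/\ finite_set F, F `<=` E, measurable N, nu N = 0%E /\ 0 < Lam &
    (forall x, E x -> ~ N x -> exists2 y, F y & ball y rho x) /\
    forall M u g, 0 < M -> controlled M u g -> l1_bounded M u ->
      (forall y, F y -> `|A u y rho| <= Lam * M) /\
      (forall x, E x -> ~ N x -> D u x (2 * rho) 0 <= Lam * M)].
Proof.
move=> rho0 r2 th0 hth.
have h2 : 0 < 2 * rho <= r1 by rewrite r2 mulr_gt0.
have hrho : 0 < rho <= r1 by rewrite rho0; lra.
have [F0 finF0 [F0E F0cov]] := totally_bounded_net rho0.
pose pos y := (0 < nu (E `&` ball y rho))%E.
pose F := F0 `&` [set y | pos y].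
pose Z := F0 `&` [set y | ~ pos y].
have mB y : measurable (E `&` ball y rho : set (g_sigma_algebraType Snu)).
  by apply: measurableI => //; exact: measurable_ball_nu (dp_onu dp) _ _.
pose N : set (g_sigma_algebraType Snu) := \bigcup_(y in Z) (E `&` ball y rho).
have finZ : finite_set Z by exact: finite_setIl.
have finF : finite_set F by exact: finite_setIl.
have mN : measurable N by apply: fin_bigcup_measurable.
have N0 : nu N = 0%E.
  apply/eqP; rewrite -measure_le0.
  apply: (@le_trans _ _ (\sum_(y \in Z) nu (E `&` ball y rho))%E).
    by apply: content_sub_fsum.
  rewrite fsbig1// => y [_ npy]; apply/eqP; rewrite -measure_le0 leNgt.
  exact/negP.
have bd y : exists Lam, F y -> 0 < Lam /\ forall M u g, 0 < M -> controlled M u g ->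
    l1_bounded M u -> `|A u y rho| <= Lam * M.
  have [[F0y py]|nF] := pselect (F y); last by exists 0.
  by have [Lam L0 hL] := avg_bound (F0E _ F0y) rho0 r2 th0 hth py; exists Lam.
have [lm hlm] := choice bd.
have [L1 L10 hL1] := finite_set_ub lm finF.
have [L2 L20 hL2] := finite_set_ub (fun y => theta * fine (nu (ball y rho)) `^ (- q^-1)) finF.
(* [L1] bounds the averages at net points and [L2] the oscillation at [x], whose ball contains that
   of a net point; passing from [y] to [x] costs a further [K * L2]. *)
exists F, N, (L1 + (1 + K) * L2); split => //.
- by move=> y [/F0E].
- by split => //; rewrite addr_gt0// mulr_gt0// addr_gt0.
have cov x : E x -> ~ N x -> exists2 y, F y & ball y rho x.
  move=> Ex Nx; have [y F0y yx] := F0cov _ Ex; exists y => //; split => //.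
  by apply: contrapT => npy; apply: Nx; exists y.
split => // M u g M0 cu lu.
have avgF y : F y -> `|A u y rho| <= L1 * M.
  move=> Fy; have [_ /(_ M u g M0 cu lu) h] := hlm _ Fy.
  by rewrite (le_trans h)// ler_wpM2r ?(ltW M0)// hL1.
split => [y Fy|x Ex Nx].
  rewrite (le_trans (avgF _ Fy))// ler_wpM2r ?(ltW M0)// lerDl.
  by rewrite mulr_ge0 ?(ltW L20)// addr_ge0// ltW.
have [y Fy yx] := cov x Ex Nx; have Ey := F0E _ Fy.1.
have [iu grad hM] := cu.
have Ioo : (\int[mu]_z (g z `^ p)%:E < +oo)%E by rewrite (le_lt_trans hM)// ltry.
have nF := fin_pos_fine (dp_nu dp Ey hrho).
have nx := fin_pos_fine (dp_nu dp Ex h2).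
have osc2 : osc mu u x (2 * rho) <= L2 * M.
  have h2' : 0 < 2 * rho <= 2 * rho by rewrite lexx andbT mulr_gt0.
  apply: (le_trans (osc_le dp p1 ler01 r2 hth (ltW th0) (L1loc_loc iu) grad Ioo Ex h2')).
  rewrite mul1r mulrA; apply: ler_pM.
  - by rewrite mulr_ge0 ?powR_ge0// ltW.
  - exact: powR_ge0.
  - apply: le_trans (hL2 _ Fy); rewrite ler_wpM2l ?(ltW th0)//.
    rewrite !powRN lef_pV2 ?posrE ?powR_gt0//.
    rewrite ge0_ler_powR ?nnegrE ?invr_ge0 ?(ltW q0) ?(ltW nF) ?(ltW nx)//.
    rewrite -lee_fin (fin_posK (dp_nu dp Ex h2)) (fin_posK (dp_nu dp Ey hrho)).
    apply: le_measure; rewrite ?inE.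
    + exact: (dp_nu dp Ey hrho).1.
    + exact: (dp_nu dp Ex h2).1.
    + by apply: sub_ball (ball_sym yx) _; lra.
  - have p0 : 0 < p by rewrite (lt_le_trans _ p1).
    have gB : (\int[mu]_(z in ball x (lam * (2 * rho))%R) (g z `^ p)%:E <= (M `^ p)%:E)%E.
      apply: le_trans hM; have mlam := (dp_mulam dp Ex h2).1.
      have [_ mg _] := grad.
      apply: ge0_subset_integral => //.
        apply/measurable_EFinP.
        exact: (measurableT_comp (f := fun z : R => z `^ p) (measurable_powR p)).
      by move=> z _; rewrite lee_fin powR_ge0.
    have -> : M = (M `^ p) `^ p^-1 by rewrite -powRrM mulfV ?gt_eqF// powRr1// ltW.
    have g0 : (0 <= \int[mu]_(z in ball x (lam * (2 * rho))%R) (g z `^ p)%:E)%E.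
      by apply: integral_ge0 => z _; rewrite lee_fin powR_ge0.
    rewrite ge0_ler_powR ?nnegrE ?invr_ge0 ?(ltW p0) ?powR_ge0 ?fine_ge0//.
    rewrite -lee_fin fineK// ge0_fin_numE//.
    by rewrite (le_lt_trans gB)// ltry.
have oscA : `|A u y rho - A u x (2 * rho)| <= K * (L2 * M).
  apply: (le_trans (avg_net_le dp _ Ex Ey yx rho0 r2 (L1loc_loc iu))).
  by rewrite ler_wpM2l// ltW.
apply: (le_trans (dev_le_avg 0 (A u x (2 * rho)) (dp_mu dp Ex h2) (L1loc_loc iu Ex h2))).
rewrite subr0 -/(osc mu u x (2 * rho)).
have := avgF _ Fy; have := ler_normB (A u y rho) (A u y rho - A u x (2 * rho)).
rewrite opprB addrC subrK.
have -> : (L1 + (1 + K) * L2) * M = L1 * M + L2 * M + K * (L2 * M) by lra.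
lra.
Qed.

End uniform_bounds.

(* The limits along an ultrafilter of a bounded family of sequences: this replaces a
   diagonal extraction. *)
Lemma simultaneous_cluster {R : realType} {I : choiceType} (a : nat -> I -> R) (b : I -> R) :
  (forall n i, `|a n i| <= b i) ->
  exists c : I -> R, forall (J : set I) (e : R) (n0 : nat), finite_set J -> 0 < e ->
    exists2 n, (n0 <= n)%N & forall i, J i -> `|a n i - c i| <= e.
Proof.
move=> ab; have [U [UU ooU]] := @ultraFilterLemma nat (nbhs \oo) _.
have PU : ProperFilter U by exact: ultra_proper.
have lim i : exists l : R, a n i @[n --> U] --> l.
  have := @segment_compact R (- b i) (b i); rewrite compact_ultra.
  move=> /(_ (a n i @[n --> U]) _)[||l [_ hl]]; last by exists l.
  - split; first exact: fmap_proper_filter.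
    move=> G GG sub; rewrite eqEsubset; split => // A GA.
    have [//|UnA] := in_ultra_setVsetC (a ^~ i @^-1` A) UU.
    have /(filterI GA) : G (~` A) by apply: sub.
    by rewrite setICr => /filter_ex[].
  - by apply: (@filterE _ U) => n /=; rewrite in_itv/= -ler_norml ab.
have [c hc] := choice lim.
exists c => J e n0 finJ e0.
have : U (\bigcap_(i in [set` fset_set J]) [set n | `|a n i - c i| <= e]).
  apply: filter_bigI => i _; have /cvgrPdist_le/(_ _ e0) := hc i.
  by apply: filterS => n /=; rewrite distrC.
rewrite fset_setK// => UJ.
have Un : U [set n | (n0 <= n)%N] by apply: ooU; exists n0.
have [n [nn hn]] := filter_ex (filterI Un UJ).
by exists n => // i Ji; exact: hn.
Qed.

Lemma increasing_choice (P : nat -> nat -> Prop) :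
  (forall m n0, exists2 n, (n0 <= n)%N & P m n) ->
  exists phi : nat -> nat, {homo phi : m n / (m < n)%N} /\ forall m, P m (phi m).
Proof.
move=> h; have h' (mn : nat * nat) : exists n, (mn.2 <= n)%N /\ P mn.1 n.
  by have [n] := h mn.1 mn.2; exists n.
have [f hf] := choice h'.
pose phi := fix phi m := match m with 0%N => f (0%N, 0%N) | m'.+1 => f (m'.+1, (phi m').+1) end.
exists phi; split.
  by apply: homo_ltn => [? ? ?|m]; [exact: ltn_trans|exact: (hf (m.+1, (phi m).+1)).1].
by case=> [|m]; [exact: (hf (0%N, 0%N)).2|exact: (hf (m.+1, (phi m).+1)).2].
Qed.

Lemma geometric_cauchy_cvg {R : realType} (u : nat -> R) (c : R) (n0 : nat) :
  (forall n, (n0 <= n)%N -> `|u n.+1 - u n| <= c * 2^-1 ^+ n) -> cvgn u.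
Proof.
move=> h.
have c0 : 0 <= c * 2^-1 ^+ n0 by rewrite (le_trans _ (h n0 (leqnn _))).
have cc0 : 0 <= c by move: c0; rewrite pmulr_lge0// exprn_gt0.
pose v n := u (n + n0)%N.
suff /cvg_ex[l hl] : cvgn v by apply/cvg_ex; exists l; rewrite -(cvg_shiftn n0).
have cg : cvgn (series (geometric c (2^-1 : R))).
  by apply: is_cvg_geometric_series; rewrite ger0_norm//; lra.
have cv : cvgn (series (fun n => v n.+1 - v n)).
  apply: normed_cvg; apply: (series_le_cvg _ _ _ cg) => n.
  - exact: normr_ge0.
  - by rewrite /geometric/= mulr_ge0// exprn_ge0.
  - rewrite /geometric/= /v addSn; apply: (le_trans (h _ (leq_addl _ _))).
    by rewrite ler_wpM2l// ler_wiXn2l ?leq_addr//; lra.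
have -> : v = (fun n => series (fun n => v n.+1 - v n) n + v 0%N).
  by apply/funext => n; rewrite /series/= telescope_sumr// subrK.
by apply: is_cvgD => //; exact: is_cvg_cst.
Qed.

Lemma nneseries_le_partial {R : realType} (u : nat -> R) (b : R) : (forall n, 0 <= u n) ->
  (forall n, \sum_(i < n) u i <= b) -> (\sum_(n <oo) (u n)%:E <= b%:E)%E.
Proof.
move=> u0 ub; apply: lime_le; first by apply: is_cvg_nneseries => n _ _; rewrite lee_fin.
by apply: nearW => n; rewrite sumEFin lee_fin big_mkord.
Qed.

Section null_sets.
Context {d : measure_display} {T : measurableType d} {R : realType}.
Variable nu : {measure set T -> \bar R}.

Lemma measureU_eq0 (A B : set T) : measurable A -> measurable B ->
  nu A = 0%E -> nu B = 0%E -> nu (A `|` B) = 0%E.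
Proof.
move=> mA mB A0 B0; apply/eqP; rewrite -measure_le0.
apply: (@le_trans _ _ (nu A + nu B)%E); first exact: measureU2.
by rewrite A0 B0 adde0.
Qed.

Lemma measure_bigcup_eq0 (F : nat -> set T) : (forall n, measurable (F n)) ->
  (forall n, nu (F n) = 0%E) -> nu (\bigcup_n F n) = 0%E.
Proof.
move=> mF F0; apply/eqP; rewrite -measure_le0.
apply: (@le_trans _ _ (\sum_(n <oo) nu (F n))%E).
  by apply: measure_sigma_subadditive => //; exact: bigcupT_measurable.
by rewrite eseries0// => n _ _; exact: F0.
Qed.

End null_sets.

Section ae_subsequence.
Context {R : realType} {X : pmetricType R} {Smu Snu : set (set X)}.
Variable mu : {measure set (g_sigma_algebraType Smu) -> \bar R}.
Variable nu : {measure set (g_sigma_algebraType Snu) -> \bar R}.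
Variables (E : set X) (lam K delta r1 alpha p q : R).
Hypothesis dp : doubling_pair mu nu E lam K delta r1.
Hypothesis mE : measurable (E : set (g_sigma_algebraType Snu)).
Hypothesis cnu : measure_is_complete nu.
Hypotheses (p1 : 1 <= p) (pq : p < q).

Local Notation A u x r := (avg mu (ball x r) u).
Local Notation controlled := (controlled mu E lam r1 alpha p).
Local Notation l1_bounded := (l1_bounded mu nu E).

(** Stage [k] provides a scale at which, off a set of measure [e k], each representative is within a
    multiple of [e k] of its average over a ball of a finite net. Only these countably many averages
    have to converge. *)
Lemma ae_cvg_subsequence (w g : nat -> X -> R) (M : R) :
  (forall theta, 0 < theta -> exists2 r, 0 < r <= r1 &
     theta_le mu nu E lam alpha p q r theta) ->
  0 < M -> (forall n, controlled M (w n) (g n)) -> (forall n, l1_bounded M (w n)) ->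
  exists (phi : nat -> nat) (N : set (g_sigma_algebraType Snu)),
    [/\ {homo phi : m n / (m < n)%N}, measurable N, nu N = 0%E &
      forall x, E x -> ~ N x -> (forall n, ubar mu (w n) x \is a fin_num) /\
        cvgn (fun n => fine (ubar mu (w (phi n)) x))].
Proof.
move=> small M0 cw lw.
have K0 : 0 < K by rewrite (lt_le_trans _ (dp_K dp)).
have q0 : 0 < q by rewrite (lt_trans _ pq)// (lt_le_trans _ p1).
have [c c0 weak] := osc_sum_weak_type dp alpha p1 pq.
pose e (k : nat) : R := 2^-1 ^+ k.
have e0 k : 0 < e k by rewrite exprn_gt0.
pose stage k (z : R * set X * set (g_sigma_algebraType Snu) * R *
    (nat -> set (g_sigma_algebraType Snu))) :=
  let: (rho, F, N0, Lam, NN) := z in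
  [/\ 0 < rho /\ 2 * rho <= r1, finite_set F /\ F `<=` E, measurable N0 /\ nu N0 = 0%E,
   (forall x, E x -> ~ N0 x -> exists2 y, F y & ball y rho x) /\
   (forall n y, F y -> `|A (w n) y rho| <= Lam) &
   forall n, [/\ measurable (NN n), (nu (NN n) <= (e k)%:E)%E &
     forall x, E x -> ~ NN n x ->
       forall m, \sum_(i < m) osc mu (w n) x (dyad (2 * rho) i) <= e k]].
have stageP k : exists z, stage k z.
  (* Chosen so that the exceptional set at threshold [e k] has measure at most
     [(e k ^ (1/q)) ^ q = e k]. *)
  pose theta := e k * e k `^ q^-1 / (c * 1 * M).
  have cM : 0 < c * 1 * M by rewrite !mulr_gt0.
  have th0 : 0 < theta by rewrite divr_gt0// mulr_gt0// powR_gt0.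
  have [r /andP[r0 rr1] hth] := small _ th0.
  have rE : 2 * (r / 2) = r by rewrite mulrC divfK.
  have rho0 : 0 < r / 2 by rewrite divr_gt0.
  have hth2 : theta_le mu nu E lam alpha p q (2 * (r / 2)) theta by rewrite rE.
  have r2 : 2 * (r / 2) <= r1 by rewrite rE.
  have h2 : 0 < 2 * (r / 2) <= r1 by rewrite rE r0.
  have [F [N0 [Lam [finF FE mN0 [N00 Lam0] [cov bd]]]]] :=
    uniform_avg_bound dp mE cnu p1 pq rho0 r2 th0 hth2.
  have wk n := let: And3 iu grad hM := cw n in
    weak (2 * (r / 2)) theta 1 M (e k) (w n) (g n) h2 th0 hth2 ltr01 M0 (e0 k)
      (L1loc_loc iu) grad hM.
  have [NN hNN] := choice wk.
  exists (r / 2, F, N0, Lam * M, NN); split => //.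
    by split => // n y Fy; have [h _] := bd _ _ _ M0 (cw n) (lw n); exact: h.
  move=> n; have [mNN nuNN hosc] := hNN n; split => //.
  apply: (le_trans nuNN); rewrite lee_fin.
  have -> : c * 1 * theta * M / e k = e k `^ q^-1.
    have -> : c * 1 * theta * M = theta * (c * 1 * M) by lra.
    by rewrite divfK ?gt_eqF// mulrAC divff ?mul1r// gt_eqF.
  by rewrite -powRrM mulVf ?gt_eqF// powRr1// ltW.
have [z hz] := choice stageP.
pose rho k := (z k).1.1.1.1; pose F k := (z k).1.1.1.2; pose N0 k := (z k).1.1.2.
pose Lam k := (z k).1.2; pose NN k := (z k).2.
have {}hz k : stage k (rho k, F k, N0 k, Lam k, NN k).
  by have := hz k; rewrite /rho /F /N0 /Lam /NN; case: (z k) => [[[[]]]].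
(* The value [0] off the nets makes the family bounded at every index. *)
pose a n (i : nat * X) := if i.2 \in F i.1 then A (w n) i.2 (rho i.1) else 0.
have [cl hcl] := @simultaneous_cluster R _ a (fun i => `|Lam i.1|)
  ltac:(move=> n [k y]; rewrite /a/=; case: ifPn => [/set_mem Fy|_]; rewrite ?normr0//;
    have [_ _ _ [_ h] _] := hz k; exact: le_trans (h _ _ Fy) (ler_norm _)).
have [phi [phi_homo hphi]] : exists phi : nat -> nat, {homo phi : m n / (m < n)%N} /\
    forall m k y, (k <= m)%N -> F k y -> `|A (w (phi m)) y (rho k) - cl (k, y)| <= e m.
  have [|phi [h1 h2]] := @increasing_choice (fun m n => forall k y, (k <= m)%N -> F k y ->
      `|A (w n) y (rho k) - cl (k, y)| <= e m); last by exists phi.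
  move=> m n0.
  (* Step [m] asks only for the nets of the stages [k <= m], which keeps the index set finite. *)
  pose J : set (nat * X) := \bigcup_(k in `I_m.+1) (pair k @` F k).
  have finJ : finite_set J.
    apply: bigcup_finite => // k _; apply: finite_image.
    by have [_ []] := hz k.
  have [n nn hn] := hcl J (e m) n0 finJ (e0 m).
  exists n => // k y km Fky; have := hn (k, y).
  rewrite /a/= mem_set//; apply.
  by exists k => //; exists y.
have hwn n : exists Nn : set (g_sigma_algebraType Snu), [/\ measurable Nn, nu Nn = 0%E &
    forall x, E x -> ~ Nn x -> ubar mu (w n) x \is a fin_num].
  have [r hr hth] := small 1 ltr01.
  have [Nn [mNn Nn0 hNn]] := osc_ae_summable dp p1 pq hr ltr01 hth M0 (cw n).
  exists Nn; split => // x Ex Nx; have [t ht] := hNn x Ex Nx.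
  have [iu _ _] := cw n.
  by have [L [->]] := osc_summable_limit dp Ex hr (L1loc_loc iu) ht.
have [Nw hNw] := choice hwn.
(* Stage [j] compares just [phi j] and [phi j.+1], so two sets of measure at most [e j] suffice, and
   these measures are summable. *)
pose Bad j := NN j (phi j) `|` NN j (phi j.+1).
have mBad j : measurable (Bad j).
  by have [_ _ _ _ h] := hz j; apply: measurableU; [have [] := h (phi j)|have [] := h (phi j.+1)].
have mlimBad : measurable (lim_sup_set Bad).
  by apply: bigcapT_measurable => n; apply: bigcup_measurable => k _; exact: mBad.
have nuBad : nu (lim_sup_set Bad) = 0%E.
  apply: lim_sup_set_cvg0 => //.
  apply: (@le_lt_trans _ _ 4%:E); last exact: ltry.
  apply: (@le_trans _ _ (\sum_(n <oo) (2 * e n)%:E)%E).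
    apply: lee_nneseries => [n _ _|n _]; first exact: measure_ge0.
    have [_ _ _ _ h] := hz n; have [m1 n1 _] := h (phi n); have [m2 n2 _] := h (phi n.+1).
    apply: (@le_trans _ _ (nu (NN n (phi n)) + nu (NN n (phi n.+1)))%E).
      exact: measureU2.
    by rewrite mulr_natl mulr2n EFinD leeD.
  apply: nneseries_le_partial => n; first by rewrite mulr_ge0// ltW.
  rewrite -mulr_sumr; have : \sum_(i < n) e i <= (1 - 2^-1)^-1.
    by apply: geometric_partial_le; lra.
  have -> : 1 - 2^-1 = 2^-1 :> R by lra.
  rewrite invrK; lra.
exists phi, ((\bigcup_k N0 k) `|` (\bigcup_n Nw n) `|` lim_sup_set Bad); split => //.
- apply: measurableU => //; apply: measurableU.
  + by apply: bigcupT_measurable => k; have [_ _ []] := hz k.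
  + by apply: bigcupT_measurable => n; have [] := hNw n.
- apply: measureU_eq0 => //.
  + by apply: measurableU; apply: bigcupT_measurable => k;
      [have [_ _ []] := hz k|have [] := hNw k].
  + apply: measureU_eq0; do ?[by apply: bigcupT_measurable => k;
      [have [_ _ []] := hz k]|by apply: bigcupT_measurable => k; have [] := hNw k].
    * by apply: measure_bigcup_eq0 => k; have [_ _ []] := hz k.
    * by apply: measure_bigcup_eq0 => k; have [] := hNw k.
move=> x Ex /not_orP[/not_orP[nN0 nNw] nBad]; split.
  by move=> n; have [_ _ h] := hNw n; apply: h => // Nx; apply: nNw; exists n.
have [j0 hj0] : exists j0, forall j, (j0 <= j)%N -> ~ Bad j x.
  apply: contrapT => /forallNP nj; apply: nBad => j0 _.
  have /existsNP[j /not_implyP[jj /contrapT ?]] := nj j0.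
  by exists j.
(* Both representatives are within [K * (1 + K) * e j] of their averages at [y], and both averages
   within [e j] of [cl (j, y)]. *)
apply: (@geometric_cauchy_cvg _ _ (2 * (K * (1 + K)) + 2) j0) => j jj.
have /not_orP[nb1 nb2] := hj0 j jj.
have [[rho0 r2] [_ FE] _ [cov _] hNN] := hz j.
have [y Fy yx] : exists2 y, F j y & ball y (rho j) x.
  by apply: cov => // N0x; apply: nN0; exists j.
have Ey := FE _ Fy.
have [_ _ osc1] := hNN (phi j); have [_ _ osc2] := hNN (phi j.+1).
have [iu1 _ _] := cw (phi j); have [iu2 _ _] := cw (phi j.+1).
have [L1 [-> _ h1]] := ubar_net dp Ex Ey yx rho0 r2 iu1 (osc1 x Ex nb1).
have [L2 [-> _ h2]] := ubar_net dp Ex Ey yx rho0 r2 iu2 (osc2 x Ex nb2).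
have h3 := hphi j j y (leqnn _) Fy.
have h4 := hphi j.+1 j y (leqnSn _) Fy.
have ej : e j.+1 <= e j by rewrite /e ler_wiXn2l//; lra.
rewrite /= -/(e j).
move: h1 h2 h3 h4; rewrite !ler_norml => /andP[? ?] /andP[? ?] /andP[? ?] /andP[? ?].
apply/andP; split; lra.
Qed.

End ae_subsequence.

(** * Tail bounds *)

Section tail_bounds.
Context {R : realType} {X : pmetricType R} {Smu Snu : set (set X)}.
Variable mu : {measure set (g_sigma_algebraType Smu) -> \bar R}.
Variable nu : {measure set (g_sigma_algebraType Snu) -> \bar R}.
Variables (E : set X) (lam K delta r1 alpha p q : R).
Hypothesis dp : doubling_pair mu nu E lam K delta r1.
Hypotheses (p1 : 1 <= p) (pq : p < q).
Implicit Types (u g : X -> R).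

Local Notation A u x r := (avg mu (ball x r) u).
Local Notation D u x r := (dev mu (ball x r) u).
Local Notation controlled := (controlled mu E lam r1 alpha p).

Let K0 : 0 < K. Proof. by rewrite (lt_le_trans _ (dp_K dp)). Qed.
Let p0 : 0 < p. Proof. by rewrite (lt_le_trans _ p1). Qed.
Let q0 : 0 < q. Proof. by rewrite (lt_trans _ pq). Qed.

Definition ubarR u (x : g_sigma_algebraType Snu) : R := fine (ubar mu u x).

(** The gap [d = q - q'] turns the layer cake series into a geometric one of ratio [2 ^ (- d)] with
    a prefactor [T ^ (- d)]. For [q' = q] both gains disappear, which is where truncation takes
    over. *)
Lemma weak_tail q' rho theta M Lam e : 0 < q' -> q' < q -> 0 < rho -> 2 * rho <= r1 ->
  0 < theta -> theta_le mu nu E lam alpha p q (2 * rho) theta -> 0 < M -> 0 < Lam ->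
  0 < e ->
  exists2 T, 0 < T & forall u g (S : set (g_sigma_algebraType Snu)), controlled M u g ->
    measurable S -> S `<=` E -> measurable_fun S (ubarR u) ->
    (forall x, S x -> D u x (2 * rho) 0 <= Lam * M) ->
    (tail nu S (ubarR u) q' T <= e%:E)%E.
Proof.
move=> q'0 q'q rho0 r2 th0 hth M0 L0 e0.
have h2 : 0 < 2 * rho <= r1 by rewrite r2 mulr_gt0.
have [c c0 weak] := osc_sum_weak_type dp alpha p1 pq.
pose d := q - q'; have d0 : 0 < d by rewrite subr_gt0.
pose B := c * 1 * theta * M * (4 * K).
have B0 : 0 < B by rewrite !mulr_gt0.
pose z : R := 2^-1 `^ d.
have z0 : 0 < z by rewrite powR_gt0// invr_gt0.
have z1 : z < 1 by exact: powR_half_lt1.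
pose W := 2 `^ q' * B `^ q / (1 - z).
have W0 : 0 < W by rewrite divr_gt0 ?subr_gt0// mulr_gt0// powR_gt0.
(* The first entry keeps the average below half of any level [s >= T], with a quarter of [s] left to
   the weak type estimate; the second makes the series at most [e]. *)
pose T := Num.max (2 * (Lam * M)) ((W / e) `^ d^-1).
have LM0 : 0 < 2 * (Lam * M) by rewrite !mulr_gt0.
have T0 : 0 < T by rewrite lt_max LM0.
exists T => // u g S cu mS SE mf hD; have [iu grad hM] := cu.
have level s : T <= s ->
    (nu (S `&` [set x | s <= `|ubarR u x|]%R) <= ((B / s) `^ q)%:E)%E.
  move=> Ts; have s0 : 0 < s by rewrite (lt_le_trans T0).
  have t0 : 0 < s / (4 * K) by rewrite divr_gt0// mulr_gt0.
  have [N [mN nuN hN]] := weak (2 * rho) theta 1 M (s / (4 * K)) u g h2 th0 hth ltr01 M0 t0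
    (L1loc_loc iu) grad hM.
  apply: (@le_trans _ _ (nu N)); last first.
    apply: (le_trans nuN); rewrite lee_fin le_eqVlt; apply/orP; left; apply/eqP.
    by congr (_ `^ q); rewrite /B invf_div -[RHS]mulrA.
  apply: le_measure; rewrite ?inE//; first exact: measurable_level.
  move=> x [Sx /= sx]; apply: contrapT => Nx; have Ex := SE _ Sx.
  have [L [uL AL _]] := osc_summable_limit dp Ex h2 (L1loc_loc iu) (hN x Ex Nx).
  move: sx; rewrite /ubarR uL/= => sL.
  have A0 : `|A u x (2 * rho)| <= Lam * M.
    rewrite -[A u _ _]subr0; apply: le_trans (hD _ Sx).
    by apply: (lipschitz_avg_le dp Ex) => //; exact: L1loc_loc.
  have KT : K * (s / (4 * K)) = s / 4.
    by rewrite invfM [4^-1 * _]mulrC mulrCA mulVKf ?gt_eqF.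
  move: AL; rewrite KT => AL.
  have Ts2 : 2 * (Lam * M) <= s by apply: le_trans Ts; rewrite le_max lexx.
  have := ler_normD (L - A u x (2 * rho)) (A u x (2 * rho)); rewrite subrK; lra.
apply: (le_trans (tail_le_series nu mS mf q'0 T0)).
have termE k : (2 ^+ k.+1 * T) `^ q' * (B / (2 ^+ k * T)) `^ q =
    2 `^ q' * B `^ q * T `^ (- d) * z ^+ k.
  have s0 : 0 < 2 ^+ k * T by rewrite mulr_gt0// exprn_gt0.
  rewrite exprS -mulrA (powRM _ _ (ltW s0))// (powRM _ (ltW B0)) ?invr_ge0 ?(ltW s0)//.
  rewrite (powR_invl _ (ltW s0)) mulrACA -[RHS]mulrA; congr (_ * _).
  rewrite -powRD; last by rewrite (gt_eqF s0) implybT.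
  have -> : q' + - q = - d by rewrite /d opprB.
  rewrite powRM ?exprn_ge0 ?(ltW T0)// mulrC powR_exprn//.
  by rewrite /z powR_invl.
apply: (@le_trans _ _ (\sum_(k <oo) (2 `^ q' * B `^ q * T `^ (- d) * z ^+ k)%:E)%E).
  apply: lee_nneseries => [k _ _|k _].
    by rewrite mule_ge0// lee_fin powR_ge0.
  rewrite -termE EFinM; apply: lee_wpmul2l; first by rewrite lee_fin powR_ge0.
  by apply: level; rewrite ler_peMl ?(ltW T0)// exprn_ege1// ler1n.
have C0 : 0 <= 2 `^ q' * B `^ q * T `^ (- d) by rewrite !mulr_ge0// powR_ge0.
apply: nneseries_le_partial => [k|n]; first by rewrite mulr_ge0// exprn_ge0// ltW.
rewrite -mulr_sumr.
apply: (@le_trans _ _ (2 `^ q' * B `^ q * T `^ (- d) * (1 - z)^-1)).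
  by rewrite ler_wpM2l// geometric_partial_le// ltW.
rewrite mulrAC -/W powRN ler_pdivrMr ?powR_gt0// mulrC -ler_pdivrMr//.
have -> : W / e = ((W / e) `^ d^-1) `^ d.
  by rewrite -powRrM mulVf ?gt_eqF// powRr1// divr_ge0 ?(ltW e0) ?(ltW W0).
rewrite ge0_ler_powR ?nnegrE ?powR_ge0 ?(ltW d0) ?(ltW T0)//.
by rewrite le_max lexx orbT.
Qed.

(** The scalar map behind [trunc], needed to truncate the values of [ubarR] as well. *)
Definition truncR (a b s : R) : R := Num.max a (Num.min s b).

Lemma truncR_lipschitz a b s s' : `|truncR a b s - truncR a b s'| <= `|s - s'|.
Proof.
have lip (x y : R) : - `|x - y| <= x - y <= `|x - y|.
  by rewrite -ler_norml.
rewrite /truncR; apply: (@le_trans _ _ `|Num.min s b - Num.min s' b|).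
  move: (Num.min s b) (Num.min s' b) => x y; have /andP[l1 l2] := lip x y.
  rewrite ler_norml /Num.max; case: (ltP a x) => ?; case: (ltP a y) => ?;
    by apply/andP; split; lra.
have /andP[l1 l2] := lip s s'; rewrite ler_norml /Num.min.
case: (ltP s b) => ?; case: (ltP s' b) => ?.
all: by apply/andP; split; lra.
Qed.

Definition trunc_controlled (kappa : R) u g : Prop :=
  forall a b, a < b -> osc_gradient mu E lam r1 alpha p kappa (trunc a b u)
    (trunc_gradient a b u g).

Lemma trunc_integrable a b u : L1loc mu u -> loc_integrable mu E r1 (trunc a b u).
Proof.
move=> iu x r Ex hr; have hB := dp_mu dp Ex hr.
have mB := hB.1; have /andP[r0 _] := hr.
have mu_ : measurable_fun (ball x r : set (g_sigma_algebraType Smu)) u.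
  by apply/measurable_EFinP; apply: measurable_int; exact: iu.
have ib := integrable_cst (`|a| + `|b|) hB.
apply: le_integrable ib => //.
  apply/measurable_EFinP.
  apply: measurable_maxr => //; exact: measurable_minr.
move=> y _ /=; rewrite lee_fin [leRHS]ger0_norm ?addr_ge0//.
have := (ler_norm a, ler_norm b, ler_norm (- a), ler_norm (- b)); rewrite !normrN.
have := normr_ge0 a; have := normr_ge0 b.
move=> ? ? [[[? ?] ?] ?].
rewrite /trunc /Num.max /Num.min ler_norml; case: (ltP (u y) b) => ?.
all: by case: ltP => ?; apply/andP; split; lra.
Qed.

(** Where the oscillation sums of [u] and of its truncation are both bounded, truncating the limit
    of the averages of [u] gives the limit for the truncation, since truncation is 1-Lipschitz. The
    weak type estimate for the truncation thus bears on [ubar u]. *)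
Lemma trunc_level_weak : exists2 c, 0 < c &
  forall rho theta kappa u g a b B t, 0 < rho -> 2 * rho <= r1 -> 0 < theta ->
    theta_le mu nu E lam alpha p q (2 * rho) theta -> 0 < kappa -> 0 < B -> 0 < t ->
    a < b -> L1loc mu u -> trunc_controlled kappa u g ->
    (\int[mu]_y (trunc_gradient a b u g y `^ p)%:E <= (B `^ p)%:E)%E ->
    exists N : set (g_sigma_algebraType Snu), [/\ measurable N,
      (nu N <= ((c * kappa * theta * B / t) `^ q)%:E)%E &
      forall x, E x -> ~ N x ->
        (exists t', forall n, \sum_(i < n) osc mu u x (dyad (2 * rho) i) <= t') ->
        `|truncR a b (ubarR u x) - A (trunc a b u) x (2 * rho)| <= K * t].
Proof.
have [c c0 weak] := osc_sum_weak_type dp alpha p1 pq.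
exists c => // rho theta kappa u g a b B t rho0 r2 th0 hth k0 B0 t0 ab iu tc hB.
have h2 : 0 < 2 * rho <= r1 by rewrite r2 mulr_gt0.
have iw := trunc_integrable a b iu.
have [N [mN nuN hN]] := weak (2 * rho) theta kappa B t _ _ h2 th0 hth k0 B0 t0 iw (tc a b ab) hB.
exists N; split => // x Ex Nx [t' ht'].
have [L [uL _ DL]] := osc_summable_limit dp Ex h2 (L1loc_loc iu) ht'.
have [L' [_ AL' DL']] := osc_summable_limit dp Ex h2 iw (hN x Ex Nx).
rewrite /ubarR uL/=; suff -> : truncR a b L = L' by [].
have /andP[h20 h2r] := h2.
have hrad n : 0 < dyad (2 * rho) n <= r1.
  by rewrite dyad_gt0//= (le_trans (dyad_le n h20)).
apply/eqP; rewrite -subr_eq0 -normr_le0; apply/ler_addgt0Pr => e e0.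
have e2 : 0 < e / 2 by rewrite divr_gt0.
have /cvgrPdist_le/(_ _ e2)[n1 _ hn1] := DL; have /cvgrPdist_le/(_ _ e2)[n2 _ hn2] := DL'.
pose n := maxn n1 n2.
have := hn1 n (leq_maxl _ _); have := hn2 n (leq_maxr _ _).
rewrite /= !sub0r !normrN => /(le_trans (ler_norm _)) hw /(le_trans (ler_norm _)) hu.
have a1 : `|A (trunc a b u) x (dyad (2 * rho) n) - truncR a b L| <= D u x (dyad (2 * rho) n) L.
  apply: (lipschitz_avg_le dp Ex (hrad n) (L1loc_loc iu) iw) => y.
  exact: truncR_lipschitz.
have a2 : `|A (trunc a b u) x (dyad (2 * rho) n) - L'| <= D (trunc a b u) x (dyad (2 * rho) n) L'.
  exact: (lipschitz_avg_le dp Ex (hrad n) iw iw).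
rewrite add0r.
move: a1 a2; rewrite !ler_norml => /andP[? ?] /andP[? ?]; apply/andP; split; lra.
Qed.

End tail_bounds.

(** * Maz'ya's truncation at the critical exponent *)

Section truncation_tail.
Context {R : realType} {X : pmetricType R} {Smu Snu : set (set X)}.
Variable mu : {measure set (g_sigma_algebraType Smu) -> \bar R}.
Variable nu : {measure set (g_sigma_algebraType Snu) -> \bar R}.
Variables (E : set X) (lam K delta r1 alpha p q : R).
Hypothesis dp : doubling_pair mu nu E lam K delta r1.
Hypotheses (p1 : 1 <= p) (pq : p < q).
Implicit Types (u g : X -> R).

Local Notation A u x r := (avg mu (ball x r) u).
Local Notation D u x r := (dev mu (ball x r) u).
Local Notation controlled := (controlled mu E lam r1 alpha p).

Let K0 : 0 < K. Proof. by rewrite (lt_le_trans _ (dp_K dp)). Qed.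
Let p0 : 0 < p. Proof. by rewrite (lt_le_trans _ p1). Qed.
Let q0 : 0 < q. Proof. by rewrite (lt_trans _ pq). Qed.

Local Notation ubarR := (ubarR mu).
Local Notation trunc_controlled := (trunc_controlled mu E lam r1 alpha p).

(** With [s = 2 ^+ k * B] these are the points where [2 * s < |u| < 4 * s], strictly between two
    truncation levels as in [trunc_gradient]. *)
Definition annulus u (B : R) (k : nat) : set (g_sigma_algebraType Smu) :=
  [set y | 2 ^+ k.+1 * B < `|u y| < 2 ^+ k.+2 * B].

Lemma trunc_gradient_annulus u g (B a b : R) k : L1loc mu u -> (forall y, 0 <= g y) ->
  measurable_fun (setT : set (g_sigma_algebraType Smu)) g ->
  measurable (annulus u B k) ->
  (forall y, a < u y < b -> annulus u B k y) ->
  (\int[mu]_y (trunc_gradient a b u g y `^ p)%:E <=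
   \int[mu]_(y in annulus u B k) (g y `^ p)%:E)%E.
Proof.
move=> iu g0 mg mA sub; rewrite [leRHS]integral_mkcond.
have mgp : measurable_fun (setT : set (g_sigma_algebraType Smu)) (fun y => (g y `^ p)%:E).
  apply/measurable_EFinP.
  exact: (measurableT_comp (f := fun z : R => z `^ p) (measurable_powR p)).
have mu_ := L1loc_measurable (dp_omu dp) iu.
apply: ge0_le_integral => //.
- by move=> y _; rewrite lee_fin powR_ge0.
- apply/measurable_EFinP.
  apply: (measurableT_comp (f := fun z : R => z `^ p) (measurable_powR p)).
  apply: measurable_funM => //; apply: measurable_indic.
  have := mu_ measurableT _ (measurable_itv `]a, b[); rewrite setTI; congr measurable.
- by apply/(measurable_restrictT _ mA); exact: measurable_funS mgp.
- move=> y _; rewrite patchE /trunc_gradient indicE.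
  have [/set_mem/sub hy|/negP hy] := boolP (y \in [set z | (a < u z < b)%R]).
    by rewrite mem_set// mulr1.
  by rewrite mulr0 powR0 ?gt_eqF//; case: ifP => // _; rewrite lee_fin powR_ge0.
Qed.

Lemma measurable_annulus u (B : R) k : L1loc mu u -> measurable (annulus u B k).
Proof.
move=> iu; have mu_ := L1loc_measurable (dp_omu dp) iu.
have mn : measurable_fun (setT : set (g_sigma_algebraType Smu)) (fun y => `|u y|).
  exact: measurableT_comp.
by have := mn measurableT _ (measurable_itv `]2 ^+ k.+1 * B, 2 ^+ k.+2 * B[); rewrite setTI.
Qed.

Lemma annulus_sum_le u g (B M : R) n : 0 < B -> controlled M u g ->
  \sum_(k < n) fine (\int[mu]_(y in annulus u B k) (g y `^ p)%:E)%E <= M `^ p.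
Proof.
move=> B0 [iu [g0 mg _] hM].
have mA k := measurable_annulus B k iu.
have mgp : measurable_fun (setT : set (g_sigma_algebraType Smu)) (fun y => (g y `^ p)%:E).
  apply/measurable_EFinP.
  exact: (measurableT_comp (f := fun z : R => z `^ p) (measurable_powR p)).
have gp0 (y : X) : (0 <= (g y `^ p)%:E)%E by rewrite lee_fin powR_ge0.
have I0 k : (0 <= \int[mu]_(y in annulus u B k) (g y `^ p)%:E)%E by exact: integral_ge0.
have Ifin k : (\int[mu]_(y in annulus u B k) (g y `^ p)%:E)%E \is a fin_num.
  rewrite ge0_fin_numE//; apply: (@le_lt_trans _ _ (M `^ p)%:E); last exact: ltry.
  apply: le_trans hM; exact: ge0_subset_integral.
have tA : trivIset setT (annulus u B).
  have lt i j y : (i < j)%N -> annulus u B i y -> annulus u B j y -> False.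
    move=> ij /andP[_ h1] /andP[h2 _]; have := lt_trans h2 h1.
    by rewrite ltr_pM2r// ltr_eXn2l ?ltr1n// !ltnS leqNgt ij.
  move=> i j _ _ [y [hi hj]]; have [ij|ji|//] := ltngtP i j.
    by case: (lt _ _ _ ij hi hj).
  by case: (lt _ _ _ ji hj hi).
rewrite -lee_fin -sumEFin; apply: le_trans hM.
rewrite (eq_bigr (fun k : 'I_n => \int[mu]_(y in annulus u B k) (g y `^ p)%:E)%E); last first.
  by move=> k _; rewrite fineK.
apply: (@le_trans _ _ (\sum_(k <oo) \int[mu]_(y in annulus u B k) (g y `^ p)%:E)%E).
  rewrite -(big_mkord xpredT (fun k => \int[mu]_(y in annulus u B k) (g y `^ p)%:E)%E).
  by apply: nneseries_lim_ge.
rewrite -ge0_integral_bigcup//; last exact: measurable_funS mgp.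
apply: ge0_subset_integral => //; exact: bigcupT_measurable.
Qed.

(* Maz'ya's truncation argument: the weak type estimate is applied to the truncations of
   [u] between consecutive dyadic levels, whose gradients live on disjoint annuli;
   the summand [M `^ p * 2^-1 ^+ k] only serves to make the bounds positive. *)
Lemma trunc_tail kappa : 0 < kappa -> exists2 c, 0 < c &
  forall rho theta M B u g (S : set (g_sigma_algebraType Snu)),
    0 < rho -> 2 * rho <= r1 -> 0 < theta ->
    theta_le mu nu E lam alpha p q (2 * rho) theta -> 0 < M -> 0 < B ->
    controlled M u g -> trunc_controlled kappa u g ->
    measurable S -> S `<=` E -> measurable_fun S (ubarR u) ->
    (forall x, S x -> D u x (2 * rho) 0 <= B) ->
    (forall x, S x -> exists t, forall n, \sum_(i < n) osc mu u x (dyad (2 * rho) i) <= t) ->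
    (tail nu S (ubarR u) q (4 * B) <= (c * (theta * M) `^ q)%:E)%E.
Proof.
move=> k0; have [c c0 weak] := trunc_level_weak alpha dp p1 pq.
(* The factor [16 * K] is the level [8 * s k] of the layer cake divided by the threshold
   [s k / (2 * K)]. *)
pose C1 := 16 * K * c * kappa; have C10 : 0 < C1 by rewrite !mulr_gt0.
exists (2 * C1 `^ q * 3 `^ (q / p)); first by rewrite !mulr_gt0 ?powR_gt0.
move=> rho theta M B u g S rho0 r2 th0 hth M0 B0 cu tc mS SE mf hD sumS.
have h2 : 0 < 2 * rho <= r1 by rewrite r2 mulr_gt0.
have [iu [g0 mg gradi] hM] := cu.
have mA k := measurable_annulus B k iu.
pose I k := fine (\int[mu]_(y in annulus u B k) (g y `^ p)%:E)%E.
have I0 k : 0 <= I k.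
  by apply: fine_ge0; apply: integral_ge0 => y _; rewrite lee_fin powR_ge0.
have IM n : \sum_(k < n) I k <= M `^ p by exact: annulus_sum_le.
have Mp0 : 0 < M `^ p by rewrite powR_gt0.
pose J k := I k + M `^ p * 2^-1 ^+ k.
have J0 k : 0 < J k by rewrite ltr_wpDl// mulr_gt0// exprn_gt0.
have JM n : \sum_(k < n) J k <= 3 * M `^ p.
  rewrite big_split/= -mulr_sumr.
  have : \sum_(i < n) (2^-1 : R) ^+ i <= (1 - 2^-1)^-1 by apply: geometric_partial_le; lra.
  have -> : 1 - 2^-1 = 2^-1 :> R by lra.
  rewrite invrK => /(ler_wpM2l (ltW Mp0)); have := IM n; lra.
pose Ak k := J k `^ p^-1.
have Ak0 k : 0 < Ak k by rewrite powR_gt0.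
have AkE k : Ak k `^ p = J k by rewrite -powRrM mulVf ?gt_eqF// powRr1// ltW.
have IA k : (\int[mu]_(y in annulus u B k) (g y `^ p)%:E <= (Ak k `^ p)%:E)%E.
  rewrite AkE /J; apply: (@le_trans _ _ (I k)%:E); last first.
    by rewrite lee_fin lerDl mulr_ge0 ?exprn_ge0 ?(ltW Mp0).
  rewrite fineK// ge0_fin_numE; last by apply: integral_ge0 => y _; rewrite lee_fin powR_ge0.
  apply: (@le_lt_trans _ _ (M `^ p)%:E); last exact: ltry.
  apply: le_trans hM; apply: ge0_subset_integral => //.
    apply/measurable_EFinP.
    exact: (measurableT_comp (f := fun z : R => z `^ p) (measurable_powR p)).
  by move=> y _; rewrite lee_fin powR_ge0.
pose s k := 2 ^+ k * B.
have s0 k : 0 < s k by rewrite mulr_gt0// exprn_gt0.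
have sB k : B <= s k by rewrite ler_peMl ?(ltW B0)// exprn_ege1// ler1n.
have s1 k : 2 ^+ k.+1 * B = 2 * s k by rewrite exprS -mulrA.
have s2 k : 2 ^+ k.+2 * B = 4 * s k by rewrite !exprS /s; lra.
have level k : (nu (S `&` [set x | 4 * s k <= `|ubarR u x|]%R) <=
    (2 * (c * kappa * theta * Ak k / (s k / (2 * K))) `^ q)%:E)%E.
  (* Up to sign, the average of the truncation is within [B <= s k] of [2 * s k], the truncation of
     [0], while the truncated value is [4 * s k]: a gap of at least [s k], twice what is allowed off
     the exceptional set. *)
  have t0 : 0 < s k / (2 * K) by rewrite divr_gt0// mulr_gt0.
  have KT : K * (s k / (2 * K)) = s k / 2.
    by rewrite invfM [2^-1 * _]mulrC mulrCA mulVKf ?gt_eqF.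
  (* Positive and negative values are truncated separately; both gradients live on the annulus [k],
     and the union of the exceptional sets costs a factor [2]. *)
  have ab1 : 2 * s k < 4 * s k by rewrite ltr_pM2r//; lra.
  have ab2 : - (4 * s k) < - (2 * s k) by rewrite ltrN2.
  have g1 : (\int[mu]_y (trunc_gradient (2 * s k) (4 * s k) u g y `^ p)%:E <= (Ak k `^ p)%:E)%E.
    apply: le_trans (IA k); apply: trunc_gradient_annulus => // y /andP[h1 h3].
    rewrite /annulus/= s1 s2; have := s0 k => ?.
    by rewrite ger0_norm; [apply/andP; split|lra].
  have g2 : (\int[mu]_y (trunc_gradient (- (4 * s k)) (- (2 * s k)) u g y `^ p)%:E <=
      (Ak k `^ p)%:E)%E.
    apply: le_trans (IA k); apply: trunc_gradient_annulus => // y /andP[h1 h3].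
    rewrite /annulus/= s1 s2; have := s0 k => ?.
    by rewrite ler0_norm; [apply/andP; split; lra|lra].
  have [N1 [mN1 nuN1 hN1]] := weak rho theta kappa u g _ _ (Ak k) _ rho0 r2 th0 hth k0 (Ak0 k) t0
    ab1 iu tc g1.
  have [N2 [mN2 nuN2 hN2]] := weak rho theta kappa u g _ _ (Ak k) _ rho0 r2 th0 hth k0 (Ak0 k) t0
    ab2 iu tc g2.
  apply: (@le_trans _ _ (nu (N1 `|` N2))); last first.
    apply: (@le_trans _ _ (nu N1 + nu N2)%E); first exact: measureU2.
    by rewrite [X in X%:E]mulr_natl mulr2n EFinD leeD.
  apply: le_measure; rewrite ?inE//; [exact: measurable_level|exact: measurableU|].
  move=> x [Sx /= sx]; apply: contrapT => /not_orP[nN1 nN2]; have Ex := SE _ Sx.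
  have iw a b := trunc_integrable dp a b iu.
  have near0 a b c' : (forall y, `|truncR a b (u y) - c'| <= `|u y - 0|) ->
      `|A (trunc a b u) x (2 * rho) - c'| <= B.
    move=> h; apply: le_trans (hD _ Sx).
    by apply: (lipschitz_avg_le dp Ex h2 (L1loc_loc iu)); [exact: iw|exact: h].
  have sk := s0 k; have sBk := sB k.
  have [f0|f0] := leP 0 (ubarR u x).
    have e1 : truncR (2 * s k) (4 * s k) (ubarR u x) = 4 * s k.
      move: sx; rewrite ger0_norm// => sx; rewrite /truncR (min_idPr sx).
      by apply/max_idPr; exact: ltW.
    have e0 : truncR (2 * s k) (4 * s k) 0 = 2 * s k.
      by rewrite /truncR; apply/max_idPl; rewrite ge_min; apply/orP; left; lra.
    have hz : `|A (trunc (2 * s k) (4 * s k) u) x (2 * rho) - 2 * s k| <= B.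
      by apply: near0 => y; rewrite -[X in `|_ - X| <= _]e0 truncR_lipschitz.
    have := hN1 x Ex nN1 (sumS x Sx); move: hz.
    rewrite KT e1 !ler_norml => /andP[h1 h3] /andP[h4 h5]; lra.
  have e1 : truncR (- (4 * s k)) (- (2 * s k)) (ubarR u x) = - (4 * s k).
    move: sx; rewrite ltr0_norm// lerNr => sx; rewrite /truncR.
    have /min_idPl-> : ubarR u x <= - (2 * s k) by lra.
    by apply/max_idPl.
  have e0 : truncR (- (4 * s k)) (- (2 * s k)) 0 = - (2 * s k).
    rewrite /truncR; have /min_idPr-> : - (2 * s k) <= 0 by lra.
    by apply/max_idPr; lra.
  have hz : `|A (trunc (- (4 * s k)) (- (2 * s k)) u) x (2 * rho) - - (2 * s k)| <= B.
    by apply: near0 => y; rewrite -[X in `|_ - X| <= _]e0 truncR_lipschitz.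
  have := hN2 x Ex nN2 (sumS x Sx); move: hz.
  rewrite KT e1 !ler_norml => /andP[h1 h3] /andP[h4 h5]; lra.
have B40 : 0 < 4 * B by rewrite mulr_gt0.
apply: (le_trans (tail_le_series nu mS mf q0 B40)).
(* Since [p < q], the power [J k ^ (q / p)] is at most [(3 * M ^ p) ^ d * J k], so summability of
   [J] is enough. *)
pose d := q / p - 1.
have d0 : 0 <= d by rewrite subr_ge0 ler_pdivlMr// mul1r ltW.
pose W := 2 * (C1 * theta) `^ q * (3 * M `^ p) `^ d.
have W0 : 0 <= W by rewrite !mulr_ge0 ?powR_ge0.
apply: (@le_trans _ _ (\sum_(k <oo) (W * J k)%:E)%E).
  apply: lee_nneseries => [k _ _|k _].
    by rewrite mule_ge0// lee_fin powR_ge0.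
  have -> : 2 ^+ k * (4 * B) = 4 * s k by rewrite /s; lra.
  have -> : 2 ^+ k.+1 * (4 * B) = 8 * s k by rewrite exprS /s; lra.
  apply: (@le_trans _ _ (((8 * s k) `^ q)%:E *
      (2 * (c * kappa * theta * Ak k / (s k / (2 * K))) `^ q)%:E)%E).
    by apply: lee_wpmul2l; [rewrite lee_fin powR_ge0|exact: level].
  rewrite -EFinM lee_fin mulrCA -powRM; last 2 first.
  + by rewrite mulr_ge0 ?(ltW (s0 k)).
  + have Y0 : 0 < c * kappa * theta * Ak k by rewrite !mulr_gt0.
    by rewrite ltW// divr_gt0// divr_gt0// mulr_gt0.
  have -> : 8 * s k * (c * kappa * theta * Ak k / (s k / (2 * K))) = C1 * theta * Ak k.
    rewrite invf_div mulrACA [s k * _]mulrCA divff ?mulr1 ?gt_eqF// /C1; lra.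
  rewrite (powRM _ (ltW (mulr_gt0 C10 th0)) (ltW (Ak0 k))) /W -!mulrA ler_wpM2l// ler_wpM2l ?powR_ge0//.
  have JkM : J k <= 3 * M `^ p.
    by apply: le_trans (JM k.+1); rewrite big_ord_recr/= lerDr sumr_ge0// => i _; exact: ltW.
  have -> : Ak k `^ q = J k `^ d * J k.
    rewrite -[X in _ * X](powRr1 (ltW (J0 k))) -powRD; last by rewrite (gt_eqF (J0 k)) implybT.
    by rewrite /d subrK -powRrM mulrC.
  rewrite ler_wpM2r ?(ltW (J0 k))// ge0_ler_powR ?nnegrE ?(ltW (J0 k))//.
  by rewrite mulr_ge0// powR_ge0.
apply: nneseries_le_partial => [k|n]; first by rewrite mulr_ge0// ltW.
rewrite -mulr_sumr; apply: (le_trans (ler_wpM2l W0 (JM n))).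
rewrite le_eqVlt; apply/orP; left; apply/eqP.
have Z0 : 0 < 3 * M `^ p by rewrite mulr_gt0.
rewrite /W -[LHS]mulrA; have -> : (3 * M `^ p) `^ d * (3 * M `^ p) = 3 `^ (q / p) * M `^ q.
  rewrite -[X in _ * X](powRr1 (ltW Z0)) -powRD; last by rewrite (gt_eqF Z0) implybT.
  rewrite /d subrK powRM ?powR_ge0// -powRrM.
  by congr (_ * _ `^ _); rewrite mulrCA divff ?mulr1// gt_eqF.
rewrite (powRM q (ltW C10) (ltW th0)) (powRM q (ltW th0) (ltW M0)); lra.
Qed.

End truncation_tail.

(** * Reduction to small scales *)

Section scales.
Context {R : realType} {X : pmetricType R} {Smu Snu : set (set X)}.
Variable mu : {measure set (g_sigma_algebraType Smu) -> \bar R}.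
Variable nu : {measure set (g_sigma_algebraType Snu) -> \bar R}.

Lemma iterated_doubling {S : set (set X)} (m : {measure set (g_sigma_algebraType S) -> \bar R})
    (x : X) (c r r0 : R) :
  1 <= c -> 0 < r ->
  (forall s, 0 < s <= r0 -> (m (ball x (2 * s)) <= c%:E * m (ball x s))%E) ->
  forall j, 2 ^+ j * r <= 2 * r0 -> (m (ball x (2 ^+ j * r)%R) <= (c ^+ j)%:E * m (ball x r))%E.
Proof.
move=> c1 rpos dbl; have c0 : 0 <= c by rewrite (le_trans _ c1).
elim=> [|j IH] hj; first by rewrite !expr0 mul1r mul1e.
have hj' : 2 ^+ j * r <= r0 by move: hj; rewrite exprS; lra.
have pj : 0 < 2 ^+ j * r by rewrite mulr_gt0// exprn_gt0.
have e1 : 2 ^+ j.+1 * r = 2 * (2 ^+ j * r) by rewrite exprS mulrA.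
rewrite e1; apply: (le_trans (dbl _ _)); first by rewrite pj.
rewrite exprS EFinM -muleA; apply: lee_wpmul2l; first by rewrite lee_fin.
by apply: IH; lra.
Qed.

Lemma doubling_pair_exists (E : set X) (C delta r0 lam : R) :
  (forall U : set X, open U -> <<s Smu >> U) ->
  (forall U : set X, open U -> <<s Snu >> U) ->
  totally_bounded E -> 0 < r0 -> 1 <= lam -> 0 < C -> 0 < delta ->
  (forall (x : X) (r' r : R), E x -> 0 < r' -> r' < r -> r <= r0 ->
     [/\ [/\ (0 < mu (ball x (2 * r)))%E,
             (mu (ball x (2 * r)) <= C%:E * mu (ball x r))%E
           & (C%:E * mu (ball x r) < +oo)%E],
         [/\ (0 < nu (ball x (2 * r)))%E,
             (nu (ball x (2 * r)) <= C%:E * nu (ball x r))%E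
           & (C%:E * nu (ball x r) < +oo)%E]
       & (nu (ball x r') / nu (ball x r) <= (C * (r' / r) `^ delta)%:E)%E]) ->
  exists K r1, r1 <= r0 /\ doubling_pair mu nu E lam K delta r1.
Proof.
move=> omu onu tb r00 lam1 C0 delta0 hyp.
have half (r : R) : 0 < r -> r / 2 < r by move=> ?; lra.
have base x r : E x -> 0 < r <= r0 -> [/\ fin_pos mu (ball x r), fin_pos nu (ball x r),
    (mu (ball x (2 * r)) <= C%:E * mu (ball x r))%E &
    (nu (ball x (2 * r)) <= C%:E * nu (ball x r))%E].
  move=> Ex /andP[rpos rr0].
  have r2 : 0 < r / 2 by rewrite divr_gt0.
  (* The hypothesis is indexed by pairs of radii; [r / 2] serves as the smaller one to extract
     doubling at [r]. *)
  have [[m1 m2 m3] [n1 n2 n3] _] := hyp x _ r Ex r2 (half _ rpos) rr0.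
  have aux (z z2 : \bar R) : (0 <= z)%E -> (0 < z2)%E -> (z2 <= C%:E * z)%E ->
      (C%:E * z < +oo)%E -> (0 < z < +oo)%E.
    move=> z0 z20 zz zoo; apply/andP; split.
      by rewrite -(@pmule_rgt0 _ C%:E)// (lt_le_trans z20).
    by move: zoo; case: z z0 zz => [s|//|//] // _ _; rewrite ?ltry// gt0_muley.
  split => //; split.
  - exact: measurable_ball_mu.
  - exact: aux m1 m2 m3.
  - exact: measurable_ball_nu.
  - exact: aux n1 n2 n3.
pose c := Num.max 1 C.
have c1 : 1 <= c by rewrite le_max lexx.
have Cc : C <= c by rewrite le_max lexx orbT.
(* One power of [2] above [4 * lam] covers the factors [lam], [4] and [3 * lam] at once. *)
pose m := (Num.truncn (4 * lam)).+1.
have lam0 : 0 < lam by rewrite (lt_le_trans _ lam1).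
have hm : 4 * lam <= 2 ^+ m.
  have /truncn_itv/andP[_ h] : 0 <= 4 * lam by rewrite mulr_ge0// ltW.
  by rewrite (le_trans (ltW h))// -natrX ler_nat ltnW// ltn_expl.
have m4 : 4 <= 2 ^+ m :> R by lra.
have p2 : 0 < 2 ^+ m :> R by rewrite exprn_gt0.
pose r1 := r0 / 2 ^+ m.
have r10 : 0 < r1 by rewrite divr_gt0.
have r1E : 2 ^+ m * r1 = r0 by rewrite mulrC divfK// gt_eqF.
have sc (r t : R) : 0 < t -> t <= 2 ^+ m -> 0 < r <= r1 -> 0 < t * r <= r0.
  move=> t0 tm /andP[rp rr1]; rewrite mulr_gt0//= -r1E; apply: ler_pM => //; exact: ltW.
have sc1 (r : R) : 0 < r <= r1 -> 0 < r <= r0.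
  by move=> h; rewrite -[r]mul1r; apply: sc => //; lra.
have K1 : 1 <= c ^+ m by rewrite exprn_ege1.
have cK : c <= c ^+ m by rewrite -{1}[c]expr1; apply: ler_weXn2l.
have iter_mu x r : E x -> 0 < r <= r1 ->
    (mu (ball x (2 ^+ m * r)%R) <= (c ^+ m)%:E * mu (ball x r))%E.
  move=> Ex hr; have /andP[rp rr1] := hr.
  apply: (@iterated_doubling Smu mu x c r r0) => //.
    move=> s hs; have [_ _ h _] := base x s Ex hs; apply: (le_trans h).
    by apply: lee_wpmul2r => //; rewrite lee_fin.
  by have /andP[_] := sc r _ p2 (lexx _) hr; lra.
have iter_nu x r : E x -> 0 < r <= r1 ->
    (nu (ball x (2 ^+ m * r)%R) <= (c ^+ m)%:E * nu (ball x r))%E.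
  move=> Ex hr; have /andP[rp rr1] := hr.
  apply: (@iterated_doubling Snu nu x c r r0) => //.
    move=> s hs; have [_ _ _ h] := base x s Ex hs; apply: (le_trans h).
    by apply: lee_wpmul2r => //; rewrite lee_fin.
  by have /andP[_] := sc r _ p2 (lexx _) hr; lra.
exists (c ^+ m), r1; split.
  by have h1 : 0 < r1 <= r1; [rewrite r10 lexx|case/andP: (sc1 _ h1)].
split => //.
- by move=> x r Ex hr; have [] := base x r Ex (sc1 _ hr).
- move=> x r Ex hr; have h : 0 < lam * r <= r0 by apply: sc => //; lra.
  by have [] := base x _ Ex h.
- by move=> x r Ex hr; have [] := base x r Ex (sc1 _ hr).
- move=> x r Ex hr; have [hb _ _ _] := base x r Ex (sc1 _ hr).
  have h4 : fin_pos mu (ball x (4 * r)).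
    have h : 0 < 4 * r <= r0 := sc r 4 (ltr0n _ 4) m4 hr.
    by have [] := base x _ Ex h.
  split => //; rewrite -lee_fin EFinM !fin_posK//.
  apply: le_trans (iter_mu x r Ex hr).
  apply: le_measure; [by apply/mem_set; case: h4|apply/mem_set; exact: (measurable_ball_mu omu)|].
  by apply: le_ball; rewrite ler_pM2r//; case/andP: hr.
- move=> x r Ex hr; apply: le_trans (iter_nu x r Ex hr).
  apply: le_measure; first by apply/mem_set; exact: (measurable_ball_nu onu).
    by apply/mem_set; exact: (measurable_ball_nu onu).
  by apply: le_ball; rewrite mulrA ler_pM2r; [lra|case/andP: hr].
- move=> x s r Ex s0 sr rr1.
  have hr : 0 < r <= r1 by rewrite rr1 (lt_le_trans s0).
  have hs : 0 < s <= r1 by rewrite s0 (le_trans sr).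
  have [_ hnr _ _] := base x r Ex (sc1 _ hr); have [_ hns _ _] := base x s Ex (sc1 _ hs).
  have nr0 := fin_pos_fine hnr.
  (* The decay hypothesis concerns strictly smaller radii; for [s = r] the claim reduces to
     [1 <= K]. *)
  have [->|sr'] := eqVneq s r.
    by rewrite divff ?gt_eqF//; [rewrite powR1 mulr1 ler_peMl// ltW|case/andP: hr].
  have slt : s < r by rewrite lt_neqAle sr'.
  have [_ _] := hyp x s r Ex s0 slt (andP (sc1 _ hr)).2.
  rewrite (fin_pos_inv hnr) -(fin_posK hns) -EFinM lee_fin ler_pdivrMr// => /le_trans; apply.
  by rewrite ler_wpM2r ?(ltW nr0)// ler_wpM2r ?powR_ge0// (le_trans Cc).
Qed.

Variables (E : set X) (lam K delta r1 alpha p : R).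
Hypothesis dp : doubling_pair mu nu E lam K delta r1.
Hypothesis p1 : 1 <= p.

Lemma Theta_theta_le q r theta : r <= r1 ->
  (Theta mu nu alpha p q lam E r <= theta%:E)%E -> theta_le mu nu E lam alpha p q r theta.
Proof.
move=> rr1 hT x s Ex hs; have /andP[s0 sr] := hs.
have hs1 : 0 < s <= r1 by rewrite s0 (le_trans sr).
have hn := dp_nu dp Ex hs1; have hm := dp_mulam dp Ex hs1.
have m0 := fin_pos_fine hm.
have : ((s `^ alpha)%:E * nu (ball x s) `^ q^-1 / mu (ball x (lam * s)%R) `^ p^-1 <= theta%:E)%E.
  apply: le_trans hT; apply: le_trans; last first.
    by apply: ereal_sup_ubound; exists s; [exact: hs|reflexivity].
  by apply: ereal_sup_ubound; exists x.
rewrite -(fin_posK hn) -(fin_posK hm) !poweR_EFin inver gt_eqF ?powR_gt0//.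
by rewrite -!EFinM lee_fin ler_pdivrMr ?powR_gt0.
Qed.

Lemma nu_ball_bound : exists2 b, 0 < b & forall x, E x -> fine (nu (ball x r1)) <= b.
Proof.
have r10 := dp_r1 dp; have lam1 := dp_lam dp.
have hr1 : 0 < r1 <= r1 by rewrite r10 lexx.
have [F finF [FE cov]] := totally_bounded_net dp r10.
have [b b0 hb] := finite_set_ub (fun y => K * fine (nu (ball y r1))) finF.
exists b => // x Ex; have [y Fy yx] := cov x Ex; have Ey := FE _ Fy.
apply: le_trans (hb _ Fy).
have hx := dp_nu dp Ex hr1; have hy := dp_nu dp Ey hr1.
rewrite -lee_fin EFinM !fin_posK//; apply: le_trans (dp_nulam dp Ey hr1).
have onu := dp_onu dp.
apply: le_measure; first by apply/mem_set; exact: (measurable_ball_nu onu).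
  by apply/mem_set; exact: (measurable_ball_nu onu).
apply: sub_ball yx _.
have : r1 <= lam * r1 by rewrite ler_peMl// ltW.
lra.
Qed.

(** Lowering the exponent multiplies by [nu (ball x s) ^ k] with [k = 1/q' - 1/q > 0], and the decay
    of [nu] makes this factor small uniformly over [E]. *)
Lemma theta_small q q' theta0 : 0 < q' -> q' < q -> 0 < theta0 ->
  theta_le mu nu E lam alpha p q r1 theta0 ->
  forall theta, 0 < theta -> exists2 r, 0 < r <= r1 &
    theta_le mu nu E lam alpha p q' r theta.
Proof.
move=> q'0 q'q t00 hth0 theta th0.
have q0 : 0 < q by exact: lt_trans q'q.
have r10 := dp_r1 dp; have delta0 := dp_delta dp.
have K0 : 0 < K by rewrite (lt_le_trans _ (dp_K dp)).
have [b b0 hb] := nu_ball_bound.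
pose k := q'^-1 - q^-1.
have k0 : 0 < k by rewrite subr_gt0 ltf_pV2.
(* Solves [(K * e * b) ^ k = theta / theta0]; below the ratio [m] of radii the decay factor is at
   most [e]. *)
pose e := (theta / theta0) `^ k^-1 / (K * b).
have e0 : 0 < e by rewrite divr_gt0 ?mulr_gt0// powR_gt0// divr_gt0.
pose m := Num.min 1 (e `^ delta^-1).
have m0 : 0 < m by rewrite lt_min ltr01/= powR_gt0.
have mr : 0 < r1 * m <= r1 by rewrite mulr_gt0//= ger_pMr// ge_min lexx.
exists (r1 * m) => // x s Ex /andP[s0 sr].
have sr1 : s <= r1 by apply: (le_trans sr); case/andP: mr.
have hs : 0 < s <= r1 by rewrite s0.
have n0 := fin_pos_fine (dp_nu dp Ex hs).
have nk : fine (nu (ball x s)) `^ k <= theta / theta0.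
  have -> : theta / theta0 = ((theta / theta0) `^ k^-1) `^ k.
    by rewrite -powRrM mulVf ?gt_eqF// powRr1// divr_ge0 ?ltW.
  rewrite ge0_ler_powR ?nnegrE ?powR_ge0 ?(ltW k0) ?(ltW n0)//.
  apply: (le_trans (dp_decay dp Ex s0 sr1 (lexx _))).
  have sm : (s / r1) `^ delta <= e.
    have -> : e = (e `^ delta^-1) `^ delta.
      by rewrite -powRrM mulVf ?gt_eqF// powRr1// ltW.
    rewrite ge0_ler_powR ?nnegrE ?powR_ge0 ?(ltW delta0)//.
      by rewrite divr_ge0// ltW.
    rewrite ler_pdivrMr// mulrC; apply: (le_trans sr); rewrite ler_pM2l//.
    by rewrite ge_min lexx orbT.
  have -> : (theta / theta0) `^ k^-1 = K * e * b.
    have -> : K * e * b = e * (K * b) by lra.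
    by rewrite /e divfK// gt_eqF// mulr_gt0.
  apply: ler_pM; rewrite ?mulr_ge0 ?powR_ge0 ?(ltW K0) ?fine_ge0 ?ler_pM2l//.
  exact: hb.
have := hth0 x s Ex hs.
have -> : q'^-1 = q^-1 + k by rewrite /k addrC subrK.
rewrite powRD ?(gt_eqF n0) ?implybT// mulrA => h.
apply: (@le_trans _ _ (theta0 * fine (mu (ball x (lam * s))) `^ p^-1 * (theta / theta0))).
  by apply: ler_pM; rewrite ?mulr_ge0 ?powR_ge0.
by rewrite mulrAC mulrCA divff ?mulr1// gt_eqF.
Qed.

Lemma nu_E_lty : measurable (E : set (g_sigma_algebraType Snu)) -> (nu E < +oo)%E.
Proof.
move=> mE; have r10 := dp_r1 dp; have hr1 : 0 < r1 <= r1 by rewrite r10 lexx.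
have [F finF [FE cov]] := totally_bounded_net dp r10.
apply: (@le_lt_trans _ _ (\sum_(y \in F) nu (ball y r1))%E).
  apply: content_sub_fsum => //.
    by move=> y _; exact: measurable_ball_nu (dp_onu dp) _ _.
rewrite fsbig_finite//= big_seq lte_sum_pinfty// => y.
by rewrite in_fset_set// => /set_mem Fy; have [_ /andP[]] := dp_nu dp (FE _ Fy) hr1.
Qed.

End scales.

(** * Embeddings *)

Section Lp_norms.
Context {d : measure_display} {T : measurableType d} {R : realType}.
Variable nu : {measure set T -> \bar R}.
Implicit Types (D : set T) (F : T -> \bar R) (t : R).

Lemma Lp_normE D t F : t != 0 ->
  Lp_norm nu D t F = ((\int[nu]_(x in D) `|F x| `^ t) `^ t^-1)%E.
Proof.
move=> t0; rewrite /Lp_norm unlock [in RHS]integral_mkcond; congr (_ `^ _)%E.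
apply: eq_integral => x _; rewrite !patchE; case: ifP => // _.
by rewrite abse0 poweR0r.
Qed.

Lemma Lp_norm1E D F : Lp_norm nu D 1 F = (\int[nu]_(x in D) `|F x|)%E.
Proof.
rewrite Lp_normE ?oner_eq0// invr1 poweRe1; last first.
  by apply: integral_ge0 => x _; exact: poweR_ge0.
by apply: eq_integral => x _; rewrite poweRe1.
Qed.

Lemma integral_le_of_Lp_norm D t F (M : R) : 0 < t -> 0 <= M ->
  (Lp_norm nu D t F <= M%:E)%E -> (\int[nu]_(x in D) `|F x| `^ t <= (M `^ t)%:E)%E.
Proof.
move=> t0 M0; rewrite Lp_normE ?gt_eqF// => h.
set J := (X in (X <= _)%E); have J0 : (0 <= J)%E by apply: integral_ge0 => x _; exact: poweR_ge0.
have -> : J = ((J `^ t^-1) `^ t)%E by rewrite -poweRrM mulVf ?gt_eqF// poweRe1.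
rewrite -poweR_EFin; apply: gt0_ler_poweR => //; first exact: ltW.
- by rewrite in_itv/= poweR_ge0 leey.
- by rewrite in_itv/= lee_fin M0 leey.
Qed.

Lemma Lp_norm_le_of_integral D t F (M : R) : 0 < t -> 0 <= M ->
  (\int[nu]_(x in D) `|F x| `^ t <= (M `^ t)%:E)%E -> (Lp_norm nu D t F <= M%:E)%E.
Proof.
move=> t0 M0 h; rewrite Lp_normE ?gt_eqF//.
have -> : M = (M `^ t) `^ t^-1 by rewrite -powRrM mulfV ?gt_eqF// powRr1.
rewrite -poweR_EFin; apply: gt0_ler_poweR => //.
- by rewrite invr_ge0 ltW.
- by rewrite in_itv/= leey andbT; apply: integral_ge0 => x _; exact: poweR_ge0.
- by rewrite in_itv/= lee_fin powR_ge0 leey.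
Qed.

Lemma integral_null_diff D (N : set T) F : measurable D -> measurable N -> nu N = 0%E ->
  measurable_fun D F -> (forall x, D x -> 0 <= F x)%E ->
  (\int[nu]_(x in D) F x = \int[nu]_(x in D `\` N) F x)%E.
Proof. by move=> mD mN N0 mF F0; exact: ge0_negligible_integral. Qed.

Lemma measurable_abs_pow D F t : measurable_fun D F ->
  measurable_fun D (fun x => `|F x| `^ t)%E.
Proof.
move=> mF; apply: (measurableT_comp (f := fun z : \bar R => (z `^ t)%E)).
  exact: measurable_poweR.
exact: measurableT_comp.
Qed.

Lemma integral_pow_fine D (N : set T) F t : measurable D -> measurable N -> nu N = 0%E ->
  measurable_fun D F -> (forall x, D x -> ~ N x -> F x \is a fin_num) ->
  (\int[nu]_(x in D) `|F x| `^ t = \int[nu]_(x in D `\` N) (`|fine (F x)| `^ t)%R%:E)%E.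
Proof.
move=> mD mN N0 mF Ffin; rewrite (integral_null_diff mD mN N0).
- apply: eq_integral => x /set_mem[Dx Nx].
  by rewrite -[in LHS](fineK (Ffin _ Dx Nx)) abse_EFin poweR_EFin.
- exact: measurable_abs_pow.
- by move=> x _; exact: poweR_ge0.
Qed.

Lemma tail_null_diff D (N : set T) (f : T -> R) t (s : R) : measurable D ->
  measurable N -> nu N = 0%E -> measurable_fun D f ->
  tail nu D f t s = tail nu (D `\` N) f t s.
Proof.
move=> mD mN N0 mf; rewrite !tailE; apply: integral_null_diff => //.
  exact: measurable_tail.
by move=> x _; apply: erestrict_ge0 => y; rewrite lee_fin powR_ge0.
Qed.

Lemma tail_subset D' D (f : T -> R) t (s : R) : measurable D' -> measurable D -> D' `<=` D ->
  measurable_fun D f -> (tail nu D' f t s <= tail nu D f t s)%E.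
Proof.
move=> mD' mD D'D mf; rewrite !tailE; apply: ge0_subset_integral => //.
  exact: measurable_tail.
by move=> x _; apply: erestrict_ge0 => y; rewrite lee_fin powR_ge0.
Qed.

End Lp_norms.

Section embeddings.
Context {R : realType} {X : pmetricType R} {Smu Snu : set (set X)}.
Variable mu : {measure set (g_sigma_algebraType Smu) -> \bar R}.
Variable nu : {measure set (g_sigma_algebraType Snu) -> \bar R}.
Variables (E : set X) (lam K delta r1 alpha p q : R).
Hypothesis dp : doubling_pair mu nu E lam K delta r1.
Hypothesis mE : measurable (E : set (g_sigma_algebraType Snu)).
Hypothesis cnu : measure_is_complete nu.
Hypotheses (p1 : 1 <= p) (pq : p < q).
Implicit Types (u g : X -> R).

Local Notation controlled := (controlled mu E lam r1 alpha p).
Local Notation l1_bounded := (l1_bounded mu nu E).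
Local Notation ubarR := (ubarR mu).
Local Notation trunc_controlled := (trunc_controlled mu E lam r1 alpha p).

Let q0 : 0 < q. Proof. by rewrite (lt_trans _ pq)// (lt_le_trans _ p1). Qed.

Lemma ubarR_measurable u : measurable_fun (E : set (g_sigma_algebraType Snu)) (ubar mu u) ->
  measurable_fun (E : set (g_sigma_algebraType Snu)) (ubarR u).
Proof. exact: (measurableT_comp (f := fine) (fine_measurable measurableT)). Qed.

Lemma ubar_regular r theta M u g : 0 < r <= r1 -> 0 < theta ->
  theta_le mu nu E lam alpha p q r theta -> 0 < M -> controlled M u g ->
  exists N : set (g_sigma_algebraType Snu), [/\ measurable N, nu N = 0%E,
    (forall x, E x -> ~ N x -> ubar mu u x \is a fin_num) &
    forall x, E x -> ~ N x -> exists t, forall n, \sum_(i < n) osc mu u x (dyad r i) <= t].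
Proof.
move=> hr th0 hth M0 cu; have [N [mN N0 hN]] := osc_ae_summable dp p1 pq hr th0 hth M0 cu.
exists N; split => // x Ex Nx; have [t ht] := hN x Ex Nx; have [iu _ _] := cu.
by have [L [->]] := osc_summable_limit dp Ex hr (L1loc_loc iu) ht.
Qed.

Lemma weak_tail_E q' theta M e : 0 < q' -> q' < q -> 0 < theta ->
  theta_le mu nu E lam alpha p q r1 theta -> 0 < M -> 0 < e ->
  exists2 T, 0 < T & forall u g, controlled M u g -> l1_bounded M u ->
    (tail nu (E : set (g_sigma_algebraType Snu)) (ubarR u) q' T <= e%:E)%E.
Proof.
move=> q'0 q'q th0 hth M0 e0; have r10 := dp_r1 dp.
have rho0 : 0 < r1 / 2 by rewrite divr_gt0.
have rE : 2 * (r1 / 2) = r1 by rewrite mulrC divfK.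
have r2 : 2 * (r1 / 2) <= r1 by rewrite rE.
have hth2 : theta_le mu nu E lam alpha p q (2 * (r1 / 2)) theta by rewrite rE.
have hr1 : 0 < r1 <= r1 by rewrite r10 lexx.
have [F [N [Lam [_ _ mN [N0 Lam0] [_ bd]]]]] :=
  uniform_avg_bound dp mE cnu p1 pq rho0 r2 th0 hth2.
have [T T0 hT] := weak_tail dp p1 pq q'0 q'q rho0 r2 th0 hth2 M0 Lam0 e0.
exists T => // u g cu lu.
have mub := ubarR_measurable (ubar_ae_measurable dp mE cnu p1 pq hr1 th0 hth M0 cu).
rewrite (tail_null_diff q' T mE mN N0 mub).
have sub : E `\` N `<=` E by exact: subDsetl.
apply: (hT u g _ cu) => //.
- exact: measurableD.
- exact: measurable_funS mub.
- by move=> x [Ex Nx]; have [_ h] := bd M u g M0 cu lu; exact: h.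
Qed.

Lemma trunc_tail_E kappa : 0 < kappa -> exists2 c, 0 < c & forall r theta, 0 < r <= r1 ->
  0 < theta -> theta_le mu nu E lam alpha p q r theta ->
  exists2 Lam, 0 < Lam & forall M u g, 0 < M -> controlled M u g -> l1_bounded M u ->
    trunc_controlled kappa u g ->
    (tail nu (E : set (g_sigma_algebraType Snu)) (ubarR u) q (Lam * M) <=
     (c * (theta * M) `^ q)%:E)%E.
Proof.
move=> k0; have [c c0 hc] := trunc_tail alpha dp p1 pq k0.
exists c => // r theta hr th0 hth; have /andP[r0 rr1] := hr.
have rho0 : 0 < r / 2 by rewrite divr_gt0.
have rE : 2 * (r / 2) = r by rewrite mulrC divfK.
have r2 : 2 * (r / 2) <= r1 by rewrite rE.
have hr2 : 0 < 2 * (r / 2) <= r1 by rewrite rE.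
have hth2 : theta_le mu nu E lam alpha p q (2 * (r / 2)) theta by rewrite rE.
have [F [N [Lam [_ _ mN [N0 Lam0] [_ bd]]]]] :=
  uniform_avg_bound dp mE cnu p1 pq rho0 r2 th0 hth2.
exists (4 * Lam) => [|M u g M0 cu lu tc]; first by rewrite mulr_gt0.
have mub := ubarR_measurable (ubar_ae_measurable dp mE cnu p1 pq hr2 th0 hth2 M0 cu).
have [N' [mN' N'0 _ hN']] := ubar_regular hr2 th0 hth2 M0 cu.
have mNN : measurable (N `|` N') by exact: measurableU.
rewrite (tail_null_diff q (4 * Lam * M) mE mNN (measureU_eq0 mN mN' N0 N'0) mub).
have sub : E `\` (N `|` N') `<=` E by exact: subDsetl.
rewrite -mulrA; apply: (hc (r / 2) theta M (Lam * M) u g) => //.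
- exact: mulr_gt0.
- exact: measurableD.
- exact: measurable_funS mub.
- by move=> x [Ex /not_orP[Nx _]]; have [_ h] := bd M u g M0 cu lu; exact: h.
- by move=> x [Ex /not_orP[_ Nx]]; exact: hN'.
Qed.

Lemma integral_ubar_le r theta M u g t T : 0 < r <= r1 -> 0 < theta ->
  theta_le mu nu E lam alpha p q r theta -> 0 < M -> controlled M u g -> 0 < t -> 0 <= T ->
  (\int[nu]_(x in (E : set (g_sigma_algebraType Snu))) `|ubar mu u x| `^ t <=
   (T `^ t)%:E * nu E + tail nu (E : set (g_sigma_algebraType Snu)) (ubarR u) t T)%E.
Proof.
move=> hr th0 hth M0 cu t0 T0.
have mub := ubar_ae_measurable dp mE cnu p1 pq hr th0 hth M0 cu.
have mubR := ubarR_measurable mub.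
have [N [mN N0 Nfin _]] := ubar_regular hr th0 hth M0 cu.
rewrite (integral_pow_fine t mE mN N0 mub Nfin).
apply: (le_trans _ (integral_normpow_le_tail nu mE mubR t0 T0)).
apply: ge0_subset_integral => //.
- exact: measurableD.
- exact: measurable_normpow.
Qed.

Lemma in_Lp_ubar r theta M u g t T : 0 < r <= r1 -> 0 < theta ->
  theta_le mu nu E lam alpha p q r theta -> 0 < M -> controlled M u g -> 0 < t -> 0 <= T ->
  (tail nu (E : set (g_sigma_algebraType Snu)) (ubarR u) t T < +oo)%E ->
  in_Lp nu E t (ubar mu u).
Proof.
move=> hr th0 hth M0 cu t0 T0 hT; split.
  by have := ubar_ae_measurable dp mE cnu p1 pq hr th0 hth M0 cu.
rewrite Lp_normE ?gt_eqF//; apply: poweR_lty.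
apply: (le_lt_trans (integral_ubar_le hr th0 hth M0 cu t0 T0)).
by rewrite lte_add_pinfty// lte_mul_pinfty ?lee_fin ?powR_ge0// (nu_E_lty dp).
Qed.

Lemma compact_of_tails (w g : nat -> X -> R) (M t : R) :
  (forall theta, 0 < theta -> exists2 r, 0 < r <= r1 &
     theta_le mu nu E lam alpha p q r theta) ->
  0 < M -> 0 < t -> (forall n, controlled M (w n) (g n)) -> (forall n, l1_bounded M (w n)) ->
  (forall e, 0 < e -> exists2 T, 0 < T & forall n,
     (tail nu (E : set (g_sigma_algebraType Snu)) (ubarR (w n)) t T <= e%:E)%E) ->
  exists phi : nat -> nat, {homo phi : m n / (m < n)%N} /\
    exists2 v : X -> R, in_Lp nu E t (EFin \o v) &
      Lp_norm nu E t (fun x => ubar mu (w (phi n)) x - (v x)%:E)%E @[n --> \oo] --> 0%E.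
Proof.
move=> small M0 t0 cw lw tight.
have [phi [N [phi_homo mN N0 hN]]] := ae_cvg_subsequence dp mE cnu p1 pq small M0 cw lw.
have [r hr hth] := small 1 ltr01.
have mub n : measurable_fun (E : set (g_sigma_algebraType Snu)) (ubar mu (w n)).
  by have := ubar_ae_measurable dp mE cnu p1 pq hr ltr01 hth M0 (cw n).
have mubR n := ubarR_measurable (mub n).
pose S : set (g_sigma_algebraType Snu) := E `\` N.
have mS : measurable S by exact: measurableD.
have SE : S `<=` E by exact: subDsetl.
pose f n (x : g_sigma_algebraType Snu) : R := ubarR (w (phi n)) x.
(* A limsup instead of a limit, so that [v] is measurable on all of [E], including the exceptional
   null set. *)
pose v (x : g_sigma_algebraType Snu) : R := fine (limn_esup (fun n => (f n x)%:E)).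
have mvE : measurable_fun (E : set (g_sigma_algebraType Snu)) v.
  apply: (measurableT_comp (f := fine) (fine_measurable measurableT)).
  by apply: (measurable_fun_limn_esup (f := fun n x => (f n x)%:E)) => n; apply/measurable_EFinP; exact: (mubR (phi n)).
have fv x : S x -> f n x @[n --> \oo] --> v x.
  move=> [Ex Nx]; have [_ /cvg_ex[l hl]] := hN x Ex Nx.
  have hE : (f n x)%:E @[n --> \oo] --> l%:E by apply: cvg_EFin => //; exact: nearW.
  by rewrite /v (cvg_limn_einf_sup hE).2.
have mfS n : measurable_fun S (f n) by exact: measurable_funS (mubR (phi n)).
have Soo : (nu S < +oo)%E.
  apply: le_lt_trans (nu_E_lty dp mE).
  by apply: le_measure => //; apply/mem_set.
have tightS e : 0 < e -> exists2 T, 0 < T & forall n, (tail nu S (f n) t T <= e%:E)%E.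
  move=> /tight[T T0 hT]; exists T; [exact: T0|move=> n].
  apply: (@le_trans _ _ (tail nu (E : set (g_sigma_algebraType Snu)) (f n) t T)); last exact: (hT (phi n)).
  exact: (tail_subset nu t T mS mE SE (mubR (phi n))).
exists phi; split => //; exists v.
  split; first exact/measurable_EFinP.
  rewrite Lp_normE ?gt_eqF//; apply: poweR_lty.
  rewrite (integral_pow_fine t mE mN N0 (F := EFin \o v))//; last exact/measurable_EFinP.
  exact: (vitali_limit_lty mS Soo t0 mfS fv tightS).
have cv := vitali_convergence mS Soo t0 mfS fv tightS.
apply: cvge0_le => [n|e e0]; first exact: Lnorm_ge0.
have et0 : 0 < e `^ t by rewrite powR_gt0.
have /fine_cvgP[[n1 _ h1] /cvgrPdist_le/(_ _ et0)[n2 _ h2]] := cv.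
exists (maxn n1 n2) => n; rewrite geq_max => /andP[n1n n2n].
apply: Lp_norm_le_of_integral => //; first exact: ltW.
have Ffin x : E x -> ~ N x -> (ubar mu (w (phi n)) x - (v x)%:E)%E \is a fin_num.
  by move=> Ex Nx; have [h _] := hN x Ex Nx; rewrite fin_numB h.
rewrite (integral_pow_fine t mE mN N0 _ Ffin); last first.
  by apply: emeasurable_funB => //; exact/measurable_EFinP.
rewrite (eq_integral (fun x => (`|f n x - v x| `^ t)%:E)); last first.
  move=> x /set_mem[Ex Nx]; have [h _] := hN x Ex Nx.
  by rewrite fineB// h.
have := h2 n n2n; rewrite /= sub0r normrN => /(le_trans (ler_norm _)).
by rewrite -lee_fin fineK//; exact: h1.
Qed.

End embeddings.

(** * From the assumptions on the class to the local estimates *)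

Section hypotheses.
Context {R : realType} {X : pmetricType R} {Smu Snu : set (set X)}.
Variable mu : {measure set (g_sigma_algebraType Smu) -> \bar R}.
Variable nu : {measure set (g_sigma_algebraType Snu) -> \bar R}.
Variables (E : set X) (lam r0 r1 alpha p : R).
Hypotheses (p1 : 1 <= p) (alpha0 : 0 < alpha) (r10 : r1 <= r0).
Hypothesis omu : forall U : set X, open U -> <<s Smu >> U.

Let p0 : 0 < p. Proof. by rewrite (lt_le_trans _ p1). Qed.

Lemma diam_ball_ge0 (x : X) r : 0 < r -> 0 <= diam (ball x r) <= 2 * r.
Proof.
move=> rpos.
have ub : ubound [set mdist z.1 z.2 | z in ball x r `*` ball x r] (2 * r).
  move=> _ [[y z] /= [xy xz] <-].
  have yz := ball_triangle (ball_sym xy) xz.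
  by move: yz; rewrite ballEmdist/= mulr_natl mulr2n => /ltW.
have in0 : [set mdist z.1 z.2 | z in ball x r `*` ball x r] 0.
  by exists (x, x); rewrite /= ?mdistxx//; split; exact: ballxx.
apply/andP; split.
  by apply: ub_le_sup => //; exists (2 * r).
by apply: ge_sup => //; exists 0.
Qed.

Lemma controlled_of_gradient M u g : L1loc mu u ->
  poincare_gradient mu alpha p lam r0 E u g -> 0 < M ->
  (Lp_norm mu setT p (EFin \o g) <= M%:E)%E -> controlled mu E lam r1 alpha p M u g.
Proof.
move=> iu [g0 [mg _] hg] M0 hM; split => //.
- split => //; first exact/measurable_EFinP.
  by move=> x r Ex /andP[rp rr1]; rewrite mul1r; apply: hg => //; rewrite rp (le_trans rr1).
- have := integral_le_of_Lp_norm p0 (ltW M0) hM; apply: le_trans.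
  rewrite le_eqVlt; apply/orP; left; apply/eqP.
  by apply: eq_integral => y _ /=; rewrite ger0_norm.
Qed.

Lemma norm_bounds NY (G : (X -> R) -> X -> R) u (M : R) :
  NY = norm_E_nu mu nu p E G \/ NY = norm_X_mu mu p G -> (NY u <= M%:E)%E ->
  (Lp_norm mu setT p (EFin \o G u) <= M%:E)%E /\ l1_bounded mu nu E M u.
Proof.
have le0 (d : measure_display) (T : measurableType d) (m : {measure set T -> \bar R}) D t F :
  (0 <= Lp_norm m D t F)%E by exact: Lnorm_ge0.
case=> -> h; split.
- by apply: le_trans h; rewrite /norm_E_nu leeDr.
- by left; rewrite -Lp_norm1E; apply: le_trans h; rewrite /norm_E_nu leeDl.
- by apply: le_trans h; rewrite /norm_X_mu leeDr.
- right; apply: le_trans (le_trans _ h); last by rewrite /norm_X_mu; apply: leeDl.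
  by rewrite Lp_norm1E.
Qed.

Lemma trunc_controlled_of_property (Y : set (X -> R)) G :
  (forall u, Y u -> L1loc mu u) ->
  (forall u, Y u -> poincare_gradient mu alpha p lam r0 E u (G u)) ->
  truncation_property mu alpha p lam r0 E Y G ->
  exists2 kappa, 0 < kappa & forall u, Y u ->
    trunc_controlled mu E lam r1 alpha p kappa u (G u).
Proof.
(* The diameter of a ball is at most twice its radius, and [|C| + 1] is positive whatever the sign
   of [C]. *)
move=> Yl hG [C hC]; exists ((`|C| + 1) * 2 `^ alpha).
  by rewrite mulr_gt0 ?powR_gt0// ltr_wpDl.
move=> u Yu a b ab; have [g0 [/measurable_EFinP mg _] _] := hG u Yu; split.
- by move=> y; rewrite /trunc_gradient mulr_ge0.
- apply: measurable_funM => //; apply: measurable_indic.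
  have mu_ := L1loc_measurable omu (Yl u Yu).
  by have := mu_ measurableT _ (measurable_itv `]a, b[); rewrite setTI; congr measurable;
    apply/seteqP; split => y /=; rewrite in_itv.
- move=> x r Ex /andP[rp rr1].
  have hr : 0 < r <= r0 by rewrite rp (le_trans rr1).
  apply: (le_trans (hC u Yu a b ab x r Ex hr)).
  apply: lee_wpmul2r; first exact: poweR_ge0.
  rewrite lee_fin -mulrA -powRM// ?(ltW rp)//.
  have /andP[d0 d2] := diam_ball_ge0 x rp.
  apply: (@le_trans _ _ (`|C| * diam (ball x r) `^ alpha)).
    by rewrite ler_wpM2r ?powR_ge0// ler_norm.
  apply: ler_pM; rewrite ?powR_ge0 ?lerDl//.
  by rewrite ge0_ler_powR ?nnegrE ?(ltW alpha0)// mulr_ge0// ltW.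
Qed.

End hypotheses.

Lemma Theta_mono {R : realType} {X : pmetricType R} {Smu Snu : set (set X)}
    (mu : {measure set (g_sigma_algebraType Smu) -> \bar R})
    (nu : {measure set (g_sigma_algebraType Snu) -> \bar R}) (alpha p q lam : R) (E : set X) s r :
  s <= r -> (Theta mu nu alpha p q lam E s <= Theta mu nu alpha p q lam E r)%E.
Proof.
move=> sr; apply: le_ereal_sup => _ [t /andP[t0 ts] <-].
by exists t => //; rewrite /= t0 (le_trans ts).
Qed.

Theorem theorem5p1 (R : realType) (X : pmetricType R) (Smu Snu : set (set X))
  (mu : {measure set (g_sigma_algebraType Smu) -> \bar R})
  (nu : {measure set (g_sigma_algebraType Snu) -> \bar R})
  (hmu : complete_borel_measure mu) (hnu : complete_borel_measure nu)
  (E : set X)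
  (mE : measurable (E : set (g_sigma_algebraType Snu)))
  (nuE : (0 < nu E)%E)
  (p q alpha r0 lambda : R)
  (p_ge1 : 1 <= p) (pq : p < q) (alpha_gt0 : 0 < alpha) (r0_gt0 : 0 < r0)
  (lambda_ge1 : 1 <= lambda)
  (tbE : totally_bounded E)
  (C delta : R) (C_gt0 : 0 < C) (delta_gt0 : 0 < delta)
  (hdoubling : forall (x : X) (r' r : R), E x -> 0 < r' -> r' < r -> r <= r0 ->
     [/\ [/\ (0 < mu (ball x (2 * r)))%E,
             (mu (ball x (2 * r)) <= C%:E * mu (ball x r))%E
           & (C%:E * mu (ball x r) < +oo)%E],
         [/\ (0 < nu (ball x (2 * r)))%E,
             (nu (ball x (2 * r)) <= C%:E * nu (ball x r))%E
           & (C%:E * nu (ball x r) < +oo)%E]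
       & (nu (ball x r') / nu (ball x r) <= (C * (r' / r) `^ delta)%:E)%E])
  (Y : set (X -> R)) (G : (X -> R) -> X -> R)
  (YP : Y `<=` poincare_space mu alpha p lambda r0 E)
  (hG : forall u, Y u -> poincare_gradient mu alpha p lambda r0 E u (G u))
  (NY : (X -> R) -> \bar R)
  (hNY : NY = norm_E_nu mu nu p E G \/ NY = norm_X_mu mu p G)
  (NY_fin : forall u, Y u -> (NY u < +oo)%E) :
  ((Theta mu nu alpha p q lambda E r0 < +oo)%E ->
     forall q' : R, 1 <= q' -> q' < q -> compact_embedding mu nu Y NY E q')
  /\
  (truncation_property mu alpha p lambda r0 E Y G ->
     ((Theta mu nu alpha p q lambda E r0 < +oo)%E ->
        bounded_embedding mu nu Y NY E q)
     /\
     (Theta mu nu alpha p q lambda E r @[r --> 0^'+] --> 0%E ->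
        compact_embedding mu nu Y NY E q)).
Proof.
have [omu _] := hmu; have [onu cnu] := hnu.
have [K [r1 [r10 dp]]] :=
  doubling_pair_exists omu onu tbE r0_gt0 lambda_ge1 C_gt0 delta_gt0 hdoubling.
have q0 : 0 < q by rewrite (lt_trans _ pq)// (lt_le_trans _ p_ge1).
have hr1 : 0 < r1 <= r1 by rewrite (dp_r1 dp) lexx.
have Yl u : Y u -> L1loc mu u by move=> /YP[].
have Yc M u : Y u -> 0 < M -> (NY u <= M%:E)%E ->
    controlled mu E lambda r1 alpha p M u (G u) /\ l1_bounded mu nu E M u.
  move=> Yu M0 /(norm_bounds hNY)[h1 h2]; split => //.
  exact: (controlled_of_gradient p_ge1 r10 (Yl u Yu) (hG u Yu) M0 h1).
have NYM u : Y u -> exists2 M : R, 0 < M & (NY u <= M%:E)%E.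
  move=> Yu; exists (Num.max 1 (fine (NY u))); first by rewrite lt_max ltr01.
  have := NY_fin u Yu; case: (NY u) => [s|//|] _; last exact: leNye.
  by rewrite lee_fin le_max lexx orbT.
have bounded_seq (w : nat -> X -> R) : (exists M : R, forall n, NY (w n) <= M%:E)%E ->
    exists2 M : R, 0 < M & forall n, (NY (w n) <= M%:E)%E.
  move=> [M hM]; exists (Num.max 1 M); first by rewrite lt_max ltr01.
  by move=> n; rewrite (le_trans (hM n))// lee_fin le_max lexx orbT.
have Theta_fin : (Theta mu nu alpha p q lambda E r0 < +oo)%E -> exists2 theta, 0 < theta &
    theta_le mu nu E lambda alpha p q r1 theta.
  move=> hT; exists (Num.max 1 (fine (Theta mu nu alpha p q lambda E r0))).
    by rewrite lt_max ltr01.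
  apply: (Theta_theta_le dp) => //; apply: (le_trans (Theta_mono _ _ _ _ _ _ _ r10)).
  move: hT; case: (Theta _ _ _ _ _ _ _ _) => [s|//|] _; last exact: leNye.
  by rewrite lee_fin le_max lexx orbT.
split=> [/Theta_fin[theta th0 hth] q' q'1 q'q|tp].
  have q'0 : 0 < q' by rewrite (lt_le_trans _ q'1).
  split.
    move=> u Yu; have [M M0 hM] := NYM u Yu; have [cu lu] := Yc M u Yu M0 hM.
    have [T T0 hT] := weak_tail_E dp mE cnu p_ge1 pq q'0 q'q th0 hth M0 ltr01.
    apply: (in_Lp_ubar dp mE cnu p_ge1 pq hr1 th0 hth M0 cu q'0 (ltW T0)).
    by rewrite (le_lt_trans (hT u _ cu lu))// ltry.
  move=> w Yw /bounded_seq[M M0 hM].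
  (* An exponent below [q] makes the scaled quantity small at small radii, and one above [p] keeps
     the weak type estimate; the tails still use [q] itself. *)
  pose q2 := (p + q) / 2.
  have pq2 : p < q2 by rewrite /q2; lra.
  have q2q : q2 < q by rewrite /q2; lra.
  have q20 : 0 < q2 by rewrite (lt_trans _ pq2)// (lt_le_trans _ p_ge1).
  have cw n := (Yc M (w n) (Yw n) M0 (hM n)).1.
  have lw n := (Yc M (w n) (Yw n) M0 (hM n)).2.
  apply: (compact_of_tails dp mE cnu p_ge1 pq2 _ M0 q'0 cw lw).
    by move=> s s0; have := theta_small dp q20 q2q th0 hth s0.
  move=> e e0; have [T T0 hT] := weak_tail_E dp mE cnu p_ge1 pq q'0 q'q th0 hth M0 e0.
  by exists T => // n; apply: hT.
have [kappa kappa0 tc] := trunc_controlled_of_property alpha_gt0 r10 omu Yl hG tp.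
have [c c0 hc] := trunc_tail_E alpha dp mE cnu p_ge1 pq kappa0.
split=> [/Theta_fin[theta th0 hth]|hT].
  have [Lam L0 hL] := hc r1 theta hr1 th0 hth.
  split.
    move=> u Yu; have [M M0 hM] := NYM u Yu; have [cu lu] := Yc M u Yu M0 hM.
    apply: (in_Lp_ubar dp mE cnu p_ge1 pq hr1 th0 hth M0 cu q0 (ltW (mulr_gt0 L0 M0))).
    by rewrite (le_lt_trans (hL M u _ M0 cu lu (tc u Yu)))// ltry.
  (* Collects the coefficients of [M ^ q] in [(Lam * M) ^ q * nu E] and in the tail bound
     [c * (theta * M) ^ q]. *)
  pose b := Lam `^ q * fine (nu E) + c * theta `^ q.
  have b0 : 0 <= b by rewrite addr_ge0 ?mulr_ge0 ?powR_ge0 ?fine_ge0// ltW.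
  have nuEfin : nu E = (fine (nu E))%:E.
    by rewrite fineK// ge0_fin_numE// (nu_E_lty dp).
  exists (b `^ q^-1) => u Yu.
  have key M : 0 < M -> (NY u <= M%:E)%E ->
      (Lp_norm nu E q (ubar mu u) <= (b `^ q^-1 * M)%:E)%E.
    move=> M0 hM; have [cu lu] := Yc M u Yu M0 hM.
    apply: Lp_norm_le_of_integral => //.
      by rewrite mulr_ge0 ?powR_ge0// ltW.
    apply: (le_trans (integral_ubar_le dp mE cnu p_ge1 pq hr1 th0 hth M0 cu q0
      (ltW (mulr_gt0 L0 M0)))).
    apply: (@le_trans _ _ (((Lam * M) `^ q)%:E * nu E + (c * (theta * M) `^ q)%:E)%E).
      by rewrite leeD2l// (hL M u _ M0 cu lu (tc u Yu)).
    rewrite nuEfin -EFinM -EFinD lee_fin.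
    rewrite (powRM q (ltW L0) (ltW M0)) (powRM q (ltW th0) (ltW M0)).
    rewrite (powRM q (powR_ge0 _ _) (ltW M0)) -powRrM mulVf ?gt_eqF// powRr1// /b.
    lra.
  have NY0 : (0 <= NY u)%E.
    by case: hNY => ->; rewrite /norm_E_nu /norm_X_mu adde_ge0// Lnorm_ge0.
  have NYE : NY u = (fine (NY u))%:E by rewrite fineK// ge0_fin_numE// NY_fin.
  have s0 : 0 <= fine (NY u) by apply: fine_ge0.
  move: NYE s0; set s := fine (NY u) => NYE s0; rewrite NYE in key *.
  (* [key] asks for a positive [M] while the norm of [u] may vanish, hence the additional room
     [e]. *)
  rewrite -EFinM; apply/lee_addgt0Pr => e e0.
  have bp : 0 < b `^ q^-1 + 1 by rewrite ltr_wpDl ?powR_ge0.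
  have M0 : 0 < s + e / (b `^ q^-1 + 1) by rewrite ltr_wpDl// divr_gt0.
  apply: (le_trans (key _ M0 _)); first by rewrite lee_fin lerDl divr_ge0// ltW.
  rewrite -EFinD lee_fin mulrDr lerD2l mulrA ler_pdivrMr// mulrC ler_pM2l// lerDl.
  exact: ler01.
have small theta : 0 < theta -> exists2 r, 0 < r <= r1 &
    theta_le mu nu E lambda alpha p q r theta.
  move=> th0.
  have near_theta : \forall r \near 0^'+, (Theta mu nu alpha p q lambda E r < theta%:E)%E.
    by apply: (hT [set z | z < theta%:E]%E); exact: open_ereal_lt'.
  have near_r := filterI (filterI near_theta (nbhs_right_lt (dp_r1 dp)))
    (nbhs_right_gt (0 : R)).
  have [r [[Tr rr1] rpos]] := @filter_ex _ _ (at_right_proper_filter 0) _ (near_r _ _).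
  exists r; first by rewrite rpos ltW.
  by apply: (Theta_theta_le dp); exact: ltW.
split.
  (* Here only the behaviour of [Theta] near [0] is given, so integrability is obtained at a radius
     where the bound [1] is admissible. *)
  move=> u Yu; have [M M0 hM] := NYM u Yu; have [cu lu] := Yc M u Yu M0 hM.
  have [r hr hth] := small 1 ltr01.
  have [Lam L0 hL] := hc r 1 hr ltr01 hth.
  apply: (in_Lp_ubar dp mE cnu p_ge1 pq hr ltr01 hth M0 cu q0 (ltW (mulr_gt0 L0 M0))).
  by rewrite (le_lt_trans (hL M u _ M0 cu lu (tc u Yu)))// ltry.
move=> w Yw /bounded_seq[M M0 hM].
have cw n := (Yc M (w n) (Yw n) M0 (hM n)).1.
have lw n := (Yc M (w n) (Yw n) M0 (hM n)).2.
apply: (compact_of_tails dp mE cnu p_ge1 pq small M0 q0 cw lw) => e e0.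
(* Makes the tail bound [c * (theta * M) ^ q] equal to [e]. *)
pose theta := (e / c) `^ q^-1 / M.
have th0 : 0 < theta by rewrite divr_gt0// powR_gt0// divr_gt0.
have [r hr hth] := small _ th0.
have [Lam L0 hL] := hc r theta hr th0 hth.
exists (Lam * M) => [|n]; first exact: mulr_gt0.
apply: (le_trans (hL M (w n) _ M0 (cw n) (lw n) (tc _ (Yw n)))); rewrite lee_fin.
rewrite divfK ?gt_eqF// -powRrM mulVf ?gt_eqF// powRr1 ?divr_ge0 ?(ltW e0) ?(ltW c0)//.
by rewrite mulrC divfK// gt_eqF.
Qed.
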